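(* The following two statements are equivalent: (A) every planar graph on $n$ vertices contains an induced forest on at least $n/2$ vertices; (B) every planar triangulation $G$ satisfies $\kappa_\rho(G) \geq \frac{1}{2}$.
   Context: A planar triangulation is a simple planar graph to which no edge can be added while keeping it simple and planar (equivalently, a simple graph with an edge-maximal embedding in the plane). For a tree $T$, $\Lambda(T)$ denotes its set of leaves. For a connected graph $G$, $\tau_G$ is the set of spanning trees of $G$. The robust connectivity of $G$ is $\kappa_\rho(G) = \min_{\emptyset \neq R \subseteq V(G)} \max_{T \in \tau_G} \frac{|R \cap \Lambda(T)|}{|R|}$. *)

(* Defs.v *)
From HB Require Import structures.
From mathcomp Require Import all_boot all_order all_algebra.
From mathcomp Require Import all_classical all_reals all_analysis.

Set Implicit Arguments.
Unset Strict Implicit.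
Unset Printing Implicit Defensive.

Import Order.TTheory GRing.Theory Num.Theory.
Import numFieldNormedType.Exports.

Local Open Scope ring_scope.

(* A finite simple graph on the vertex set V is given by its set E of edges, *)
(* each edge being the two-element set of its ends.                          *)

Section Graphs.
Variable V : finType.
Implicit Types (E T : {set {set V}}) (F X : {set V}).

Definition simple_graph E : Prop := forall e, e \in E -> #|e| = 2%N.

Definition adj E : rel V := fun x y => [set x; y] \in E.

Definition connected_graph E : Prop := forall x y : V, connect (adj E) x y.

Definition is_cycle E (c : seq V) : Prop :=
  [/\ (2 < size c)%N, uniq c & cycle (adj E) c].

Definition is_forest E : Prop := forall c : seq V, ~ is_cycle E c.

Definition is_tree E : Prop := connected_graph E /\ is_forest E.

(* The edge set of G[F]. The vertices outside F remain, as isolated vertices; *)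
(* this is immaterial for being a forest.                                     *)
Definition induced_edges E F : {set {set V}} := [set e in E | e \subset F].

Definition induces_forest E F : Prop := is_forest (induced_edges E F).

(* Vertices of degree one; so the one-vertex tree has no leaf. *)
Definition leaves T : {set V} :=
  [set v | #|[set e in T | v \in e]| == 1%N].

Definition spanning_trees E : {set {set {set V}}} :=
  [set T : {set {set V}} | (T \subset E) && `[< is_tree T >]].

(* For a connected graph with at least one vertex both ranges are nonempty and *)
(* the ratios lie in [0, 1], so the default values 1 and 0 play no role.       *)
Definition robust_connectivity E : rat :=
  \big[Order.min/1]_(X : {set V} | X != finset.set0)
    \big[Order.max/0]_(T in spanning_trees E)
      (#|X :&: leaves T|%:R / #|X|%:R).

End Graphs.

Section Planarity.
Local Open Scope classical_set_scope.
Variables (R : realType) (V : finType).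

(* g, restricted to [0, 1], is a Jordan arc in the plane R * R from p to q. *)
Definition is_arc (g : R -> R * R) (p q : R * R) : Prop :=
  [/\ {within `[0, 1], continuous g},
      {in `[0, 1]%R &, injective g}, g 0 = p & g 1 = q].

Definition arc_trace (g : R -> R * R) : set (R * R) :=
  g @` `[0, 1].

Record is_drawing (E : {set {set V}})
    (pos : V -> R * R) (arc : {set V} -> R -> R * R) : Prop := IsDrawing {
  drawing_inj : injective pos;
  drawing_ends : forall e, e \in E ->
    exists x y, e = [set x; y]%SET /\ is_arc (arc e) (pos x) (pos y);
  drawing_vertex : forall e v, e \in E ->
    arc_trace (arc e) (pos v) -> v \in e;
  drawing_cross : forall e f p, e \in E -> f \in E -> e <> f ->
    arc_trace (arc e) p -> arc_trace (arc f) p ->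
    exists2 v, v \in e :&: f & p = pos v
}.

Definition planar (E : {set {set V}}) : Prop :=
  exists pos arc, is_drawing E pos arc.

Definition planar_triangulation (E : {set {set V}}) : Prop :=
  [/\ simple_graph E, planar E &
      forall e : {set V}, #|e| = 2%N -> e \notin E -> ~ planar (e |: E)].

End Planarity.

Arguments planar R {V} E.
Arguments planar_triangulation R {V} E.

(* Main.v *)
Require Import Defs.
From HB Require Import structures.
From mathcomp Require Import all_boot all_order all_algebra.
From mathcomp Require Import all_classical all_reals all_analysis.
From mathcomp Require Import zify ring lra fintype finset.

(* A drawing is discretised to a layout in the square grid: vertices become
   disjoint square balls of lattice points and edges disjoint lattice paths
   joining them; conversely a layout is drawn with radial segments and lattice
   paths. On the grid the Jordan curve theorem is elementary: a closed chain
   colours the unit faces by the parity of the number of horizontal edges above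
   them, and the colour changes exactly across the chain; and if a face
   colouring changes only across a drawn subgraph, the edges where it changes
   form a subgraph with no vertex of degree one, so a drawn forest does not
   separate the faces.

   Hence, if F induces a forest and G - F is disconnected, two components of
   G - F see a common face region and an edge joining them can be drawn. So in a
   triangulation every vertex set whose removal disconnects contains a cycle.
   Conversely this property forces edge-maximality: if uv is not an edge, some
   neighbours of u, all adjacent to the component D of v in G - N(u), contain a
   cycle C, and u, D and C form a K5 minor in G + uv.

   (A) => (B): for a vertex set X, a large induced forest F of G[X] has connected
   and dominating complement, so some spanning tree has all of F as leaves.

   (B) => (A): put a new vertex on both sides of every edge of the drawing, and
   add edges as long as the new vertices stay separated by the cycles of G; the
   result is a triangulation. The old vertices that are leaves of a spanning tree
   induce a forest: a cycle of such leaves would separate two new vertices, but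
   the tree path joining them avoids its leaves. *)

Set Implicit Arguments.
Unset Strict Implicit.
Unset Printing Implicit Defensive.

Import Order.TTheory GRing.Theory Num.Theory.
Import numFieldNormedType.Exports.

Local Open Scope ring_scope.

(** A vertex has to be a ball because a lattice point has only four neighbours; balls also let the
    paths of all edges be pairwise disjoint, even at a common end. Doubling the grid is the way to
    make room: midpoints of grid edges and centres of faces become lattice points, so a route
    through faces turns into a lattice path off the drawing. Separation is always expressed by
    two-colourings of the faces, so that neither regions nor their boundaries are needed.

    The obstacle in (B) => (A) is that a triangulation is maximal against all drawings, while the
    graph built there is grown inside one layout. The bridge is [cyclic_separators], which mentions
    no drawing: it holds when one layout admits no further edge, and it implies maximality for every
    drawing. The new vertices are there because a cycle of the given graph may have no vertex on one
    of its sides, and a spanning tree notices a separation only between vertices. The constant 1/2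
    survives because robust connectivity is applied to the set of old vertices alone, however many
    new ones there are. *)

Definition pt := (int * int)%type.

(** * Lattice paths, faces and two-colourings of the faces *)

Definition adjp (p q : pt) : bool := `|p.1 - q.1| + `|p.2 - q.2| == 1.

Definition steps (s : seq pt) := zip s (behead s).

Definition same_edge (a b : pt) (st : pt * pt) : bool :=
  (st == (a, b)) || (st == (b, a)).

Definition inedge (s : seq pt) (a b : pt) : bool := has (same_edge a b) (steps s).

Lemma adjp_sym p q : adjp p q = adjp q p.
Proof. by rewrite /adjp; apply/idP/idP; lia. Qed.

Lemma inedge_sym s a b : inedge s a b = inedge s b a.
Proof. by apply: eq_has => st; rewrite /same_edge orbC. Qed.

Lemma steps_cons p q s : steps (p :: q :: s) = (p, q) :: steps (q :: s).
Proof. by []. Qed.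

Lemma mem_steps (s : seq pt) a b : (a, b) \in steps s -> (a \in s) && (b \in s).
Proof.
elim: s => [|p [|q s] IH] //; rewrite steps_cons in_cons => /orP[/eqP[-> ->]|/IH /andP[h1 h2]].
  by rewrite !inE !eqxx !orbT.
by apply/andP; split; rewrite in_cons ?h1 ?h2 orbT.
Qed.

Lemma inedge_mem s a b : inedge s a b -> (a \in s) && (b \in s).
Proof.
case/hasP => -[p q] /mem_steps /andP[hp hq]; rewrite /same_edge !xpair_eqE.
by case/orP => /andP[/eqP<- /eqP<-]; rewrite hp hq.
Qed.

Lemma steps_adjp s a b : sorted adjp s -> (a, b) \in steps s -> adjp a b.
Proof.
elim: s => [|p [|q s] IH] // /andP[hpq hs].
rewrite steps_cons in_cons => /orP[/eqP[-> ->] //|]; exact: IH.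
Qed.

Lemma inedge_adjp s a b : sorted adjp s -> inedge s a b -> adjp a b.
Proof.
move=> hs /hasP[[p q] hpq] /orP[] /eqP[<- <-]; first exact: steps_adjp hpq.
by rewrite adjp_sym; exact: steps_adjp hpq.
Qed.

(* A face is a unit square of the grid, named by its lower left corner. *)

Definition side1 (p q : pt) : pt :=
  if p.1 == q.1 then (p.1 - 1, Order.min p.2 q.2) else (Order.min p.1 q.1, p.2 - 1).

(** [side1] is the face to the left of a vertical edge or below a horizontal one, [side2] is the
    face across; both formulas are meant for adjacent points only. *)
Definition side2 (p q : pt) : pt := (Order.min p.1 q.1, Order.min p.2 q.2).

Definition dif (col : pt -> bool) p q : bool := col (side1 p q) (+) col (side2 p q).

(** A colouring stands for a set of faces; flatness says that the boundary of this set lies in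
    [K]. *)
Definition flat (K : rel pt) (col : pt -> bool) : Prop :=
  forall p q, adjp p q -> ~~ K p q -> dif col p q = false.

Lemma side1_sym p q : adjp p q -> side1 p q = side1 q p.
Proof.
move=> h; rewrite /side1 [q.1 == _]eq_sym minC; case: eqP => [->|hn].
  by congr (_, _).
by rewrite [Order.min q.1 _]minC; congr (_, _); move: h; rewrite /adjp; lia.
Qed.

Lemma side2_sym p q : side2 p q = side2 q p.
Proof. by rewrite /side2 [Order.min q.1 _]minC [Order.min q.2 _]minC. Qed.

Lemma dif_sym col p q : adjp p q -> dif col p q = dif col q p.
Proof. by move=> h; rewrite /dif side1_sym // side2_sym. Qed.

Lemma side_vert x y : side1 (x, y) (x, y + 1) = (x - 1, y).
Proof. by rewrite /side1 eqxx /=; congr (_, _); lia. Qed.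

Lemma side_hor x y : side1 (x, y) (x + 1, y) = (x, y - 1).
Proof. by rewrite /side1 /= ifF; [congr (_, _); lia | lia]. Qed.

Lemma side2_vert x y : side2 (x, y) (x, y + 1) = (x, y).
Proof. by rewrite /side2 /=; congr (_, _); lia. Qed.

Lemma side2_hor x y : side2 (x, y) (x + 1, y) = (x, y).
Proof. by rewrite /side2 /=; congr (_, _); lia. Qed.

Lemma dif_vert col x y : dif col (x, y) (x, y + 1) = col (x - 1, y) (+) col (x, y).
Proof. by rewrite /dif side_vert side2_vert. Qed.

Lemma dif_hor col x y : dif col (x, y) (x + 1, y) = col (x, y - 1) (+) col (x, y).
Proof. by rewrite /dif side_hor side2_hor. Qed.

Lemma adjpP p q : adjp p q ->
  [\/ q = (p.1, p.2 + 1), q = (p.1 + 1, p.2), p = (q.1, q.2 + 1) | p = (q.1 + 1, q.2)].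
Proof.
case: p q => [x y] [x' y']; rewrite /adjp /= => h.
have : [\/ x' = x /\ y' = y + 1, x' = x + 1 /\ y' = y,
          x = x' /\ y = y' + 1 | x = x' + 1 /\ y = y'].
  have [?|[?|[?|?]]] : (x' = x /\ y' = y + 1) \/ ((x' = x + 1 /\ y' = y) \/
          ((x = x' /\ y = y' + 1) \/ (x = x' + 1 /\ y = y'))) by lia.
  - exact: Or41.
  - exact: Or42.
  - exact: Or43.
  - exact: Or44.
by case=> -[-> ->]; [exact: Or41|exact: Or42|exact: Or43|exact: Or44].
Qed.

Lemma adjp_vert x y : adjp (x, y) (x, y + 1).
Proof. by rewrite /adjp /=; lia. Qed.
Lemma adjp_hor x y : adjp (x, y) (x + 1, y).
Proof. by rewrite /adjp /=; lia. Qed.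

(** The sides of an edge have simple formulas for steps north and east only; symmetry supplies the
    other two directions. *)
Lemma edge_ind (P : pt -> pt -> Prop) :
  (forall p q, adjp p q -> P p q -> P q p) ->
  (forall x y, P (x, y) (x, y + 1)) -> (forall x y, P (x, y) (x + 1, y)) ->
  forall p q, adjp p q -> P p q.
Proof.
move=> hs hv hh [x y] [x' y'] h; case: (adjpP h) => /= -[-> ->] //.
  by apply: hs; rewrite ?adjp_vert.
by apply: hs; rewrite ?adjp_hor.
Qed.

Definition corner (f p : pt) : bool := (p.1 - 1 <= f.1 <= p.1) && (p.2 - 1 <= f.2 <= p.2).

Lemma cornerP f p : corner f p ->
  [\/ f = p, f = (p.1 - 1, p.2), f = (p.1, p.2 - 1) | f = (p.1 - 1, p.2 - 1)].
Proof.
case: f p => [a b] [x y]; rewrite /corner /= => h.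
have [ha|ha] : a = x \/ a = x - 1 by lia.
  have [hb|hb] : b = y \/ b = y - 1 by lia.
    by apply: Or41; rewrite ha hb.
  by apply: Or43; rewrite ha hb.
have [hb|hb] : b = y \/ b = y - 1 by lia.
  by apply: Or42; rewrite ha hb.
by apply: Or44; rewrite ha hb.
Qed.

Lemma corner_side1 p q : adjp p q -> corner (side1 p q) p.
Proof. by move=> h; rewrite /corner /side1; move: h; rewrite /adjp; case: ifP => /=; lia. Qed.

Lemma corner_side2 p q : adjp p q -> corner (side2 p q) p.
Proof. by rewrite /corner /side2 /adjp /=; lia. Qed.

Lemma dif_west col x y : dif col (x, y) (x - 1, y) = col (x - 1, y - 1) (+) col (x - 1, y).
Proof.
rewrite dif_sym; last by rewrite /adjp /=; lia.
by have := dif_hor col (x - 1) y; rewrite subrK.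
Qed.

Lemma dif_south col x y : dif col (x, y) (x, y - 1) = col (x - 1, y - 1) (+) col (x, y - 1).
Proof.
rewrite dif_sym; last by rewrite /adjp /=; lia.
by have := dif_vert col x (y - 1); rewrite subrK.
Qed.

(** Points and faces share a type: [col p] is the colour of the face with lower left corner [p]. The
    four faces around [p] are linked through the edges at [p], none of which is in [K]. *)
Lemma flat_corner K col p f : flat K col -> (forall q, adjp p q -> ~~ K p q) ->
  corner f p -> col f = col p.
Proof.
case: p => x y hK hp /cornerP /=.
have hN := hK _ _ (adjp_vert x y) (hp _ (adjp_vert x y)).
have hE := hK _ _ (adjp_hor x y) (hp _ (adjp_hor x y)).
have aW : adjp (x, y) (x - 1, y) by rewrite /adjp /=; lia.
have hW := hK _ _ aW (hp _ aW).
move: hN hE hW; rewrite dif_vert dif_hor dif_west.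
by move=> h1 h2 h3 []-> //; move: h1 h2 h3; case: (col _) (col _) (col _) (col _) => -[] [] [].
Qed.

Lemma flat_adj K col p q : flat K col -> (forall q', adjp p q' -> ~~ K p q') ->
  (forall q', adjp q q' -> ~~ K q q') -> adjp p q -> col p = col q.
Proof.
move=> hK hp hq h.
have h' : adjp q p by rewrite adjp_sym.
rewrite -(flat_corner hK hp (corner_side2 h)) side2_sym.
by rewrite (flat_corner hK hq (corner_side2 h')).
Qed.

Lemma flat_walk K col p s : flat K col -> path adjp p s ->
  (forall a b, a \in p :: s -> adjp a b -> ~~ K a b) -> col p = col (last p s).
Proof.
move=> hK; elim: s p => [|q s IH] p //= /andP[hpq hs] hoff.
rewrite (flat_adj hK _ _ hpq).
- by apply: IH => // a b ha; apply: hoff; rewrite inE ha orbT.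
- by move=> b; apply: hoff; rewrite mem_head.
- by move=> b; apply: hoff; rewrite !inE eqxx orbT.
Qed.

Lemma adjp_south x y : adjp (x, y) (x, y - 1).
Proof. by rewrite /adjp /=; lia. Qed.
Lemma adjp_west x y : adjp (x, y) (x - 1, y).
Proof. by rewrite /adjp /=; lia. Qed.

Lemma adjp_dirs x y q : adjp (x, y) q ->
  [\/ q = (x, y + 1), q = (x + 1, y), q = (x, y - 1) | q = (x - 1, y)].
Proof.
case: q => x' y'; rewrite /adjp /= => h.
have [[-> ->]|[[-> ->]|[[-> ->]|[-> ->]]]] : (x' = x /\ y' = y + 1) \/ ((x' = x + 1 /\ y' = y) \/
        ((x' = x /\ y' = y - 1) \/ (x' = x - 1 /\ y' = y))) by lia.
- exact: Or41.
- exact: Or42.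
- exact: Or43.
- exact: Or44.
Qed.

Lemma dirs_uniq (x y : int) : uniq [:: (x, y + 1); (x + 1, y); (x, y - 1); (x - 1, y)].
Proof. by rewrite /= !inE !xpair_eqE; lia. Qed.

(** Each of the four faces around [p] borders two of the four edges at [p], so the number of edges
    with a change is even; if only two edges may change, both do or neither does. *)
Lemma dif_thru col p a b : adjp p a -> adjp p b -> a != b ->
  (forall q, adjp p q -> q != a -> q != b -> dif col p q = false) ->
  dif col p a = dif col p b.
Proof.
case: p => x y ha hb hab hq.
have := dirs_uniq x y; have := adjp_vert x y; have := adjp_hor x y.
have := adjp_south x y; have := adjp_west x y.
have := adjp_dirs ha; have := adjp_dirs hb.
have : dif col (x, y) (x, y + 1) (+) dif col (x, y) (x + 1, y) (+)
       dif col (x, y) (x, y - 1) (+) dif col (x, y) (x - 1, y) = false.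
  rewrite dif_vert dif_hor dif_west dif_south.
  by case: (col _) (col _) (col _) (col _) => -[] [] [].
move: (x, y + 1) (x + 1, y) (x, y - 1) (x - 1, y) => N E S W.
move=> hs hb' ha' aW aS aE aN.
rewrite /= !inE !negb_or !andbT => /and3P[/and3P[nNE nNS nNW] /andP[nES nEW] nSW].
have key q : adjp (x, y) q -> [|| q == a, q == b | ~~ dif col (x, y) q].
  by move=> aq; case: eqVneq => //= na; case: eqVneq => //= nb; rewrite hq.
move: hs (key N aN) (key E aE) (key S aS) (key W aW) => {key}.
have [nEN nSN nWN nSE] : [/\ E != N, S != N, W != N & S != E] by rewrite ![_ == N]eq_sym [S == E]eq_sym.
have [nWE nWS] : W != E /\ W != S by rewrite ![W == _]eq_sym.
case: ha' => ea; case: hb' => eb; subst a b; rewrite ?eqxx in hab => //;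
  rewrite ?eqxx ?(negPf nNE) ?(negPf nNS) ?(negPf nNW) ?(negPf nES) ?(negPf nEW) ?(negPf nSW)
    ?(negPf nEN) ?(negPf nSN) ?(negPf nWN) ?(negPf nSE) ?(negPf nWE) ?(negPf nWS) /=;
  by move: (dif _ _ N) (dif _ _ E) (dif _ _ S) (dif _ _ W) => [] [] [] [].
Qed.

(** * Parity of closed chains *)

(** The step, in either direction, crosses the vertical ray that rises from the centre of [f], as in
    the ray-casting proof of the Jordan curve theorem for polygons. *)
Definition up (f : pt) (st : pt * pt) : bool :=
  [&& st.1.2 == st.2.2, f.2 < st.1.2 &
   (st.1.1 == f.1) && (st.2.1 == f.1 + 1) || (st.2.1 == f.1) && (st.1.1 == f.1 + 1)].

Definition par (s : seq pt) (f : pt) : bool := odd (count (up f) (steps s)).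

Definition cnt (s : seq pt) (a b : pt) : bool := odd (count (same_edge a b) (steps s)).

(** The boundary of the walk modulo 2, evaluated on a test function [h]; a chain is closed when
    these values cancel for all [h]. *)
Definition wends (h : pt -> bool) (w : seq pt) : bool :=
  if w is p :: s then h p (+) h (last p s) else false.

(** Both sides count, modulo 2, the ends of the step on the half-line that rises from [(x, y + 1)].
    A horizontal step with an end there lies in one of the two columns; a vertical step along the
    half-line has two ends on it, and the step between [(x, y)] and [(x, y + 1)] has one. *)
Lemma up_vert x y p q : adjp p q ->
  up (x - 1, y) (p, q) (+) up (x, y) (p, q) (+) same_edge (x, y) (x, y + 1) (p, q) =
  ((p.1 == x) && (y < p.2)) (+) ((q.1 == x) && (y < q.2)).
Proof.
case: p q => [a b] [c d] h.
case: (boolP (up (x - 1, y) _)) => h1; case: (boolP (up (x, y) _)) => h2;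
case: (boolP (same_edge _ _ _)) => h3; case: (boolP ((a == x) && _)) => h4;
case: (boolP ((c == x) && _)) => h5; rewrite //=; exfalso;
by move: h h1 h2 h3 h4 h5; rewrite /adjp /up /same_edge !xpair_eqE /=; lia.
Qed.

Lemma up_hor x y p q : adjp p q ->
  up (x, y - 1) (p, q) (+) up (x, y) (p, q) = same_edge (x, y) (x + 1, y) (p, q).
Proof.
case: p q => [a b] [c d] h.
case: (boolP (up (x, y - 1) _)) => h1; case: (boolP (up (x, y) _)) => h2;
case: (boolP (same_edge _ _ _)) => h3; rewrite //=; exfalso;
by move: h h1 h2 h3; rewrite /adjp /up /same_edge !xpair_eqE /=; lia.
Qed.

Lemma par_vert x y s : sorted adjp s ->
  par s (x - 1, y) (+) par s (x, y) (+) cnt s (x, y) (x, y + 1) =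
  wends (fun p => (p.1 == x) && (y < p.2)) s.
Proof.
case: s => [|p s] //=; elim: s p => [|q s IH] p; first by rewrite /par /cnt /= addbb.
move=> /= /andP[hpq hs]; rewrite /par /cnt steps_cons ![count _ (_ :: _)]/= !oddD !oddb.
have {}IH := IH _ hs; have h := up_vert x y hpq.
move: h IH; rewrite /par /cnt.
set u1 := up _ _; set u2 := up _ _; set u3 := same_edge _ _ _.
set c1 := odd _; set c2 := odd _; set c3 := odd _.
set hp := (p.1 == x) && _; set hq := (q.1 == x) && _; set hl := ((last q s).1 == x) && _.
by case: u1 u2 u3 c1 c2 c3 hp hq hl => -[] [] [] [] [] [] [] [].
Qed.

Lemma par_hor x y s : sorted adjp s ->
  par s (x, y - 1) (+) par s (x, y) = cnt s (x, y) (x + 1, y).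
Proof.
case: s => [|p s] //=; elim: s p => [|q s IH] p //.
move=> /= /andP[hpq hs]; rewrite /par /cnt steps_cons ![count _ (_ :: _)]/= !oddD !oddb.
rewrite -(up_hor x y hpq); have := IH _ hs; rewrite /par /cnt => <-.
by rewrite addbACA.
Qed.

Definition Par (ws : seq (seq pt)) f := \big[addb/false]_(w <- ws) par w f.
Definition Cnt (ws : seq (seq pt)) a b := \big[addb/false]_(w <- ws) cnt w a b.
Definition closed_chain (ws : seq (seq pt)) :=
  forall h, \big[addb/false]_(w <- ws) wends h w = false.

Lemma cnt_sym s a b : cnt s a b = cnt s b a.
Proof. by congr odd; apply: eq_count => st; rewrite /same_edge orbC. Qed.

Lemma Cnt_sym ws a b : Cnt ws a b = Cnt ws b a.
Proof. by apply: eq_bigr => w _; exact: cnt_sym. Qed.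

(** The Jordan curve theorem of the grid. [par_vert] leaves the end terms of the walks, which cancel
    because the chain is closed; what remains is the multiplicity of the edge. *)
Lemma dif_Par ws p q : all (sorted adjp) ws -> closed_chain ws -> adjp p q ->
  dif (Par ws) p q = Cnt ws p q.
Proof.
move=> hws hc; move: p q; apply: edge_ind.
- by move=> p q hpq h; rewrite -dif_sym // h Cnt_sym.
- move=> x y; rewrite dif_vert.
  have xorE (a b c : bool) : a (+) b (+) c = false -> a (+) b = c by case: a b c => -[] [].
  apply: xorE; rewrite /Par /Cnt -!big_split /=.
  rewrite -[RHS](hc (fun p => (p.1 == x) && (y < p.2))).
  by rewrite big_seq [RHS]big_seq; apply: eq_bigr => w hw; rewrite par_vert // (allP hws).
- move=> x y; rewrite dif_hor /Par /Cnt -big_split /=.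
  by rewrite big_seq [RHS]big_seq; apply: eq_bigr => w hw; rewrite par_hor // (allP hws).
Qed.

Lemma cnt_inedge s a b : ~~ inedge s a b -> cnt s a b = false.
Proof. by rewrite /inedge /cnt has_count -leqNgt leqn0 => /eqP ->. Qed.

Lemma flat_Par ws (K : rel pt) : all (sorted adjp) ws -> closed_chain ws ->
  (forall p q w, w \in ws -> inedge w p q -> K p q) -> flat K (Par ws).
Proof.
move=> hws hc hK p q hpq hn; rewrite dif_Par // /Cnt big_seq big1 // => w hw.
by apply: cnt_inedge; apply: contra hn => /(hK _ _ _ hw).
Qed.

(** * Lattice balls *)

Definition inb (o : pt) (r : int) (p : pt) : bool :=
  (`|p.1 - o.1| <= r) && (`|p.2 - o.2| <= r).

Definition inface (o : pt) (r : int) (f : pt) : bool :=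
  (o.1 - r <= f.1 < o.1 + r) && (o.2 - r <= f.2 < o.2 + r).

Lemma inb_center o r : 1 <= r -> inb o r o.
Proof. by move=> hr; rewrite /inb; lia. Qed.

Lemma inface_corner o r f p : inface o r f -> corner f p -> inb o r p.
Proof. by rewrite /inface /corner /inb; lia. Qed.

Lemma inface_inb o r f : inface o r f -> inb o r f.
Proof. by rewrite /inface /inb; lia. Qed.

Lemma corner_side1r p q : adjp p q -> corner (side1 p q) q.
Proof. by move=> h; rewrite side1_sym // corner_side1 // adjp_sym. Qed.

Lemma corner_side2r p q : adjp p q -> corner (side2 p q) q.
Proof. by move=> h; rewrite side2_sym corner_side2 // adjp_sym. Qed.

Lemma out_side o r p q : adjp p q -> ~~ (inb o r p && inb o r q) ->
  ~~ inface o r (side1 p q) && ~~ inface o r (side2 p q).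
Proof.
move=> h hn; apply/andP; split; apply: contra hn => hf.
  by rewrite (inface_corner hf (corner_side1 h)) (inface_corner hf (corner_side1r h)).
by rewrite (inface_corner hf (corner_side2 h)) (inface_corner hf (corner_side2r h)).
Qed.

Lemma hline (col : pt -> bool) (a b y : int) : a <= b ->
  (forall x, a < x <= b -> col (x - 1, y) = col (x, y)) -> col (a, y) = col (b, y).
Proof.
move=> hab hc; have [n hn] : exists n : nat, b = a + n%:Z.
  by exists `|b - a|%N; lia.
subst b; elim: n {hab} hc => [|n IH] h; first by rewrite addr0.
rewrite IH; last by move=> x hx; apply: h; lia.
by have := h (a + n.+1%:Z); rewrite -addn1 PoszD addrA addrK; apply; lia.
Qed.

Lemma vline (col : pt -> bool) (a b x : int) : a <= b ->
  (forall y, a < y <= b -> col (x, y - 1) = col (x, y)) -> col (x, a) = col (x, b).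
Proof.
move=> hab hc.
exact: (@hline (fun p => col (p.2, p.1)) a b x hab hc).
Qed.

Section Ring.
Variables (col : pt -> bool) (o : pt) (r : int).
Hypothesis hr : 1 <= r.

Let x0 := o.1 - r.
Let x1 := o.1 + r.
Let y0 := o.2 - r.
Let y1 := o.2 + r.

Lemma ring_top a b : x0 - 1 <= a <= b -> b <= x1 ->
  (forall x, a < x <= b -> dif col (x, y1) (x, y1 + 1) = false) -> col (a, y1) = col (b, y1).
Proof.
move=> /andP[ha hab] hb hd; apply: hline => // x hx.
by have := hd x hx; rewrite dif_vert; case: (col _) (col _) => -[].
Qed.

Lemma ring_bottom a b : x0 - 1 <= a <= b -> b <= x1 ->
  (forall x, a < x <= b -> dif col (x, y0) (x, y0 - 1) = false) ->
  col (a, y0 - 1) = col (b, y0 - 1).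
Proof.
move=> /andP[ha hab] hb hd; apply: hline => // x hx.
by have := hd x hx; rewrite dif_south; case: (col _) (col _) => -[].
Qed.

Lemma ring_right a b : y0 - 1 <= a <= b -> b <= y1 ->
  (forall y, a < y <= b -> dif col (x1, y) (x1 + 1, y) = false) -> col (x1, a) = col (x1, b).
Proof.
move=> /andP[ha hab] hb hd; apply: vline => // y hy.
by have := hd y hy; rewrite dif_hor; case: (col _) (col _) => -[].
Qed.

Lemma ring_left a b : y0 - 1 <= a <= b -> b <= y1 ->
  (forall y, a < y <= b -> dif col (x0, y) (x0 - 1, y) = false) ->
  col (x0 - 1, a) = col (x0 - 1, b).
Proof.
move=> /andP[ha hab] hb hd; apply: vline => // y hy.
by have := hd y hy; rewrite dif_west; case: (col _) (col _) => -[].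
Qed.

(** The faces just outside the ball form a cyclic ring in which neighbours are separated by an edge
    leaving the ball. The lower left corner of the ring serves as the reference face. *)
Lemma ring_const f p :
  (forall p q, inb o r p -> ~~ inb o r q -> adjp p q -> dif col p q = false) ->
  ~~ inface o r f -> inb o r p -> corner f p -> col f = col (x0 - 1, y0 - 1).
Proof.
move=> hd hf hp hc; move: f hf hc => [x y] hf hc.
have [hx hy hxy] : [/\ x0 - 1 <= x <= x1, y0 - 1 <= y <= y1 &
    [|| x == x0 - 1, x == x1, y == y0 - 1 | y == y1]].
  by move: hp hf hc; rewrite /inb /inface /corner /= /x0 /x1 /y0 /y1; clear -hr; split; lia.
have hT a b : x0 - 1 <= a <= b -> b <= x1 -> col (a, y1) = col (b, y1).
  move=> ha hb; apply: ring_top => // z hz.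
  by apply: hd; rewrite ?adjp_vert // /inb /=; move: ha hb hz; rewrite /x0 /x1 /y1; clear -hr; lia.
have hB a b : x0 - 1 <= a <= b -> b <= x1 -> col (a, y0 - 1) = col (b, y0 - 1).
  move=> ha hb; apply: ring_bottom => // z hz.
  by apply: hd; rewrite ?adjp_south // /inb /=; move: ha hb hz; rewrite /x0 /x1 /y0; clear -hr; lia.
have hL a b : y0 - 1 <= a <= b -> b <= y1 -> col (x0 - 1, a) = col (x0 - 1, b).
  move=> ha hb; apply: ring_left => // z hz.
  by apply: hd; rewrite ?adjp_west // /inb /=; move: ha hb hz; rewrite /x0 /y0 /y1; clear -hr; lia.
have hR a b : y0 - 1 <= a <= b -> b <= y1 -> col (x1, a) = col (x1, b).
  move=> ha hb; apply: ring_right => // z hz.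
  by apply: hd; rewrite ?adjp_hor // /inb /=; move: ha hb hz; rewrite /x1 /y0 /y1; clear -hr; lia.
have hb0 : x0 - 1 <= x1 by rewrite /x0 /x1; clear -hr; lia.
have hb1 : y0 - 1 <= y1 by rewrite /y0 /y1; clear -hr; lia.
clear -hx hy hxy hT hB hL hR hb0 hb1.
case/or4P: hxy => /eqP h; rewrite h.
- by rewrite -(hL (y0 - 1) y) //; clear -hy; lia.
- rewrite -(hR (y0 - 1) y); [| clear -hy; lia ..].
  by rewrite -(hB (x0 - 1) x1) //; clear -hb0; lia.
- by rewrite -(hB (x0 - 1) x) //; clear -hx; lia.
rewrite -(hT (x0 - 1) x); [| clear -hx; lia ..].
by rewrite -(hL (y0 - 1) y1) //; clear -hb1; lia.
Qed.

(* The colour changes around the ring of faces along a ball cannot occur just once. *)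
Lemma ring_one p0 q0 : inb o r p0 -> ~~ inb o r q0 -> adjp p0 q0 ->
  (forall p q, inb o r p -> ~~ inb o r q -> adjp p q -> (p, q) != (p0, q0) ->
    dif col p q = false) -> dif col p0 q0 = false.
Proof.
move=> hp0 hq0 h0 hd.
have hT a b : x0 - 1 <= a <= b -> b <= x1 ->
    (forall z, a < z <= b -> ((z, y1), (z, y1 + 1)) != (p0, q0)) -> col (a, y1) = col (b, y1).
  move=> ha hb hz'; apply: ring_top => // z hz.
  by apply: hd; rewrite ?hz' ?adjp_vert // /inb /=; move: ha hb hz; rewrite /x0 /x1 /y1; clear -hr; lia.
have hB a b : x0 - 1 <= a <= b -> b <= x1 ->
    (forall z, a < z <= b -> ((z, y0), (z, y0 - 1)) != (p0, q0)) ->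
    col (a, y0 - 1) = col (b, y0 - 1).
  move=> ha hb hz'; apply: ring_bottom => // z hz.
  by apply: hd; rewrite ?hz' ?adjp_south // /inb /=; move: ha hb hz; rewrite /x0 /x1 /y0; clear -hr; lia.
have hL a b : y0 - 1 <= a <= b -> b <= y1 ->
    (forall z, a < z <= b -> ((x0, z), (x0 - 1, z)) != (p0, q0)) ->
    col (x0 - 1, a) = col (x0 - 1, b).
  move=> ha hb hz'; apply: ring_left => // z hz.
  by apply: hd; rewrite ?hz' ?adjp_west // /inb /=; move: ha hb hz; rewrite /x0 /y0 /y1; clear -hr; lia.
have hR a b : y0 - 1 <= a <= b -> b <= y1 ->
    (forall z, a < z <= b -> ((x1, z), (x1 + 1, z)) != (p0, q0)) -> col (x1, a) = col (x1, b).
  move=> ha hb hz'; apply: ring_right => // z hz.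
  by apply: hd; rewrite ?hz' ?adjp_hor // /inb /=; move: ha hb hz; rewrite /x1 /y0 /y1; clear -hr; lia.
have hx01 : x0 <= x1 by rewrite /x0 /x1; clear -hr; lia.
have hy01 : y0 <= y1 by rewrite /y0 /y1; clear -hr; lia.
have hin : (x0 <= p0.1 <= x1) && (y0 <= p0.2 <= y1).
  by move: hp0; rewrite /inb /x0 /x1 /y0 /y1; clear; lia.
have hout : ~~ ((x0 <= q0.1 <= x1) && (y0 <= q0.2 <= y1)).
  by move: hq0; rewrite /inb /x0 /x1 /y0 /y1; clear; lia.
clear -hT hB hL hR hx01 hy01 hin hout h0.
move: x0 x1 y0 y1 hx01 hy01 hin hout hT hB hL hR => X0 X1 Y0 Y1 hx01 hy01 hin hout hT hB hL hR.
case: p0 h0 hin hT hB hL hR => x y h0 /= hin.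
(* The cases are the four sides of the ball by which the exceptional edge leaves. Its two faces are
   compared by going around the ball the other way, which avoids that edge. *)
case: (adjp_dirs h0) hout => -> /= hout hT hB hL hR.
- have hy : y = Y1 by clear -hin hout; lia.
  subst y; rewrite dif_vert.
  have -> : col (x - 1, Y1) = col (X0 - 1, Y1).
    by symmetry; apply: hT; [clear -hin; lia.. | move=> z hz; rewrite !xpair_eqE; clear -hz; lia].
  have -> : col (x, Y1) = col (X1, Y1).
    by apply: hT; [clear -hin; lia.. | move=> z hz; rewrite !xpair_eqE; clear -hz; lia].
  rewrite -(hL (Y0 - 1) Y1) -?(hR (Y0 - 1) Y1) -?(hB (X0 - 1) X1) ?addbb //;
    by [clear -hx01 hy01; lia | move=> z hz; rewrite !xpair_eqE; clear -hz hx01 hy01; lia].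
- have hy : x = X1 by clear -hin hout; lia.
  subst x; rewrite dif_hor.
  have -> : col (X1, y - 1) = col (X1, Y0 - 1).
    by symmetry; apply: hR; [clear -hin; lia.. | move=> z hz; rewrite !xpair_eqE; clear -hz; lia].
  have -> : col (X1, y) = col (X1, Y1).
    by apply: hR; [clear -hin; lia.. | move=> z hz; rewrite !xpair_eqE; clear -hz; lia].
  rewrite -(hB (X0 - 1) X1) -?(hT (X0 - 1) X1) -?(hL (Y0 - 1) Y1) ?addbb //;
    by [clear -hx01 hy01; lia | move=> z hz; rewrite !xpair_eqE; clear -hz hx01 hy01; lia].
- have hy : y = Y0 by clear -hin hout; lia.
  subst y; rewrite dif_south.
  have -> : col (x - 1, Y0 - 1) = col (X0 - 1, Y0 - 1).
    by symmetry; apply: hB; [clear -hin; lia.. | move=> z hz; rewrite !xpair_eqE; clear -hz; lia].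
  have -> : col (x, Y0 - 1) = col (X1, Y0 - 1).
    by apply: hB; [clear -hin; lia.. | move=> z hz; rewrite !xpair_eqE; clear -hz; lia].
  rewrite (hL (Y0 - 1) Y1) ?(hR (Y0 - 1) Y1) -?(hT (X0 - 1) X1) ?addbb //;
    by [clear -hx01 hy01; lia | move=> z hz; rewrite !xpair_eqE; clear -hz hx01 hy01; lia].
have hy : x = X0 by clear -hin hout; lia.
subst x; rewrite dif_west.
have -> : col (X0 - 1, y - 1) = col (X0 - 1, Y0 - 1).
  by symmetry; apply: hL; [clear -hin; lia.. | move=> z hz; rewrite !xpair_eqE; clear -hz; lia].
have -> : col (X0 - 1, y) = col (X0 - 1, Y1).
  by apply: hL; [clear -hin; lia.. | move=> z hz; rewrite !xpair_eqE; clear -hz; lia].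
rewrite (hB (X0 - 1) X1) ?(hT (X0 - 1) X1) ?(hR (Y0 - 1) Y1) ?addbb //;
  by [clear -hx01 hy01; lia | move=> z hz; rewrite !xpair_eqE; clear -hz hx01 hy01; lia].
Qed.
End Ring.

Lemma const_all (col : pt -> bool) : (forall p q, adjp p q -> dif col p q = false) ->
  forall f g, col f = col g.
Proof.
move=> hd.
have hH x y : col (x - 1, y) = col (x, y).
  by have := hd _ _ (adjp_vert x y); rewrite dif_vert; case: (col _) (col _) => -[].
have hV x y : col (x, y - 1) = col (x, y).
  by have := hd _ _ (adjp_hor x y); rewrite dif_hor; case: (col _) (col _) => -[].
have h0 f : col f = col (0, 0).
  case: f => x y; transitivity (col (x, 0)).
    by have [h|h] := lerP y 0; [apply: vline => // | symmetry; apply: vline => //; exact: ltW].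
  by have [h|h] := lerP x 0; [apply: hline => // | symmetry; apply: hline => //; exact: ltW].
by move=> f g; rewrite h0 [RHS]h0.
Qed.

(** * Lattice walks *)

Definition in_box (p q z : pt) : bool :=
  (Order.min p.1 q.1 <= z.1 <= Order.max p.1 q.1) && (Order.min p.2 q.2 <= z.2 <= Order.max p.2 q.2).

Lemma box_walk p q : exists s, [/\ path adjp p s, last p s = q &
  forall z, z \in p :: s -> in_box p q z].
Proof.
have [n] := ubnP (absz (p.1 - q.1) + absz (p.2 - q.2)).
elim: n p => // n IH [x y]; case: q IH => x' y' IH /= hn.
have step (u v : int) : adjp (x, y) (u, v) -> in_box (x, y) (x', y') (u, v) ->
    (absz (u - x') + absz (v - y') < n)%N ->
    exists s, [/\ path adjp (x, y) s, last (x, y) s = (x', y') &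
      forall z, z \in (x, y) :: s -> in_box (x, y) (x', y') z].
  move=> ha hb hlt; have [s [hs hl hz]] := IH (u, v) hlt.
  exists ((u, v) :: s); split; rewrite /= ?ha //.
  move=> [a b]; rewrite inE => /orP[/eqP[-> ->]|/hz].
    by rewrite /in_box /=; clear; lia.
  by move: hb; rewrite /in_box /=; clear; lia.
have [hx|hx|hx] := ltrgtP x x'.
- by apply: (step (x + 1) y); rewrite /adjp /in_box /=; clear -hx hn; lia.
- by apply: (step (x - 1) y); rewrite /adjp /in_box /=; clear -hx hn; lia.
have [hy|hy|hy] := ltrgtP y y'.
- by apply: (step x (y + 1)); rewrite /adjp /in_box /=; clear -hy hn hx; lia.
- by apply: (step x (y - 1)); rewrite /adjp /in_box /=; clear -hy hn hx; lia.
exists [::]; rewrite hx hy; split=> // z; rewrite inE => /eqP ->.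
by rewrite /in_box /=; clear; lia.
Qed.

Lemma in_box_inb o r p q z : inb o r p -> inb o r q -> in_box p q z -> inb o r z.
Proof. by rewrite /in_box /inb; lia. Qed.

(** Induction on the length: a repeated point allows a shortcut, a later visit to [A] a later start,
    and an earlier visit to [B] an earlier stop, all within the points of the given walk. *)
Lemma path_extract (T : eqType) (e : rel T) (A B : pred T) p s :
  path e p s -> A p -> B (last p s) ->
  exists p' s', [/\ path e p' s', uniq (p' :: s'), {subset p' :: s' <= p :: s},
     A p' /\ B (last p' s') &
     forall x, x \in p' :: s' -> (A x -> x = p') /\ (B x -> x = last p' s')].
Proof.
have [n] := ubnP (size s); elim: n p s => // n IH p s hn hp hA hB.
have rec p1 s1 : (size s1 < size s)%N -> path e p1 s1 -> A p1 -> B (last p1 s1) ->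
    {subset p1 :: s1 <= p :: s} -> exists p' s', [/\ path e p' s', uniq (p' :: s'),
    {subset p' :: s' <= p :: s}, A p' /\ B (last p' s') &
     forall x, x \in p' :: s' -> (A x -> x = p') /\ (B x -> x = last p' s')].
  move=> hsz h1 h2 h3 hsub.
  have [p' [s' [k1 k2 k3 k4 k5]]] := IH p1 s1 (leq_trans hsz hn) h1 h2 h3.
  by exists p', s'; split=> // x /k3 /hsub.
have [hu|hu] := boolP (uniq (p :: s)); last first.
  case/shortenP: (hp) (hB) => s' hs' us' sub' hB'.
  have hsz : (size s' < size s)%N.
    have hle : (size s' <= size s)%N.
      by have /andP[_ /uniq_leq_size] := us'; apply.
    rewrite ltn_neqAle hle andbT; apply: contra hu => /eqP hs.
    have /andP[hps' us''] := us'.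
    have us := leq_size_uniq us'' sub' (eq_leq (esym hs)).
    have [_ heq] := uniq_min_size us'' sub' (eq_leq (esym hs)).
    by rewrite /= us andbT -heq.
  apply: (rec p s') => // x; rewrite !inE => /orP[->//|/sub' ->]; exact: orbT.
have [/hasP[x xs Ax]|hA'] := boolP (has A s).
  case/splitPr: xs hn hp hB hu rec => s1 s2 hn hp hB hu rec.
  move: hp; rewrite cat_path /= => /and3P[_ _ hp2].
  apply: (rec x s2) => //; first by rewrite size_cat /= addnS ltnS leq_addl.
    by move: hB; rewrite last_cat.
  by move=> y; rewrite !inE mem_cat !inE => /orP[->|->]; rewrite ?orbT.
have [/hasP[x xs Bx]|hB'] := boolP (has B (belast p s)).
  case/lastP: s hn hp hB hu rec hA' xs => [|s y] hn hp hB hu rec hA' //.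
  rewrite belast_rcons inE => /orP[/eqP xp|xs].
    apply: (rec p [::]) => //=; rewrite -?xp ?size_rcons //.
    by move=> z; rewrite !inE => ->.
  case/splitPr: xs hn hp hB hu rec hA' => s1 s2 hn hp hB hu rec hA'.
  have /and3P[hp1 hx _] : [&& path e p s1, e (last p s1) x & path e x (rcons s2 y)].
    by move: hp; rewrite rcons_cat cat_path.
  apply: (rec p (rcons s1 x)) => //.
  - by rewrite !(size_rcons, size_cat) /= addnS ltnS leq_addr.
  - by rewrite rcons_path hp1.
  - by rewrite last_rcons.
  move=> z; rewrite !inE !mem_rcons !inE mem_cat !inE.
  by case/or3P => ->; rewrite ?orbT.
exists p, s; split=> // x hx; split => [Ax|Bx].
  move: hx; rewrite inE => /orP[/eqP //|xs].
  by case/hasP: hA'; exists x.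
have : x \in rcons (belast p s) (last p s) by rewrite -lastI.
rewrite mem_rcons inE => /orP[/eqP //|xs].
by case/hasP: hB'; exists x.
Qed.

(** * Doubling the grid *)

Definition dp (p : pt) : pt := (2 * p.1, 2 * p.2).
(** The midpoint of the edge from [p] to [q], in the coordinates of the doubled grid. *)
Definition mid (p q : pt) : pt := (p.1 + q.1, p.2 + q.2).

Fixpoint dblp (p : pt) (t : seq pt) : seq pt :=
  dp p :: (if t is q :: t' then mid p q :: dblp q t' else [::]).

Definition dbl (s : seq pt) : seq pt := if s is p :: t then dblp p t else [::].

Lemma dp_inj : injective dp.
Proof. by move=> [a b] [c d] [h1 h2]; congr (_, _); move: h1 h2; lia. Qed.

Lemma mid_sym p q : mid p q = mid q p.
Proof. by rewrite /mid addrC [p.2 + _]addrC. Qed.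

Lemma mid_inj p q p' q' : adjp p q -> adjp p' q' -> mid p q = mid p' q' ->
  (p' = p /\ q' = q) \/ (p' = q /\ q' = p).
Proof.
move: p q p' q' => [a b] [c d] [a' b'] [c' d']; rewrite /adjp /= => h h' [h1 h2].
have [[-> [-> [-> ->]]]|[-> [-> [-> ->]]]] : (a' = a /\ b' = b /\ c' = c /\ d' = d) \/
  (a' = c /\ b' = d /\ c' = a /\ d' = b) by lia.
  by left.
by right.
Qed.

Lemma mid_dp p q z : adjp p q -> mid p q <> dp z.
Proof. by rewrite /adjp => h [h1 h2]; move: h h1 h2; lia. Qed.

Lemma dbl_cons p t : exists t', dbl (p :: t) = dp p :: t'.
Proof. by case: t => [|q t]; eexists. Qed.

Lemma dbl_last p t z : last z (dbl (p :: t)) = dp (last p t).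
Proof. by elim: t p z => [|q t IH] p z //=; rewrite (IH q). Qed.

Lemma mem_dbl s z : z \in dbl s ->
  (exists2 p : pt, p \in s & z = dp p) \/ (exists p q : pt, (p, q) \in steps s /\ z = mid p q).
Proof.
case: s => // p t; elim: t p => [|q t IH] p.
  by rewrite inE => /eqP ->; left; exists p; rewrite ?mem_head.
rewrite [dbl _]/= in_cons => /orP[/eqP->|].
  by left; exists p; rewrite ?mem_head.
rewrite in_cons => /orP[/eqP->|/IH [[p' hp' ->]|[p' [q' [h ->]]]]].
- by right; exists p, q; rewrite steps_cons mem_head.
- by left; exists p' => //; rewrite inE hp' orbT.
by right; exists p', q'; rewrite steps_cons inE h orbT.
Qed.

Lemma adjp_dp_mid p q : adjp p q -> adjp (dp p) (mid p q).
Proof. by rewrite /adjp /dp /mid /=; lia. Qed.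

Lemma dbl_sorted s : sorted adjp s -> sorted adjp (dbl s).
Proof.
case: s => // p t; elim: t p => [|q t IH] p //= /andP[hpq ht].
have [t'' e] := dbl_cons q t; have := IH q ht; rewrite [dbl _]e /= => h.
have -> : dblp q t = dbl (q :: t) by [].
rewrite e /= h adjp_dp_mid //= mid_sym adjp_sym adjp_dp_mid //.
by rewrite adjp_sym.
Qed.

Lemma dbl_uniq s : sorted adjp s -> uniq s -> uniq (dbl s).
Proof.
case: s => // p t; elim: t p => [|q t IH] p // /andP[hpq ht0] /andP[hp hu].
have ht : sorted adjp (q :: t) by [].
have -> : dbl (p :: q :: t) = dp p :: mid p q :: dbl (q :: t) by [].
rewrite !cons_uniq IH // andbT; apply/andP; split; last first.
  apply/negP => /mem_dbl[[z _ /(mid_dp hpq)]//|[a [b [hab h]]]].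
  have /andP[ha hb] := mem_steps hab.
  case: (mid_inj hpq (steps_adjp ht hab) h) => -[e1 e2].
    by rewrite -e1 ha in hp.
  by rewrite -e2 hb in hp.
rewrite inE negb_or; apply/andP; split.
  by apply/eqP => h; case: (mid_dp hpq (esym h)).
apply/negP => /mem_dbl[[z hz /dp_inj e]|[a [b [hab h]]]].
  by rewrite e hz in hp.
by case: (mid_dp (steps_adjp ht hab) (esym h)).
Qed.

Lemma steps_dbl s p q : (p, q) \in steps s ->
  (dp p, mid p q) \in steps (dbl s) /\ (mid p q, dp q) \in steps (dbl s).
Proof.
case: s => // a t; elim: t a => [|b t IH] a //; rewrite steps_cons in_cons.
have -> : dbl (a :: b :: t) = dp a :: mid a b :: dbl (b :: t) by [].
have [t' e] := dbl_cons b t.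
rewrite steps_cons e steps_cons -e => /orP[/eqP[-> ->]|/IH [h1 h2]].
  by rewrite !inE !eqxx !orbT.
by rewrite !inE h1 h2 !orbT.
Qed.

Lemma inedge_dbl s p q : inedge s p q -> inedge (dbl s) (dp p) (mid p q).
Proof.
case/hasP => -[a b] hab /orP[] /eqP[<- <-]; have [h1 h2] := steps_dbl hab; apply/hasP.
  by exists (dp a, mid a b) => //; rewrite /same_edge eqxx.
by exists (mid a b, dp b) => //; rewrite /same_edge mid_sym eqxx orbT.
Qed.

(** * Finite graphs *)

Lemma adj_sym (V : finType) (E : {set {set V}}) x y : adj E x y = adj E y x.
Proof. by rewrite /adj setUC. Qed.

Lemma simple_edgeP (V : finType) (E : {set {set V}}) e : simple_graph E -> e \in E ->
  exists x y, e = [set x; y] /\ x != y.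
Proof. by move=> hE /hE /eqP /cards2P[x [y [h ->]]]; exists x, y. Qed.

Lemma edge_other (V : finType) (x y z : V) : z \in [set x; y] -> x != y ->
  exists2 w, [set x; y] = [set z; w] & z != w.
Proof.
rewrite !inE => /orP[] /eqP -> h; first by exists y.
by exists x; rewrite 1?setUC 1?eq_sym.
Qed.

(** If every edge had a companion at each of its ends, a simple path could be prolonged at its front
    for ever, the only alternative being a new edge that closes a cycle. *)
Lemma forest_leaf (V : finType) (E : {set {set V}}) e0 :
  simple_graph E -> is_forest E -> e0 \in E ->
  exists v e, [/\ e \in E, v \in e & forall e', e' \in E -> v \in e' -> e' = e].
Proof.
move=> hE hF he0; apply: contrapT => hno.
have more v e : e \in E -> v \in e -> exists e', [/\ e' \in E, v \in e' & e' != e].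
  move=> he hv; apply: contrapT => hn; apply: hno; exists v, e; split=> // e' he' hv'.
  by apply/eqP; apply: contraT => hne; case: hn; exists e'.
have long n : exists x s, [/\ size s = n.+1, uniq (x :: s) & path (adj E) x s].
  elim: n => [|n [x [s [hs hu hp]]]].
    have [x [y [e hxy]]] := simple_edgeP hE he0; exists x, [:: y].
    by split; rewrite //= ?inE ?hxy // andbT /adj -e.
  case: s hs hu hp => [|y s] // hs hu hp.
  have hxy : [set x; y] \in E by move: hp => /= /andP[].
  have [e' [he' hx' hne]] := more x _ hxy (set21 _ _).
  have [a [b [e'ab hab]]] := simple_edgeP hE he'.
  rewrite e'ab in hx'; have [z ez hxz] := edge_other hx' hab.
  rewrite {}ez in e'ab; have hzy : z != y.
    by apply: contra hne => /eqP <-; rewrite e'ab.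
  have hzx : adj E z x by rewrite adj_sym /adj -e'ab.
  have [zs|zs] := boolP (z \in s); last first.
    exists z, (x :: y :: s); split; first by rewrite /= -hs.
      by rewrite [uniq _]/= in hu; rewrite /= hu andbT !inE !negb_or eq_sym hxz hzy zs.
    by rewrite /= in hp; rewrite /= hzx.
  exfalso; case/splitPr: zs hs hu hp => s1 s2 hs hu hp.
  apply: (hF (x :: y :: rcons s1 z)); split; first by rewrite /= size_rcons.
    move: hu; have -> : x :: y :: s1 ++ z :: s2 = (x :: y :: rcons s1 z) ++ s2.
      by rewrite /= cat_rcons.
    by rewrite cat_uniq => /and3P[].
  rewrite /cycle; have -> : rcons (y :: rcons s1 z) x = rcons (rcons (y :: s1) z) x by [].
  rewrite rcons_path last_rcons hzx andbT.
  by move: hp; rewrite -cat_rcons -cat_cons cat_path => /andP[].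
have [x [s [hs hu _]]] := long #|V|.
by have := max_card (mem (x :: s)); move/card_uniqP: hu => ->; rewrite /= hs => /ltnW; rewrite ltnn.
Qed.

Lemma forest_sub (V : finType) (E E' : {set {set V}}) :
  E' \subset E -> is_forest E -> is_forest E'.
Proof.
move=> /subsetP sub hF c [h1 h2 h3]; apply: (hF c); split=> //.
case: c {h1 h2} h3 => // x s; apply: sub_path => a b; exact: sub.
Qed.

(** * Grid layouts *)

(* [pth L e] is only meaningful for the edges of the graph that is laid out. *)
Record layout (V : finType) := Layout {
  ctr : V -> pt;
  rad : V -> int;
  pth : {set V} -> seq pt }.

Definition ball_of (V : finType) (L : layout V) v := inb (ctr L v) (rad L v).
Definition fball (V : finType) (L : layout V) v := inface (ctr L v) (rad L v).

(** Balls are met only in the two end points of the path. Hence a path has no grid edge inside a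
    ball and leaves each of its two balls by a single grid edge. *)
Definition opath (V : finType) (L : layout V) (x y : V) (s : seq pt) : Prop :=
  exists p t, [/\ s = p :: t, path adjp p t, uniq (p :: t),
    ball_of L x p /\ ball_of L y (last p t) &
    forall z v, z \in p :: t -> ball_of L v z -> (v = x /\ z = p) \/ (v = y /\ z = last p t)].

Record is_model (V : finType) (E : {set {set V}}) (L : layout V) : Prop := IsModel {
  rad_ge1 : forall v, 1 <= rad L v;
  ball_disj : forall u v p, ball_of L u p -> ball_of L v p -> u = v;
  pth_ok : forall e, e \in E -> exists x y, [/\ e = [set x; y], x != y & opath L x y (pth L e)];
  pth_disj : forall e f z, e \in E -> f \in E -> z \in pth L e -> z \in pth L f -> e = f }.

Lemma inedgeP s a b : inedge s a b <->
  exists s1 s2, s = s1 ++ [:: a, b & s2] \/ s = s1 ++ [:: b, a & s2].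
Proof.
split.
  elim: s => [|p [|q s] IH] //; rewrite /inedge steps_cons /= => /orP[|/IH].
    rewrite /same_edge !xpair_eqE => /orP[] /andP[/eqP-> /eqP->].
      by exists [::], s; left.
    by exists [::], s; right.
  by case=> s1 [s2 [->|->]]; exists (p :: s1), s2; [left|right].
have cons p t : inedge t a b -> inedge (p :: t) a b.
  by case: t => [|q t] //; rewrite /inedge steps_cons /= => ->; rewrite orbT.
case=> s1 [s2 [->|->]]; elim: s1 => [|p s1 IH]; rewrite ?cat_cons; try exact: cons.
  by rewrite /inedge steps_cons /= /same_edge eqxx.
by rewrite /inedge steps_cons /= /same_edge eqxx orbT.
Qed.

Lemma inedge_rev s a b : inedge (rev s) a b = inedge s a b.
Proof.
have imp t : inedge t a b -> inedge (rev t) a b.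
  case/inedgeP => s1 [s2 [->|->]]; apply/inedgeP;
  by rewrite rev_cat !rev_cons -!cats1 -!catA /=; exists (rev s2), (rev s1); auto.
by apply/idP/idP => /imp; rewrite ?revK.
Qed.

Lemma uniq_split (T : eqType) (s1 s2 s3 s4 : seq T) z :
  uniq (s1 ++ z :: s2) -> s1 ++ z :: s2 = s3 ++ z :: s4 -> s1 = s3 /\ s2 = s4.
Proof.
move=> hu he; have hi (t1 t2 : seq T) : uniq (t1 ++ z :: t2) -> index z (t1 ++ z :: t2) = size t1.
  rewrite cat_uniq => /and3P[_ /hasPn h _]; rewrite index_cat ifF ?index_head ?addn0 //.
  by apply/negbTE; apply: (h z); rewrite mem_head.
have hs : size s1 = size s3 by rewrite -(hi _ _ hu) he hi // -he.
by move/eqP: he; rewrite eqseq_cat // eqseq_cons eqxx /= => /andP[/eqP -> /eqP ->].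
Qed.

Lemma uniq_nbr s s1 a z b s2 q : uniq s -> s = s1 ++ [:: a, z, b & s2] ->
  inedge s z q -> q = a \/ q = b.
Proof.
move=> hu hs /inedgeP[s3 [s4 [e|e]]]; move: hu; rewrite e.
  have -> : s3 ++ [:: z, q & s4] = s3 ++ z :: (q :: s4) by [].
  move=> hu; have : s3 ++ z :: (q :: s4) = rcons s1 a ++ z :: (b :: s2) by rewrite cat_rcons -hs -e.
  by case/(uniq_split hu) => _ [-> _]; right.
rewrite -cat_rcons => hu.
have : rcons s3 q ++ z :: s4 = rcons s1 a ++ z :: (b :: s2) by rewrite !cat_rcons -hs -e.
by case/(uniq_split hu) => /rcons_inj[_ ->]; left.
Qed.

Lemma uniq_nbr_head p q t z : uniq (p :: q :: t) -> inedge (p :: q :: t) p z -> z = q.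
Proof.
move=> hu /inedgeP[s3 [s4 [e|e]]]; move: hu; rewrite e.
  move=> hu; have : s3 ++ p :: (z :: s4) = [::] ++ p :: (q :: t) by rewrite -e.
  by case/(uniq_split hu) => _ [].
rewrite -cat_rcons => hu.
have : rcons s3 z ++ p :: s4 = [::] ++ p :: (q :: t) by rewrite cat_rcons -e.
by case/(uniq_split hu); case: (s3).
Qed.

Section Layout.
Variables (V : finType) (E : {set {set V}}) (L : layout V).
Hypothesis M : is_model E L.

Lemma model_simple : simple_graph E.
Proof. by move=> e /(pth_ok M)[x [y [-> h _]]]; rewrite cards2 h. Qed.

Lemma opath_rev x y s : opath L x y s -> opath L y x (rev s).
Proof.
case=> p [t [-> hp hu [hx hy] hz]]; exists (last p t), (behead (rev (p :: t))).
have e : rev (p :: t) = last p t :: behead (rev (p :: t)).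
  by rewrite lastI rev_rcons.
have hl : last (last p t) (behead (rev (p :: t))) = p.
  have : last (last p t) (rev (p :: t)) = p by rewrite rev_cons last_rcons.
  by rewrite {1}e.
split=> //.
- have h := rev_path adjp p t; move: hp; have -> : path adjp p t = path (fun x y => adjp y x) p t.
    by apply: eq_path => a b; exact: adjp_sym.
  by rewrite -h lastI rev_rcons.
- by rewrite -e rev_uniq.
- by rewrite hl.
move=> z v; rewrite -e mem_rev hl => h1 h2.
by case: (hz z v h1 h2); [right|left].
Qed.

Lemma orient e x : e \in E -> x \in e -> exists y s, [/\ e = [set x; y], x != y, opath L x y s &
  s = pth L e \/ s = rev (pth L e)].
Proof.
move=> he hx; have [a [b [eab hab ho]]] := pth_ok M he.
have : x \in [set a; b] by rewrite -eab.
rewrite !inE => /orP[]/eqP ->.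
  by exists b, (pth L e); split=> //; left.
exists a, (rev (pth L e)); split; rewrite 1?eq_sym //; last by right.
  by rewrite setUC.
exact: opath_rev.
Qed.

Lemma opath_cons x y s : x != y -> opath L x y s -> exists p q t,
  [/\ s = [:: p, q & t], ball_of L x p, ~~ ball_of L x q & adjp p q].
Proof.
move=> hxy [p [t [-> hp hu [hx hy] hz]]]; case: t hp hu hy hz => [|q t] hp hu hy hz.
  by case/eqP: hxy; apply: ball_disj M _ _ _ hx hy.
exists p, q, t; split=> //; last by case/andP: hp.
apply/negP => hq; have hin : q \in [:: p, q & t] by rewrite !inE eqxx orbT.
case: (hz q x hin hq) => [[_ e]|[e _]].
  by move: hu; rewrite e /= mem_head.
by rewrite e eqxx in hxy.
Qed.

(** Uniqueness turns a change of colour along one edge of the graph into a single change around the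
    ball of its end, the situation that [ring_one] excludes. *)
Lemma out_edge e x : e \in E -> x \in e -> exists p q,
  [/\ ball_of L x p, ~~ ball_of L x q, adjp p q, inedge (pth L e) p q &
   forall p' q', ball_of L x p' -> inedge (pth L e) p' q' -> p' = p /\ q' = q].
Proof.
move=> he hx; have [y [s [exy hxy ho hs]]] := orient he hx.
have [p [q [t [es hp hq hpq]]]] := opath_cons hxy ho.
have [p1 [t1 [es1 _ hu _ hz]]] := ho; move: es1; rewrite es => -[??]; subst p1 t1.
have hin a b : inedge (pth L e) a b = inedge s a b by case: hs => ->; rewrite ?inedge_rev.
exists p, q; rewrite hin es; split=> //.
  by rewrite /inedge steps_cons /= /same_edge eqxx.
move=> p' q' hp'; rewrite hin es => hin'.
have /andP[hpm _] := inedge_mem hin'.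
have e1 : p' = p.
  case: (hz p' x hpm hp') => [[]//|[e1 _]].
  by rewrite e1 eqxx in hxy.
by rewrite e1 in hin' *; rewrite (uniq_nbr_head hu hin').
Qed.

Lemma pth_sorted e : e \in E -> sorted adjp (pth L e).
Proof. by case/(pth_ok M) => x [y [_ _ [p [t [-> hp]]]]]. Qed.

Lemma pth_uniq e : e \in E -> uniq (pth L e).
Proof. by case/(pth_ok M) => x [y [_ _ [p [t [-> _ hu]]]]]. Qed.

Lemma pth_ball e z v : e \in E -> z \in pth L e -> ball_of L v z -> v \in e.
Proof.
move=> he; have [x [y [-> _ [p [t [-> _ _ _ hz]]]]]] := pth_ok M he.
by move=> h1 h2; case: (hz z v h1 h2) => -[-> _]; rewrite !inE eqxx ?orbT.
Qed.

Lemma pth_interior e s1 a z b s2 v : e \in E -> pth L e = s1 ++ [:: a, z, b & s2] ->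
  ~~ ball_of L v z.
Proof.
move=> he hs; apply/negP => hv.
have [x [y [_ _ [p [t [hp _ hu _ hz]]]]]] := pth_ok M he.
have zin : z \in p :: t by rewrite -hp hs mem_cat !inE eqxx !orbT.
rewrite -hp hs in hu.
case: (hz z v zin hv) => -[_ ez].
  move: hp; rewrite hs; case: s1 {hs} hu => [|c s1] hu [e1 _].
    by move: hu; rewrite ez e1 /= mem_head.
  by move: hu; rewrite ez e1 /= mem_cat !inE eqxx !orbT.
have : last p t = last b s2.
  have -> : last p t = last z (pth L e) by rewrite hp.
  by rewrite hs last_cat.
rewrite -ez => ez'; move: hu; rewrite -[s1 ++ _]/(s1 ++ [:: a, z & b :: s2]).
rewrite cat_uniq => /and3P[_ _ /= /and3P[_ hzb _]].
by move: hzb; rewrite {1}ez' mem_last.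
Qed.

(* The grid edges covered by the paths of [EF] and the balls of [F]. *)
Definition Kset (EF : {set {set V}}) (F : {set V}) : rel pt := fun p q =>
  [exists e in EF, inedge (pth L e) p q] || [exists v in F, ball_of L v p && ball_of L v q].

Lemma KsetP (EF : {set {set V}}) (F : {set V}) p q : reflect ((exists2 e, e \in EF & inedge (pth L e) p q) \/
  (exists2 v, v \in F & ball_of L v p /\ ball_of L v q)) (Kset EF F p q).
Proof.
apply: (iffP orP) => -[].
- by move/existsP => [e /andP[h1 h2]]; left; exists e.
- by move/existsP => [v /and3P[h1 h2 h3]]; right; exists v.
- by move=> [e h1 h2]; left; apply/existsP; exists e; rewrite h1.
- by move=> [v h1 [h2 h3]]; right; apply/existsP; exists v; rewrite h1 h2 h3.
Qed.

(** An interior point of the path lies in no ball and on no other path, so only two edges of [Kset]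
    meet there and [dif_thru] carries the change from one to the next. *)
Lemma dif_along (EF : {set {set V}}) (F : {set V}) col e : EF \subset E -> e \in EF -> flat (Kset EF F) col ->
  forall a b c d, inedge (pth L e) a b -> inedge (pth L e) c d -> dif col a b = dif col c d.
Proof.
move=> /subsetP sub he hfl; have heE := sub _ he.
have hsort := pth_sorted heE; have hu := pth_uniq heE.
have key s1 a z b s2 : pth L e = s1 ++ [:: a, z, b & s2] -> dif col a z = dif col z b.
  move=> hs.
  have iaz : inedge (pth L e) a z by apply/inedgeP; exists s1, (b :: s2); left.
  have izb : inedge (pth L e) z b by apply/inedgeP; exists (rcons s1 a), s2; left; rewrite cat_rcons.
  have aaz := inedge_adjp hsort iaz; have azb := inedge_adjp hsort izb.
  rewrite dif_sym //; apply: dif_thru => //; first by rewrite adjp_sym.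
    move: hu; rewrite hs cat_uniq => /and3P[_ _ /= /andP[+ _]].
    by rewrite !inE !negb_or => /and3P[].
  move=> q hzq hqa hqb; apply: hfl => //; apply/negP => /KsetP[[e' he' hin]|[v _ [hv _]]].
    have ee : e' = e.
      apply: (@pth_disj _ _ _ M e' e z) => //; first exact: sub.
        by have /andP[+ _] := inedge_mem hin.
      by have /andP[_ +] := inedge_mem iaz.
    rewrite ee in hin; case: (uniq_nbr hu hs hin) => eq.
      by rewrite eq eqxx in hqa.
    by rewrite eq eqxx in hqb.
  by move: hv; apply/negP; exact: pth_interior heE hs.
have all_eq s0 s : pth L e = s0 ++ s -> forall a b c d, (a, b) \in steps s -> (c, d) \in steps s ->
    dif col a b = dif col c d.
  elim: s s0 => [|p [|q [|r s]] IH] // s0 hs a b c d.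
    by rewrite !inE => /eqP[-> ->] /eqP[-> ->].
  have hk := key _ _ _ _ _ hs.
  have hs' : pth L e = rcons s0 p ++ [:: q, r & s] by rewrite cat_rcons.
  have qr : (q, r) \in steps [:: q, r & s] by rewrite steps_cons mem_head.
  rewrite steps_cons !in_cons => /orP[/eqP[-> ->]|h1] /orP[/eqP[-> ->]|h2] //.
  - by rewrite hk; apply: (IH _ hs').
  - by rewrite hk; apply: (IH _ hs').
  exact: (IH _ hs').
have norm a b : inedge (pth L e) a b -> exists a' b', (a', b') \in steps (pth L e) /\
    dif col a b = dif col a' b'.
  move=> hin; have hab := inedge_adjp hsort hin.
  case/hasP: hin => -[a' b'] h /orP[]/eqP[e1 e2]; exists a', b'; split=> //; rewrite e1 e2 //.
  by rewrite dif_sym.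
move=> a b c d /norm[a' [b' [h1 ->]]] /norm[c' [d' [h2 ->]]].
exact: (all_eq [::]).
Qed.

Definition outside (F : {set V}) f := forall v, v \in F -> ~~ fball L v f.

(* A drawn forest does not separate the plane: a colour change along the path of an edge
   persists over the whole path, and around a ball it cannot occur just once. *)
Lemma forest_complement (EF : {set {set V}}) (F : {set V}) col :
  EF \subset E -> (forall e, e \in EF -> e \subset F) -> is_forest EF ->
  flat (Kset EF F) col -> forall f g, outside F f -> outside F g -> col f = col g.
Proof.
move=> sub hEF hF hfl.
pose EZ := [set e in EF | `[< exists p q, inedge (pth L e) p q /\ dif col p q >]].
have subZ : EZ \subset EF by apply/subsetP => e; rewrite inE => /andP[].
have EZ0 : EZ = finset.set0.
  apply/eqP; apply: contraT => /set0Pn[e0 he0].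
  have sZ : simple_graph EZ.
    by move=> e he; apply: model_simple; apply: (subsetP sub); apply: (subsetP subZ).
  have [v [e [he hv hve]]] := forest_leaf sZ (forest_sub subZ hF) he0.
  have heF := subsetP subZ _ he; have heE := subsetP sub _ heF.
  have [p0 [q0 [hp0 hq0 a0 in0 un0]]] := out_edge heE hv.
  have d0 : dif col p0 q0.
    move: he; rewrite inE => /andP[_ /asboolP[p [q [hpq d]]]].
    by rewrite (dif_along sub heF hfl in0 hpq).
  suff : dif col p0 q0 = false by rewrite d0.
  apply: (ring_one (rad_ge1 M v) hp0 hq0 a0) => p q hp hq hpq hne.
  apply/negP => dpq.
  have : Kset EF F p q by apply: contraT => hn; rewrite (hfl _ _ hpq hn) in dpq.
  case/KsetP => [[e' he' hin]|[w hw [h1 h2]]]; last first.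
    have ew : w = v by exact: ball_disj M _ _ _ h1 hp.
    by rewrite ew in h2; move: hq; rewrite -/(ball_of L v q) h2.
  have hve' : v \in e'.
    by apply: (pth_ball (subsetP sub _ he') _ hp); have /andP[] := inedge_mem hin.
  have ee : e' = e.
    by apply: hve => //; rewrite inE he'; apply/asboolP; exists p, q.
  rewrite ee in hin; have [e1 e2] := un0 _ _ hp hin.
  by rewrite e1 e2 eqxx in hne.
have d0 p q : adjp p q -> (forall v, v \in F -> ~~ (ball_of L v p && ball_of L v q)) ->
    dif col p q = false.
  move=> hpq hout; apply/negP => dpq.
  have : Kset EF F p q by apply: contraT => hn; rewrite (hfl _ _ hpq hn) in dpq.
  case/KsetP => [[e he hin]|[v hv [h1 h2]]]; last by have := hout v hv; rewrite h1 h2.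
  have : e \in EZ by rewrite inE he; apply/asboolP; exists p, q.
  by rewrite EZ0 inE.
(* Inside the balls of [F] the colour is arbitrary, because [Kset] contains all their edges.
   Repainting each ball with the colour of the ring around it leaves no change anywhere, so that
   [const_all] applies. *)
pose ref v := col ((ctr L v).1 - rad L v - 1, (ctr L v).2 - rad L v - 1).
pose col' f := if [pick v in F | fball L v f] is Some v then ref v else col f.
have col'_in v f : v \in F -> fball L v f -> col' f = ref v.
  move=> hv hf; rewrite /col'; case: pickP => [w /andP[hw hwf]|/(_ v)]; last by rewrite hv hf.
  by congr ref; apply: (ball_disj M) (inface_inb hwf) (inface_inb hf).
have col'_out f : outside F f -> col' f = col f.
  move=> ho; rewrite /col'; case: pickP => // w /andP[hw hwf].
  by move: (ho w hw); rewrite hwf.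
have c' : forall p q, adjp p q -> dif col' p q = false.
  move=> p q hpq; have [/existsP[v /and3P[hv hp hq]]|hn] :=
    boolP [exists v in F, ball_of L v p && ball_of L v q].
    have side f : corner f p -> col' f = ref v.
      move=> hc; have [hf|hf] := boolP (fball L v f); first exact: col'_in.
      rewrite col'_out; last first.
        move=> w hw; apply/negP => hwf; have hwp := inface_corner hwf hc.
        by have ew : w = v := ball_disj M hwp hp; rewrite ew in hwf; rewrite hwf in hf.
      apply: (ring_const (rad_ge1 M v) _ hf hp hc) => a b ha hb hab; apply: d0 => // w hw.
      apply/negP => /andP[h1 h2]; have ew := ball_disj M h1 ha; rewrite ew in h2.
      by move: hb; rewrite -/(ball_of L v b) h2.
    by rewrite /dif (side _ (corner_side1 hpq)) (side _ (corner_side2 hpq)) addbb.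
  have hn' v : v \in F -> ~~ (ball_of L v p && ball_of L v q).
    by move=> hv; apply: contra hn => h; apply/existsP; exists v; rewrite hv.
  rewrite /dif !col'_out; first exact: d0.
    by move=> v hv; have /andP[] := out_side hpq (hn' v hv).
  by move=> v hv; have /andP[] := out_side hpq (hn' v hv).
move=> f g hf hg; rewrite -(col'_out f hf) -(col'_out g hg).
exact: const_all.
Qed.

End Layout.

Lemma adjpp p : adjp p p = false.
Proof. by rewrite /adjp; lia. Qed.

Definition side_of (p q f : pt) : Prop := f = side1 p q \/ f = side2 p q.

Lemma side_of_sym p q f : adjp p q -> side_of p q f -> side_of q p f.
Proof. by move=> h [] ->; [left; exact: side1_sym | right; exact: side2_sym]. Qed.

Lemma side_of_corner p q f : adjp p q -> side_of p q f -> corner f p /\ corner f q.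
Proof.
by move=> h [] ->; rewrite ?corner_side1 ?corner_side1r ?corner_side2 ?corner_side2r.
Qed.

(** * Reachability of faces *)

Inductive reach (K : rel pt) (f : pt) : pt -> Prop :=
| reach0 : reach K f f
| reach_step g h p q : reach K f g -> adjp p q -> ~~ K p q -> side_of p q g -> side_of p q h ->
    reach K f h.

Lemma reach1 K p q f g : adjp p q -> ~~ K p q -> side_of p q f -> side_of p q g -> reach K f g.
Proof. by move=> h1 h2 h3 h4; apply: reach_step h1 h2 h3 h4; exact: reach0. Qed.

Lemma reach_trans K g f h : reach K f g -> reach K g h -> reach K f h.
Proof.
move=> h1; elim => // g' h' p q _ IH h2 h3 h4 h5.
exact: reach_step IH h2 h3 h4 h5.
Qed.

Lemma reach_sym K f g : reach K f g -> reach K g f.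
Proof.
elim=> [|g' h p q _ IH h1 h2 h3 h4]; first exact: reach0.
by apply: reach_trans IH; exact: reach1 h4 h3.
Qed.

(** The centre of the face, as a point of the doubled grid. *)
Definition cen (f : pt) : pt := (2 * f.1 + 1, 2 * f.2 + 1).

Lemma adjp_cen_mid p q f : adjp p q -> side_of p q f -> adjp (cen f) (mid p q).
Proof.
move=> h [] ->; rewrite /cen /mid /side1 /side2; move: h; rewrite /adjp.
  by case: ifP => /=; lia.
by rewrite /=; lia.
Qed.

(** Passing from one face to the next becomes centre, midpoint of the crossed edge, centre. Every
    point remembers an edge outside [K], which is what later keeps the walk off the drawing. *)
Lemma reach_walk K f g : reach K f g -> exists s, [/\ path adjp (cen f) s, last (cen f) s = cen g &
  forall z, z \in s -> exists p q, [/\ adjp p q, ~~ K p q &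
     z = mid p q \/ exists2 h, side_of p q h & z = cen h]].
Proof.
elim=> [|g' h p q _ [s [hs hl hz]] h1 h2 h3 h4]; first by exists [::].
exists (s ++ [:: mid p q; cen h]); split.
- rewrite cat_path hs hl /= adjp_cen_mid //= andbT adjp_sym.
  exact: adjp_cen_mid.
- by rewrite last_cat.
move=> z; rewrite mem_cat => /orP[/hz //|]; rewrite !inE => /orP[] /eqP ->; exists p, q; split=> //.
  by left.
by right; exists h.
Qed.

(** The neighbours counterclockwise from the north, with [fc p i] the face between [nb p i] and
    [nb p i.+1]. The lists are repeated so that the index [i + 3] needs no reduction modulo 4. *)
Definition nb (p : pt) (i : nat) : pt :=
  nth p [:: (p.1, p.2 + 1); (p.1 - 1, p.2); (p.1, p.2 - 1); (p.1 + 1, p.2);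
            (p.1, p.2 + 1); (p.1 - 1, p.2); (p.1, p.2 - 1); (p.1 + 1, p.2)] i.

Definition fc (p : pt) (i : nat) : pt :=
  nth p [:: (p.1 - 1, p.2); (p.1 - 1, p.2 - 1); (p.1, p.2 - 1); p;
            (p.1 - 1, p.2); (p.1 - 1, p.2 - 1); (p.1, p.2 - 1); p] i.

Lemma adjp_nb p i : (i < 8)%N -> adjp p (nb p i).
Proof. by case: p => x y; do 8?case: i => [|i] //; rewrite /adjp /nb /=; lia. Qed.

Lemma nb_side p i : (i < 7)%N -> side_of p (nb p i.+1) (fc p i) /\ side_of p (nb p i.+1) (fc p i.+1).
Proof.
case: p => x y hi; have hs := side_of_sym.
have N : side_of (x, y) (x, y + 1) (x - 1, y) /\ side_of (x, y) (x, y + 1) (x, y).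
  by rewrite /side_of side_vert side2_vert; split; [left|right].
have E : side_of (x, y) (x + 1, y) (x, y - 1) /\ side_of (x, y) (x + 1, y) (x, y).
  by rewrite /side_of side_hor side2_hor; split; [left|right].
have S : side_of (x, y) (x, y - 1) (x - 1, y - 1) /\ side_of (x, y) (x, y - 1) (x, y - 1).
  have a := adjp_south x y; rewrite /side_of side1_sym // side2_sym.
  have := side_vert x (y - 1); have := side2_vert x (y - 1); rewrite subrK => -> ->.
  by split; [left|right].
have W : side_of (x, y) (x - 1, y) (x - 1, y - 1) /\ side_of (x, y) (x - 1, y) (x - 1, y).
  have a := adjp_west x y; rewrite /side_of side1_sym // side2_sym.
  have := side_hor (x - 1) y; have := side2_hor (x - 1) y; rewrite subrK => -> ->.
  by split; [left|right].
move: N E S W => [? ?] [? ?] [? ?] [? ?].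
by do 7?case: i hi => [|i] // hi.
Qed.

Lemma nb_surj p a : adjp p a -> exists2 i, (i < 4)%N & nb p i = a.
Proof.
case: p => x y /adjp_dirs[] ->.
- by exists 0%N.
- by exists 3%N.
- by exists 2%N.
- by exists 1%N.
Qed.

Lemma side_fc p i f : (i < 4)%N -> side_of p (nb p i) f -> f = fc p i \/ f = fc p (i + 3).
Proof.
move=> hi; have [h1 h2] := @nb_side p (i + 3) ltac:(by lia).
have e1 : nb p (i + 3).+1 = nb p i by do 4?case: i hi h1 h2 => [|i] // hi h1 h2.
have e2 : fc p (i + 3).+1 = fc p i by do 4?case: i hi h1 h2 e1 => [|i] // hi h1 h2 e1.
have ne : fc p i != fc p (i + 3).
  by case: p {h1 h2 e1 e2} => x y; do 4?case: i hi => [|i] // hi; rewrite /fc -plusE /= xpair_eqE; lia.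
move: h1 h2; rewrite e1 e2 => -[h1|h1] [h2|h2] [h|h]; rewrite h -?h1 -?h2; auto.
  by rewrite h1 h2 eqxx in ne.
by rewrite h1 h2 eqxx in ne.
Qed.

(* Turning around [p], away from the edge [p a], until the next edge of [K]. *)
Lemma rotate (K : rel pt) p a b f : adjp p a -> side_of p a f ->
  adjp p b -> b != a -> K p b ->
  exists c g, [/\ adjp p c, c != a, K p c, side_of p c g & reach K f g].
Proof.
move=> hpa hf hpb hba hK.
have [i hi ea] := nb_surj hpa.
have ne k : (0 < k < 4)%N -> nb p (i + k) != a.
  rewrite -ea; clear -hi; case: p => x y hk; do 4?case: i hi => [|i] // hi;
  by do 4?case: k hk => [|k] // hk; rewrite /nb -plusE /= xpair_eqE; lia.
have hadj k : (k < 4)%N -> adjp p (nb p (i + k)) by move=> hk; apply: adjp_nb; lia.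
have exK : [|| K p (nb p (i + 1)), K p (nb p (i + 2)) | K p (nb p (i + 3))].
  have [j hj eb] := nb_surj hpb.
  have hj' : exists2 k, (k < 4)%N & nb p (i + k) = b.
    rewrite -eb; case: (leqP i j) => hij.
      by exists (j - i)%N; [lia | rewrite subnKC].
    exists (4 + j - i)%N; first by lia.
    rewrite subnKC; last by lia.
    by clear -hj; do 4?case: j hj => [|j] // hj.
  have [k hk ek] := hj'.
  have : (0 < k)%N by rewrite lt0n; apply: contra hba => /eqP k0; rewrite -ek k0 addn0 ea.
  rewrite -ek in hK; clear -hk hK => k0.
  by do 4?case: k k0 hk hK => [|k] // k0 hk hK; rewrite hK ?orbT.
have sd j : (j < 3)%N -> side_of p (nb p (i + j.+1)) (fc p (i + j)) /\
    side_of p (nb p (i + j.+1)) (fc p (i + j.+1)).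
  by move=> hj; rewrite !addnS; apply: nb_side; lia.
have [s1 t1] := sd 0%N isT; have [s2 t2] := sd 1%N isT; have [s3 t3] := sd 2%N isT.
rewrite addn0 in s1.
(* The face [fc p i] comes just after the edge to [a] in the cyclic order and is turned forwards;
   [fc p (i + 3)] comes just before it and is turned backwards. *)
rewrite -ea in hf; case: (side_fc hi hf) => ->.
  have [K1|K1] := boolP (K p (nb p (i + 1))); last rewrite (negbTE K1) /= in exK.
    by exists (nb p (i + 1)), (fc p i); rewrite ne // hadj //; split=> //; exact: reach0.
  have r1 : reach K (fc p i) (fc p (i + 1)) by apply: reach1 s1 t1; rewrite ?K1 ?hadj.
  have [K2|K2] := boolP (K p (nb p (i + 2))); last rewrite (negbTE K2) /= in exK.
    by exists (nb p (i + 2)), (fc p (i + 1)); rewrite ne // hadj //; split.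
  have r2 : reach K (fc p (i + 1)) (fc p (i + 2)) by apply: reach1 s2 t2; rewrite ?K2 ?hadj.
  exists (nb p (i + 3)), (fc p (i + 2)); rewrite ne // hadj //; split=> //.
  exact: reach_trans r1 r2.
have [K3|K3] := boolP (K p (nb p (i + 3))); last rewrite (negbTE K3) orbF in exK.
  by exists (nb p (i + 3)), (fc p (i + 3)); rewrite ne // hadj //; split=> //; exact: reach0.
have r1 : reach K (fc p (i + 3)) (fc p (i + 2)) by apply: reach1 t3 s3; rewrite ?K3 ?hadj.
have [K2|K2] := boolP (K p (nb p (i + 2))); last rewrite (negbTE K2) orbF in exK.
  by exists (nb p (i + 2)), (fc p (i + 2)); rewrite ne // hadj //; split.
have r2 : reach K (fc p (i + 2)) (fc p (i + 1)) by apply: reach1 t2 s2; rewrite ?K2 ?hadj.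
exists (nb p (i + 1)), (fc p (i + 1)); rewrite ne // hadj //; split=> //.
exact: reach_trans r1 r2.
Qed.

(** * Following the drawing along its faces *)

Section Run.
Variables (V : finType) (E : {set {set V}}) (L : layout V).
Hypothesis M : is_model E L.
Local Notation K := (Kset L E [set: V]).

(** The face may lie inside the ball or just outside, along its border. Only an edge within the ball
    is asked for, since its midpoint will be the end of a new path. *)
Definition touch v f := exists p q,
  [/\ adjp p q, ball_of L v p, ball_of L v q & side_of p q f].

Lemma uniq_nbr_last (s : seq pt) a b z : uniq (rcons (rcons s a) b) ->
  inedge (rcons (rcons s a) b) b z -> z = a.
Proof.
rewrite -rev_uniq -inedge_rev !rev_rcons; exact: uniq_nbr_head.
Qed.

Lemma ball_nbr v p : ball_of L v p -> exists2 q, adjp p q & ball_of L v q.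
Proof.
have hr := rad_ge1 M v; move: hr; rewrite /ball_of; move: (ctr L v) (rad L v) => [a b] r hr.
case: p => x y hp; have [h|h] := lerP a x.
  by exists (x - 1, y); [exact: adjp_west | move: hp; rewrite /inb /=; lia].
by exists (x + 1, y); [exact: adjp_hor | move: hp; rewrite /inb /=; lia].
Qed.

(** The path is followed along one of its sides. At an interior point [rotate] can only stop at the
    next edge of the path; at the last point it stops at an edge inside the ball of [v]. *)
Lemma run_path e u v s : e \in E -> u != v -> opath L u v s ->
  s = pth L e \/ s = rev (pth L e) ->
  forall t s0 a b f, s = s0 ++ [:: a, b & t] -> side_of a b f ->
  exists2 g, reach K f g & touch v g.
Proof.
move=> he huv [p0 [t0 [es hp hu [hx hy] hz]]] hs.
rewrite -es in hu hz.
have hin a b : inedge (pth L e) a b = inedge s a b by case: hs => ->; rewrite ?inedge_rev.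
have hmem z : z \in s -> z \in pth L e by case: hs => ->; rewrite ?mem_rev.
have hsort : sorted adjp s by rewrite es.
have Kpth z w : z \in s -> (forall x, ~~ ball_of L x z) -> K z w -> inedge s z w.
  move=> hzs hball /KsetP[[e' he' hin']|[x _ [hx1 _]]]; last by move: (hball x); rewrite hx1.
  have /andP[hz' _] := inedge_mem hin'.
  by rewrite -hin -(pth_disj M he' he hz' (hmem _ hzs)).
elim=> [|c t IH] s0 a b f hs0 hf.
  have es' : s = rcons (rcons s0 a) b by rewrite -!cats1 -catA.
  have iab : inedge s a b by apply/inedgeP; exists s0, [::]; left.
  have aab := inedge_adjp hsort iab.
  have bl : b = last p0 t0.
    have : last p0 s = last p0 t0 by rewrite es.
    by rewrite es' last_rcons.
  have hb : ball_of L v b by rewrite bl.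
  have ha : ~~ ball_of L v a.
    apply/negP => ha; have ain : a \in s by have /andP[] := inedge_mem iab.
    case: (hz a v ain ha) => [[e1 _]|[_ e1]]; first by rewrite e1 eqxx in huv.
    by move: aab; rewrite e1 -bl adjpp.
  have [q hbq hq] := ball_nbr hb.
  have qa : q != a by apply: contra ha => /eqP <-.
  have Kbq : K b q by apply/KsetP; right; exists v; rewrite ?inE.
  have aba : adjp b a by rewrite adjp_sym.
  have [d [g [h1 h2 h3 h4 h5]]] := rotate aba (side_of_sym aab hf) hbq qa Kbq.
  exists g => //; exists b, d; split=> //.
  case/KsetP: h3 => [[e' he' hin']|[x _ [hx1 hx2]]]; last first.
    by rewrite (ball_disj M hb hx1).
  have /andP[hb' _] := inedge_mem hin'.
  have bs : b \in s by have /andP[] := inedge_mem iab.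
  rewrite (pth_disj M he' he hb' (hmem _ bs)) hin in hin'.
  rewrite es' in hin' hu; rewrite (uniq_nbr_last hu hin') in h2.
  by rewrite eqxx in h2.
have iab : inedge s a b by apply/inedgeP; exists s0, (c :: t); left.
have ibc : inedge s b c by apply/inedgeP; exists (rcons s0 a), t; left; rewrite cat_rcons.
have bs : b \in s by have /andP[] := inedge_mem iab.
have hball x : ~~ ball_of L x b.
  case: hs => hs; rewrite hs0 in hs; first exact: (pth_interior M x he (esym hs)).
  have : pth L e = rev (s0 ++ [:: a, b, c & t]) by rewrite hs revK.
  rewrite rev_cat !rev_cons -!cats1 -!catA /= => h.
  exact: (pth_interior M x he h).
have aab := inedge_adjp hsort iab; have abc := inedge_adjp hsort ibc.
have Kbc : K b c by apply/KsetP; left; exists e; rewrite ?hin.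
have ca : c != a.
  move: hu; rewrite hs0 cat_uniq => /and3P[_ _ /= /andP[+ _]].
  by rewrite !inE !negb_or [a == c]eq_sym => /and3P[].
have aba : adjp b a by rewrite adjp_sym.
have [d [g [h1 h2 h3 h4 h5]]] := rotate aba (side_of_sym aab hf) abc ca Kbc.
have dc : d = c.
  have := Kpth _ _ bs hball h3 => hd.
  by case: (uniq_nbr hu hs0 hd) => // da; rewrite da eqxx in h2.
rewrite dc in h4.
have [g' r1 r2] := IH (rcons s0 a) b c g ltac:(by rewrite cat_rcons) h4.
by exists g' => //; exact: reach_trans h5 r1.
Qed.

Lemma run e v a b f : e \in E -> v \in e -> inedge (pth L e) a b -> side_of a b f ->
  exists2 g, reach K f g & touch v g.
Proof.
move=> he hv hab hf; have [u [s [_ huv ho hs]]] := orient M he hv.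
have ho' := opath_rev ho.
have hs' : rev s = pth L e \/ rev s = rev (pth L e) by case: hs => ->; rewrite ?revK; auto.
have adj_ab := inedge_adjp (pth_sorted M he) hab.
have hab' : inedge (rev s) a b by case: hs' => ->; rewrite ?inedge_rev.
have huv' : u != v by rewrite eq_sym.
case/inedgeP: hab' => s1 [s2 [e1|e1]].
  exact: run_path he huv' ho' hs' _ _ _ _ _ e1 hf.
exact: run_path he huv' ho' hs' _ _ _ _ _ e1 (side_of_sym adj_ab hf).
Qed.

Lemma touch_center v : touch v (ctr L v).
Proof.
have hr := rad_ge1 M v.
exists (ctr L v), ((ctr L v).1, (ctr L v).2 + 1); split.
- by rewrite /adjp /=; lia.
- by rewrite /ball_of /inb; lia.
- by rewrite /ball_of /inb /=; lia.
by right; rewrite /side2 /=; case: (ctr L v) => x y /=; congr (_, _); lia.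
Qed.

Lemma center_outside v (F : {set V}) : v \notin F -> outside L F (ctr L v).
Proof.
move=> hv w hw; apply/negP => hf.
have := inface_inb hf; have := inb_center (ctr L v) (rad_ge1 M v) => h1 h2.
by move: hv; rewrite (ball_disj M h1 h2) hw.
Qed.

(** Colour the faces that can be reached from a face touching [A] without crossing the drawing. If
    none of them touched a vertex outside both [A] and [F], the colour would change only across the
    drawing of G[F], a forest, although it differs at [a0] and [b0]. *)
Lemma reach_between (F A : {set V}) a0 b0 :
  is_forest (induced_edges E F) -> a0 \in A -> b0 \notin A -> a0 \notin F -> b0 \notin F ->
  (forall a b, a \in A -> b \notin A -> b \notin F -> [set a; b] \notin E) ->
  [disjoint A & F] ->
  exists a b f g, [/\ a \in A, b \notin A, b \notin F, touch a f /\ touch b g & reach K f g].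
Proof.
move=> hF ha0 hb0 ha0F hb0F hAB dAF; apply: contrapT => hno.
pose P f := exists a g, [/\ a \in A, touch a g & reach K g f].
have noB b f : b \notin A -> b \notin F -> touch b f -> ~ P f.
  by move=> h1 h2 h3 [a [g [h4 h5 h6]]]; apply: hno; exists a, b, g, f.
have Pr f g : reach K f g -> P f -> P g.
  move=> r [a [h [h1 h2 h3]]]; exists a, h; split=> //; exact: reach_trans h3 r.
have Pr' f g : reach K f g -> P f <-> P g.
  by move=> r; split; apply: Pr => //; exact: reach_sym.
pose col f := `[< P f >].
have eqc f g : (P f <-> P g) -> col f = col g.
  by move=> h; apply/asboolP/asboolP; apply h.
have hfl : flat (Kset L (induced_edges E F) F) col.
  move=> p q hpq hn; rewrite /dif.
  have s1 : side_of p q (side1 p q) by left.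
  have s2 : side_of p q (side2 p q) by right.
  suff : col (side1 p q) = col (side2 p q) by move=> ->; rewrite addbb.
  apply: eqc; have [hK|hK] := boolP (K p q); last by apply: Pr'; exact: reach1 hpq hK s1 s2.
  case/KsetP: (hK) => [[e he hin]|[v _ [hp hq]]].
    (* Both sides of the path of [e] lead to faces touching [v]. So both are coloured if [v] is in
       [A], and neither is otherwise. *)
    have [v hve hvF] : exists2 v, v \in e & v \notin F.
      apply/subsetPn; apply: contra hn => heF; apply/KsetP; left; exists e => //.
      by rewrite inE he heF.
    have [g1 r1 t1] := run he hve hin s1; have [g2 r2 t2] := run he hve hin s2.
    have [hvA|hvA] := boolP (v \in A).
      split=> _; exists v.
        by exists g2; split=> //; exact: reach_sym.
      by exists g1; split=> //; exact: reach_sym.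
    by split => /Pr h; [case: (noB v g1 hvA hvF t1); exact: h | case: (noB v g2 hvA hvF t2); exact: h].
  have hvF : v \notin F.
    by apply: contra hn => hvF; apply/KsetP; right; exists v.
  have t1 : touch v (side1 p q) by exists p, q.
  have t2 : touch v (side2 p q) by exists p, q.
  have [hvA|hvA] := boolP (v \in A).
    by split=> _; exists v; [exists (side2 p q) | exists (side1 p q)]; split=> //; exact: reach0.
  by split => h; [case: (noB v _ hvA hvF t1 h) | case: (noB v _ hvA hvF t2 h)].
have sub : induced_edges E F \subset E by apply/subsetP => e; rewrite inE => /andP[].
have sub' e : e \in induced_edges E F -> e \subset F by rewrite inE => /andP[].
have := forest_complement M sub sub' hF hfl (center_outside ha0F) (center_outside hb0F).
have -> : col (ctr L a0) by apply/asboolP; exists a0, (ctr L a0); split=> //; [exact: touch_center | exact: reach0].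
by move=> /esym/asboolP; apply: noB; first exact: hb0; [exact: hb0F | exact: touch_center].
Qed.

(** * Refined layouts and the drawing of a new edge *)

Lemma dbl_inb o r p : inb (dp o) (2 * r) (dp p) = inb o r p.
Proof. by rewrite /inb /dp /=; apply/idP/idP; lia. Qed.

Lemma dbl_inb_mid o r p q : adjp p q -> inb (dp o) (2 * r) (mid p q) = inb o r p && inb o r q.
Proof. by rewrite /inb /dp /mid /adjp /= => h; apply/idP/idP; lia. Qed.

Lemma dbl_inb_cen o r f : inb (dp o) (2 * r) (cen f) = inface o r f.
Proof. by rewrite /inb /dp /cen /inface /=; apply/idP/idP; lia. Qed.

(** The doubled layout with [s0] as the path of a new edge [e0]. With the empty set, which is never
    an edge, for [e0] it is plain doubling. *)
Definition refined (e0 : {set V}) s0 : layout V :=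
  Layout (fun v => dp (ctr L v)) (fun v => 2 * rad L v)
    (fun e => if e == e0 then s0 else dbl (pth L e)).

Lemma ball_refined_disj e0 s0 u v p : ball_of (refined e0 s0) u p -> ball_of (refined e0 s0) v p ->
  u = v.
Proof.
have hx (o : pt) r : inb (dp o) (2 * r) p -> inb o r ((p.1 %/ 2)%Z, (p.2 %/ 2)%Z).
  by rewrite /inb /dp /=; lia.
by move=> /hx hu /hx hv; exact: (ball_disj M hu hv).
Qed.

Lemma refined_opath e0 s0 e x y : e \in E -> x != y -> opath L x y (pth L e) ->
  opath (refined e0 s0) x y (dbl (pth L e)).
Proof.
move=> he hxy [p [t [es hp hu [hx hy] hz]]]; rewrite es.
have [t' et] := dbl_cons p t; exists (dp p), t'.
have hl : last (dp p) t' = dp (last p t).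
  by have := dbl_last p t (dp p); rewrite et.
have sorted_pt : sorted adjp (p :: t) by [].
split=> //.
- by have := dbl_sorted sorted_pt; rewrite et.
- by rewrite -et dbl_uniq.
- by rewrite hl /ball_of /= !dbl_inb.
rewrite -et hl => z v /mem_dbl[[p' hp' ->]|[a [b [hab ->]]]]; rewrite /ball_of /=.
  by rewrite dbl_inb => /(hz _ _ hp')[[-> ->]|[-> ->]]; auto.
have aab := steps_adjp sorted_pt hab.
rewrite dbl_inb_mid // => /andP[hva hvb]; have /andP[ha hb] := mem_steps hab.
exfalso; case: (hz _ _ ha hva) => -[e1 e2]; case: (hz _ _ hb hvb) => -[e3 e4].
- by move: aab; rewrite e2 e4 adjpp.
- by rewrite -e1 e3 eqxx in hxy.
- by rewrite -e1 e3 eqxx in hxy.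
by move: aab; rewrite e2 e4 adjpp.
Qed.

Lemma dbl_pth_disj e f z : e \in E -> f \in E -> z \in dbl (pth L e) -> z \in dbl (pth L f) -> e = f.
Proof.
move=> he hf /mem_dbl[[p hp ->]|[a [b [hab ->]]]] /mem_dbl[[p' hp' e1]|[a' [b' [hab' e1]]]].
- by move: e1 => /dp_inj e1; rewrite -e1 in hp'; exact: (pth_disj M he hf hp hp').
- by have := mid_dp (steps_adjp (pth_sorted M hf) hab') (esym e1).
- by have := mid_dp (steps_adjp (pth_sorted M he) hab) e1.
have h1 := steps_adjp (pth_sorted M he) hab; have h2 := steps_adjp (pth_sorted M hf) hab'.
have /andP[ha hb] := mem_steps hab; have /andP[ha' hb'] := mem_steps hab'.
by case: (mid_inj h1 h2 e1) => -[e2 e3]; [rewrite e2 in ha'; exact: (pth_disj M he hf ha ha')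
  | rewrite e2 in ha'; exact: (pth_disj M he hf hb ha')].
Qed.

Lemma refined_model e0 s0 : e0 \notin E -> is_model E (refined e0 s0).
Proof.
move=> he0; have hne e : e \in E -> (e == e0) = false.
  by move=> he; apply/negbTE; apply: contra he0 => /eqP <-.
split=> [v|u v p|e he|e f z he hf] /=.
- by have := rad_ge1 M v; lia.
- exact: ball_refined_disj.
- have [x [y [e1 e2 e3]]] := pth_ok M he; exists x, y; split=> //.
  by rewrite hne //; exact: refined_opath.
by rewrite !hne //; exact: dbl_pth_disj.
Qed.

(** The face route of [reach_between], prolonged to a midpoint inside each of the two balls, is a
    walk of the doubled grid; [path_extract] trims it to the path of the new edge. *)
Lemma extend_model (F A : {set V}) a0 b0 :
  is_forest (induced_edges E F) -> a0 \in A -> b0 \notin A -> a0 \notin F -> b0 \notin F ->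
  (forall a b, a \in A -> b \notin A -> b \notin F -> [set a; b] \notin E) ->
  [disjoint A & F] ->
  exists a b s, [/\ a \in A, b \notin A, b \notin F &
    is_model ([set a; b] |: E) (refined [set a; b] s)].
Proof.
move=> hF ha0 hb0 ha0F hb0F hAB dAF.
have [a [b [f [g [ha hb hbF [tf tg] r]]]]] := reach_between hF ha0 hb0 ha0F hb0F hAB dAF.
have hab : a != b by apply: contra hb => /eqP <-.
have [p1 [q1 [a1 hp1 hq1 s1]]] := tf; have [p2 [q2 [a2 hp2 hq2 s2]]] := tg.
have [s [hs hl hz]] := reach_walk r.
pose D v := inb (dp (ctr L v)) (2 * rad L v).
have pw : path adjp (mid p1 q1) (cen f :: rcons s (mid p2 q2)).
  rewrite /= rcons_path hs hl adjp_sym (adjp_cen_mid a1 s1) /=; exact: adjp_cen_mid.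
have Da : D a (mid p1 q1) by rewrite /D dbl_inb_mid // [inb _ _ _]hp1.
have Db : D b (last (mid p1 q1) (cen f :: rcons s (mid p2 q2))).
  by rewrite /= last_rcons /D dbl_inb_mid // [inb _ _ _]hp2.
have [p' [s' [k1 k2 k3 [k4 k5] k6]]] := path_extract pw Da Db.
(* A face centre has two odd coordinates and so lies on no doubled path; the midpoint of an edge
   outside [K] lies on no path and in no ball; the two extreme midpoints belong to edges inside a
   ball, which no path uses. *)
have off z : z \in p' :: s' -> (forall e, e \in E -> z \notin dbl (pth L e)) /\
    (forall v, D v z -> v = a \/ v = b).
  move/k3.
  have cenP h : (forall v, inface (ctr L v) (rad L v) h -> v = a \/ v = b) ->
    (forall e, e \in E -> cen h \notin dbl (pth L e)) /\ (forall v, D v (cen h) -> v = a \/ v = b).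
    move=> hv; split=> [e he|v]; last by rewrite /D dbl_inb_cen => /hv.
    apply/negP => /mem_dbl[[p _]|[c [d [hcd]]]].
      by rewrite /cen /dp => -[]; clear; lia.
    have := steps_adjp (pth_sorted M he) hcd.
    by rewrite /adjp /cen /mid => h' -[]; move: h'; clear; lia.
  have endP v p q : ball_of L v p -> ball_of L v q -> adjp p q -> v = a \/ v = b ->
      (forall e, e \in E -> mid p q \notin dbl (pth L e)) /\
      (forall w, D w (mid p q) -> w = a \/ w = b).
    move=> hp hq hpq hv; split=> [e he|w]; last first.
      by rewrite /D dbl_inb_mid // => /andP[hw _]; rewrite (ball_disj M hw hp).
    apply/negP => /mem_dbl[[z' _ /(mid_dp hpq)//]|[c [d [hcd e1]]]].
    have hcd' := steps_adjp (pth_sorted M he) hcd.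
    have hin : inedge (pth L e) p q.
      by apply/hasP; exists (c, d) => //; case: (mid_inj hpq hcd' e1) => -[-> ->];
        rewrite /same_edge eqxx ?orbT.
    have hve : v \in e by apply: (pth_ball M he _ hp); have /andP[] := inedge_mem hin.
    have [p3 [q3 [_ hq3 _ _ un]]] := out_edge M he hve.
    by have [_ e2] := un _ _ hp hin; rewrite -e2 hq in hq3.
  rewrite !inE mem_rcons !inE => /or4P[/eqP->|/eqP->|/eqP->|/hz [p [q [hpq hK [->|[h hh ->]]]]]].
  - by apply: (endP a) => //; left.
  - apply: cenP => v hv; left; have [hc _] := side_of_corner a1 s1.
    exact: (ball_disj M (inface_corner hv hc) hp1).
  - by apply: (endP b) => //; right.
  - split=> [e he|v]; last first.
      rewrite /D dbl_inb_mid // => /andP[h1 h2].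
      by case/KsetP: hK; right; exists v; rewrite ?inE.
    apply/negP => /mem_dbl[[z' _ /(mid_dp hpq)//]|[c [d [hcd e1]]]].
    have hcd' := steps_adjp (pth_sorted M he) hcd.
    case/KsetP: hK; left; exists e => //.
    by apply/hasP; exists (c, d) => //; case: (mid_inj hpq hcd' e1) => -[-> ->];
        rewrite /same_edge eqxx ?orbT.
  apply: cenP => v hv; exfalso; have [hc1 hc2] := side_of_corner hpq hh.
  by case/KsetP: hK; right; exists v; rewrite ?inE //; split;
    [exact: (inface_corner hv hc1) | exact: (inface_corner hv hc2)].
exists a, b, (p' :: s'); split=> //.
have he0 := hAB a b ha hb hbF.
have M' := refined_model (p' :: s') he0.
have hne e : e \in E -> (e == [set a; b]) = false.
  by move=> he; apply/negbTE; apply: contra he0 => /eqP <-.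
split.
- exact: (rad_ge1 M').
- exact: (ball_disj M').
- move=> e; rewrite in_setU1 => /orP[/eqP ->|]; last exact: (@pth_ok _ _ _ M').
  exists a, b; split=> //; rewrite /refined /= eqxx; exists p', s'; split=> //.
  move=> z v hz' hv.
  have [h1 h2] := k6 _ hz'; have [_ h3] := off _ hz'.
  case: (h3 v hv) => ev; rewrite ev in hv *; [left | right]; split=> //; first exact: h1.
  exact: h2.
move=> e e' z; rewrite !in_setU1 => /orP[/eqP->|he] /orP[/eqP->|he'] //=; rewrite ?eqxx ?hne //.
- by move=> hz1; have [h1 _] := off _ hz1; rewrite (negbTE (h1 _ he')).
- by move=> + hz1; have [h1 _] := off _ hz1; rewrite (negbTE (h1 _ he)).
exact: dbl_pth_disj.
Qed.

End Run.

(** * Edge chains *)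

Lemma cnt_uniq s a b : uniq s -> inedge s a b -> cnt s a b.
Proof.
elim: s => [|p [|q s] IH] //; rewrite cons_uniq => /andP[hp hu].
rewrite /inedge /cnt steps_cons => hin.
have hn c d : same_edge a b (p, q) -> (c, d) \in steps (q :: s) -> ~~ same_edge a b (c, d).
  rewrite /same_edge !xpair_eqE => h1 /mem_steps /andP[hc hd].
  apply/negP => h2.
  have : (p == c) || (p == d).
    by case/orP: h1 => /andP[/eqP -> _]; case/orP: h2 => /andP[/eqP -> /eqP ->]; rewrite eqxx ?orbT.
  by case/orP => /eqP e; rewrite e ?hc ?hd in hp.
have [h|h] := boolP (same_edge a b (p, q)).
  rewrite [count _ _]/= h (_ : count _ _ = 0%N) //.
  apply/eqP; rewrite -leqn0 leqNgt -has_count; apply/hasPn => -[c d]; exact: hn.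
move: hin; rewrite [has _ _]/= [count _ _]/= (negbTE h) /= => hin.
exact: IH.
Qed.

Section Chains.
Variables (V : finType) (E : {set {set V}}) (L : layout V).
Hypothesis M : is_model E L.

Lemma inedge_not_ball e p q v : e \in E -> inedge (pth L e) p q ->
  ball_of L v p -> ball_of L v q -> False.
Proof.
move=> he hin hp hq; have /andP[h1 _] := inedge_mem hin.
have [p3 [q3 [_ hq3 _ _ un]]] := out_edge M he (pth_ball M he h1 hp).
by have [_ e2] := un _ _ hp hin; rewrite -e2 hq in hq3.
Qed.

Lemma ball_walk v p q : ball_of L v p -> ball_of L v q ->
  exists s, [/\ path adjp p s, last p s = q & forall z, z \in p :: s -> ball_of L v z].
Proof.
move=> hp hq; have [s [h1 h2 h3]] := box_walk p q.
by exists s; split=> // z /h3; exact: in_box_inb.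
Qed.

Lemma sum_edge (x y : V) (h : V -> bool) : x != y ->
  \big[addb/false]_(z in [set x; y]) h z = h x (+) h y.
Proof. by move=> hxy; rewrite big_setU1 ?inE //= big_set1. Qed.

(** The drawn edge as a chain modulo 2 from centre to centre: its path, completed by a walk in each
    of the two balls. The last clause says that the additions do not cancel any part of the path. *)
Definition edge_chain (e : {set V}) (ws : seq (seq pt)) : Prop :=
  [/\ all (sorted adjp) ws,
      forall h, \big[addb/false]_(w <- ws) wends h w = \big[addb/false]_(x in e) h (ctr L x),
      forall p q w, w \in ws -> inedge w p q ->
        inedge (pth L e) p q \/ exists2 v, v \in e & ball_of L v p /\ ball_of L v q &
      forall p q, inedge (pth L e) p q -> Cnt ws p q].

Lemma edge_chain_exists e : e \in E -> exists ws, edge_chain e ws.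
Proof.
move=> he; have [x [y [exy hxy [p [t [es hp hu [hx hy] hz]]]]]] := pth_ok M he.
have cx : ball_of L x (ctr L x) by exact: inb_center (rad_ge1 M x).
have cy : ball_of L y (ctr L y) by exact: inb_center (rad_ge1 M y).
have [s1 [p1 l1 b1]] := ball_walk cx hx; have [s2 [p2 l2 b2]] := ball_walk hy cy.
have xe : x \in e by rewrite exy set21.
have ye : y \in e by rewrite exy set22.
exists [:: ctr L x :: s1; pth L e; last p t :: s2]; split.
- by rewrite /= p1 p2 es /= hp.
- move=> h; rewrite !big_cons big_nil es exy sum_edge //= l1 l2.
  by case: (h _) (h _) (h _) (h _) => -[] [] [].
- move=> a b w; rewrite !inE => /or3P[]/eqP -> hin; first 1 last.
  + by left.
  + by right; exists y => //; have /andP[ha hb] := inedge_mem hin; split; exact: b2.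
  by right; exists x => //; have /andP[ha hb] := inedge_mem hin; split; exact: b1.
move=> a b hin; rewrite /Cnt !big_cons big_nil.
rewrite [cnt (pth L e) a b]cnt_uniq ?(pth_uniq M he) // ?cnt_inedge //.
  apply/negP => /inedge_mem /andP[ha hb].
  by apply: (inedge_not_ball he hin (b2 _ ha) (b2 _ hb)).
apply/negP => /inedge_mem /andP[ha hb].
by apply: (inedge_not_ball he hin (b1 _ ha) (b1 _ hb)).
Qed.

Variable ws : {set V} -> seq (seq pt).
Hypothesis hws : forall e, e \in E -> edge_chain e (ws e).

Definition chain_par (es : seq {set V}) f := \big[addb/false]_(e <- es) Par (ws e) f.
(** Every vertex lies on an even number of members of the list; test functions are used to match
    [closed_chain]. *)
Definition closed_edges (es : seq {set V}) := forall h : V -> bool,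
  \big[addb/false]_(e <- es) \big[addb/false]_(x in e) h x = false.
Definition ends (es : seq {set V}) : {set V} := [set x | has (fun e : {set V} => x \in e) es].
Definition Kes (es : seq {set V}) := Kset L [set e in es] (ends es).

Lemma endsP (es : seq {set V}) x : reflect (exists2 e : {set V}, e \in es & x \in e) (x \in ends es).
Proof. by rewrite inE; exact: hasP. Qed.

Lemma chain_parE es f : chain_par es f = Par (flatten [seq ws e | e <- es]) f.
Proof.
rewrite /chain_par /Par; elim: es => [|e es IH]; first by rewrite !big_nil.
by rewrite big_cons /= big_cat /= IH.
Qed.

Section Closed.
Variable es : seq {set V}.
Hypothesis hes : {subset es <= E}.
Hypothesis hc : closed_edges es.

Lemma chain_sorted : all (sorted adjp) (flatten [seq ws e | e <- es]).
Proof.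
apply/allP => w /flattenP[s /mapP[e he ->] hw].
by have [h _ _ _] := hws (hes he); exact: (allP h).
Qed.

Lemma chain_closed : closed_chain (flatten [seq ws e | e <- es]).
Proof.
move=> h; rewrite big_flatten big_map -[RHS](hc (fun x => h (ctr L x))).
by rewrite big_seq [RHS]big_seq; apply: eq_bigr => e he; have [_ -> _ _] := hws (hes he).
Qed.

Lemma chain_flat : flat (Kes es) (chain_par es).
Proof.
move=> p q hpq hn; rewrite /dif !chain_parE -/(dif _ p q).
apply: (flat_Par chain_sorted chain_closed (K := Kes es)) => // a b w /flattenP[s /mapP[e he ->] hw] hin.
have [_ _ h _] := hws (hes he); apply/KsetP.
case: (h _ _ _ hw hin) => [h1|[v hv h1]]; first by left; exists e; rewrite ?inE.
by right; exists v => //; apply/endsP; exists e.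
Qed.

Lemma chain_dif e es' p q : es = e :: es' -> e \notin es' -> inedge (pth L e) p q ->
  dif (chain_par es) p q.
Proof.
move=> ees hne hin; have heE : e \in E by apply: hes; rewrite ees mem_head.
have hpq := inedge_adjp (pth_sorted M heE) hin.
rewrite /dif !chain_parE -/(dif _ p q) (dif_Par chain_sorted chain_closed hpq).
rewrite /Cnt big_flatten big_map ees big_cons -/(Cnt _ p q).
have [_ _ _ ->] := hws heE => //.
rewrite big1_seq // => e' /andP[_ he']; have he'E : e' \in E by apply: hes; rewrite ees inE he' orbT.
apply: big1_seq => w /andP[_ hw]; apply: cnt_inedge; apply/negP => hin'.
have [_ _ h _] := hws he'E; case: (h _ _ _ hw hin') => [h1|[v _ [h1 h2]]].
  have /andP[m1 _] := inedge_mem hin; have /andP[m2 _] := inedge_mem h1.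
  by rewrite -(pth_disj M he'E heE m2 m1) he' in hne.
exact: (inedge_not_ball heE hin h1 h2).
Qed.

Lemma off_ball x p q : x \notin ends es -> ball_of L x p -> ~~ Kes es p q.
Proof.
move=> hx hp; apply/negP => /KsetP[[e]|[v hv [h1 _]]].
  rewrite inE => he /inedge_mem /andP[hm _].
  by case/endsP: hx; exists e => //; exact: (pth_ball M (hes he) hm hp).
by rewrite (ball_disj M hp h1) hv in hx.
Qed.

Lemma off_pth e p q : e \in E -> e \notin es -> p \in pth L e ->
  (forall v, v \in ends es -> ~~ ball_of L v p) -> ~~ Kes es p q.
Proof.
move=> he hne hp hb; apply/negP => /KsetP[[e']|[v hv [h1 _]]].
  rewrite inE => he' /inedge_mem /andP[hm _].
  by rewrite -(pth_disj M (hes he') he hm hp) he' in hne.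
by have := hb v hv; rewrite h1.
Qed.

Lemma chain_ball x p : x \notin ends es -> ball_of L x p -> chain_par es p = chain_par es (ctr L x).
Proof.
move=> hx hp; have cx : ball_of L x (ctr L x) by exact: inb_center (rad_ge1 M x).
have [s [h1 h2 h3]] := ball_walk hp cx.
rewrite -h2; apply: (flat_walk chain_flat h1) => a b ha _.
exact: off_ball hx (h3 _ ha).
Qed.

Lemma chain_pth e x p : e \in E -> e \notin es -> x \in e -> x \notin ends es -> p \in pth L e ->
  (forall v, v \in ends es -> ~~ ball_of L v p) -> chain_par es p = chain_par es (ctr L x).
Proof.
move=> he hne hx hxe hp hb; have [y [s [exy hxy [p0 [t [es0 hpt hu [hbx hby] hz]]] hs]]] := orient M he hx.
have hp' : p \in p0 :: t by rewrite -es0; case: hs => ->; rewrite ?mem_rev.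
have mem z : z \in p0 :: t -> z \in pth L e by rewrite -es0; case: hs => ->; rewrite ?mem_rev.
rewrite -(chain_ball hxe hbx).
case/splitPl: {hby} hp' hpt hu hz mem => t1 t2 hl hpt hu hz mem.
rewrite -hl; symmetry; apply: (flat_walk chain_flat).
  by move: hpt; rewrite cat_path => /andP[].
move=> a b ha _; have ha' : a \in p0 :: t1 ++ t2 by rewrite -cat_cons mem_cat ha.
apply: (off_pth _ he hne (mem _ ha')) => v hv; apply/negP => hva.
case: (hz a v ha' hva) => -[e1 e2]; first by rewrite e1 (negbTE hxe) in hv.
case: (t2) e2 hu => [|c t2'].
  rewrite cats0 hl => e2 _; rewrite e2 in hva.
  by move: (hb v hv); rewrite hva.
move=> e2; rewrite -cat_cons cat_uniq => /and3P[_ /hasPn h _].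
have : a \in c :: t2' by rewrite e2 last_cat /= mem_last.
by move/h; rewrite ha.
Qed.

(** The two balls and the path between them are joined lattice points without an edge of [Kes], so
    the colour is constant along them. *)
Lemma chain_edge x y : [set x; y] \in E -> x \notin ends es -> y \notin ends es ->
  chain_par es (ctr L x) = chain_par es (ctr L y).
Proof.
move=> he hx hy.
have hne : [set x; y] \notin es.
  by apply: contra hx => h; apply/endsP; exists [set x; y]; rewrite ?set21.
have [p [q [hp _ _ hin _]]] := out_edge M he (set21 x y).
have /andP[hm _] := inedge_mem hin.
have hb v : v \in ends es -> ~~ ball_of L v p.
  by move=> hv; apply/negP => h; rewrite (ball_disj M hp h) hv in hx.
rewrite -(chain_pth he hne (set21 x y) hx hm hb).
by rewrite -(chain_pth he hne (set22 x y) hy hm hb).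
Qed.

Lemma chain_corner f p : corner f p -> (forall q, adjp p q -> ~~ Kes es p q) ->
  chain_par es f = chain_par es p.
Proof. by move=> hc' h; exact: flat_corner chain_flat h hc'. Qed.

End Closed.

(** Meant for a cycle: each of its vertices is on the border of each of its sides. Otherwise the
    faces reachable from [z] give a colouring that changes only across the cycle without its edges
    at [x], a forest, although it differs at [z] and at the centre of [x]. *)
Lemma reach_vertex (EC : {set {set V}}) (S : {set V}) x z :
  EC \subset E -> (forall e, e \in EC -> e \subset S) -> x \in S ->
  is_forest [set e in EC | x \notin e] -> outside L S z ->
  exists f p q, [/\ reach (Kset L EC S) z f, adjp p q, side_of p q f &
    (ball_of L x p /\ ball_of L x q) \/ exists2 e, e \in EC & x \in e /\ inedge (pth L e) p q].
Proof.
move=> sub subS xS hF hz; apply: contrapT => hno.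
pose col f := `[< reach (Kset L EC S) z f >].
have no f p q : adjp p q -> side_of p q f ->
   (ball_of L x p /\ ball_of L x q) \/ (exists2 e, e \in EC & x \in e /\ inedge (pth L e) p q) ->
   col f = false.
  by move=> h1 h2 h3; apply/asboolP => h4; apply: hno; exists f, p, q.
have sub1 : [set e in EC | x \notin e] \subset E.
  by apply: (subset_trans _ sub); apply/subsetP => e; rewrite inE => /andP[].
have hfl : flat (Kset L [set e in EC | x \notin e] (S :\ x)) col.
  move=> p q hpq hn; rewrite /dif.
  have s1 : side_of p q (side1 p q) by left.
  have s2 : side_of p q (side2 p q) by right.
  have [/KsetP hK|hK] := boolP (Kset L EC S p q); last first.
    suff -> : col (side1 p q) = col (side2 p q) by rewrite addbb.
    by apply/asboolP/asboolP => h; apply: reach_trans h (reach1 hpq hK _ _).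
  have hx : (ball_of L x p /\ ball_of L x q) \/ (exists2 e, e \in EC & x \in e /\ inedge (pth L e) p q).
    case: hK => [[e he hin]|[v hv [hp hq]]].
      have [hxe|hxe] := boolP (x \in e); first by right; exists e.
      by case/KsetP: hn; left; exists e; rewrite ?inE ?he.
    have [e|hvx] := eqVneq v x; first by left; rewrite -e.
    by case/KsetP: hn; right; exists v; rewrite ?inE ?hvx.
  by rewrite (no _ _ _ hpq s1 hx) (no _ _ _ hpq s2 hx).
have sub2 e : e \in [set e in EC | x \notin e] -> e \subset S :\ x.
  rewrite inE => /andP[he hx]; apply/subsetP => y hy; rewrite !inE (subsetP (subS _ he)) // andbT.
  by apply: contra hx => /eqP <-.
have hz' : outside L (S :\ x) z by move=> v; rewrite inE => /andP[_]; exact: hz.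
have hx' : outside L (S :\ x) (ctr L x) by apply: (center_outside M); rewrite !inE eqxx.
have := forest_complement M sub1 sub2 hF hfl hz' hx'.
have -> : col z by apply/asboolP; exact: reach0.
have [p [q [h1 h2 h3 h4]]] := touch_center M x.
by rewrite (no _ _ _ h1 h4) //; left.
Qed.

End Chains.

(** * Edges of walks and cycles *)

Section Walks.
Variable V : finType.
Implicit Types (E : {set {set V}}) (x y : V) (s : seq V).

Definition edges_of x s : seq {set V} := pairmap (fun a b => [set a; b]) x s.

Lemma edges_of_mem x s e z : e \in edges_of x s -> z \in e -> z \in x :: s.
Proof.
elim: s x => [|y s IH] x //=; rewrite in_cons => /orP[/eqP->|/IH h].
  by rewrite !inE => /orP[] ->; rewrite ?orbT.
by move/h => hz; rewrite inE hz orbT.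
Qed.

Lemma edges_of_rcons x s y : edges_of x (rcons s y) = rcons (edges_of x s) [set last x s; y].
Proof. by elim: s x => [|z s IH] x //=; rewrite IH. Qed.

Lemma edges_of_sub E x s : path (adj E) x s -> {subset edges_of x s <= E}.
Proof.
elim: s x => [|y s IH] x //= /andP[hxy /IH hs] e.
by rewrite in_cons => /orP[/eqP->|/hs].
Qed.

Lemma edges_of_sum E x s (h : V -> bool) : simple_graph E -> path (adj E) x s ->
  \big[addb/false]_(e <- edges_of x s) \big[addb/false]_(z in e) h z = h x (+) h (last x s).
Proof.
move=> hE; elim: s x => [|y s IH] x /=; first by rewrite big_nil addbb.
case/andP=> hxy hs; rewrite big_cons IH // sum_edge; first by rewrite -addbA addKb.
by apply: contraTneq hxy => ->; apply/negP => /hE; rewrite setUid cards1.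
Qed.

(** On a cycle [v] would have two different neighbours, but [w] is the only one it can have in
    [E']. *)
Lemma forest_add_leaf E E' (v w : V) : is_forest E -> (forall e, e \in E -> v \notin e) ->
  E' \subset [set v; w] |: E -> is_forest E'.
Proof.
move=> hF hv /subsetP sub c [hsz hu hc].
have [vc|vc] := boolP (v \in c); last first.
  apply: (hF c); split=> //.
  have hin : {in c &, subrel (adj E') (adj E)}.
    move=> a b ha hb /sub; rewrite in_setU1 => /orP[/eqP e|//].
    have : v \in [set a; b] by rewrite e set21.
    by rewrite !inE => /orP[]/eqP e1; rewrite e1 ?ha ?hb in vc.
  by apply: (sub_in_cycle hin) hc; apply/allP.
have [i s es] := rot_to vc.
have hsz' : (2 < size (v :: s))%N by rewrite -es size_rot.
have hu' : uniq (v :: s) by rewrite -es rot_uniq.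
have hc' : cycle (adj E') (v :: s) by rewrite -es rot_cycle.
have nw a : adj E' v a -> a != v -> a = w.
  move=> /sub; rewrite in_setU1 => /orP[/eqP e ha|/hv]; last by rewrite set21.
  have : a \in [set v; w] by rewrite -e set22.
  by rewrite !inE (negbTE ha) => /eqP.
case: s {es} hsz' hu' hc' => [|a [|b s]] // _ hu' hc'.
have ha : a = w.
  apply: nw; first by move: hc' => /= /andP[].
  by move: hu'; rewrite /= !inE !negb_or eq_sym => /andP[/andP[]].
have hl : last b s = w.
  apply: nw.
    by rewrite adj_sym; move: hc'; rewrite /cycle rcons_path => /andP[_].
  move: hu' => /= /andP[+ _]; rewrite in_cons negb_or => /andP[_ h].
  by apply: contraNneq h => <-; exact: mem_last.
by move: hu'; rewrite ha -hl /= mem_last andbF.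
Qed.

Lemma path_forest x s : uniq (x :: s) -> is_forest [set e in edges_of x s].
Proof.
elim: s x => [|y s IH] x.
  move=> _ c [hsz hu hc]; case: c hsz hc {hu} => [|a [|b c]] //= _ /andP[].
  by rewrite /adj inE.
rewrite cons_uniq => /andP[hx hu].
apply: (@forest_add_leaf _ _ x y (IH y hu)).
  move=> e; rewrite inE => he; apply: contra hx; exact: edges_of_mem.
by apply/subsetP => e; rewrite !inE.
Qed.

Lemma cycle_minus_forest x y s (EC : {set {set V}}) : uniq [:: x, y & s] ->
  (forall e, e \in EC -> e \in edges_of x (rcons (y :: s) x)) ->
  is_forest [set e in EC | x \notin e].
Proof.
rewrite cons_uniq => /andP[_ hu] hEC; apply: forest_sub (path_forest hu).
apply/subsetP => e; rewrite !inE => /andP[/hEC + hx].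
rewrite edges_of_rcons mem_rcons in_cons => /orP[/eqP e1|].
  by rewrite e1 set22 in hx.
by rewrite /= in_cons => /orP[/eqP e1|//]; rewrite e1 set21 in hx.
Qed.

End Walks.

(** * Excluding a drawn K5 minor, and edge-maximality *)

Section K5.
Variables (V : finType) (E : {set {set V}}) (L : layout V).
Hypothesis M : is_model E L.
Variable ws : {set V} -> seq (seq pt).
Hypothesis hws : forall e, e \in E -> edge_chain L e (ws e).
Local Notation pi := (chain_par ws).

(* From [z], lying on the other side of the cycle [eC] than [u], the ball of [c] can be
   reached without crossing the cycle, hence without meeting the edges at [u]. *)
Lemma K5_side (eC es : seq {set V}) (S : {set V}) u c z :
  {subset eC <= E} -> closed_edges eC -> (forall e, e \in eC -> e \subset S) ->
  u \notin S -> (forall x, x \in S -> [set u; x] \in E) ->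
  {subset es <= E} -> closed_edges es ->
  (forall e, e \in es -> e \in eC \/ exists2 x, x \in S & e = [set u; x]) ->
  c \in S -> c \notin ends es -> is_forest [set e in [set e in eC] | c \notin e] ->
  outside L S z -> pi eC z != pi eC (ctr L u) ->
  pi es z = pi es (ctr L c).
Proof.
move=> heC cC eCS uS huS hes ces hes' cS cends hF hz hne.
have subE : [set e in eC] \subset E by apply/subsetP => e; rewrite inE => /heC.
have subS e : e \in [set e in eC] -> e \subset S by rewrite inE; exact: eCS.
have endsC x : x \in ends eC -> x \in S.
  by case/endsP => e he hx; exact: (subsetP (eCS _ he)).
have uends : u \notin ends eC by apply: contra uS; exact: endsC.
have KC p q : Kes L eC p q -> Kset L [set e in eC] S p q.
  case/KsetP => h; apply/KsetP; first by left.
  by case: h => v hv h; right; exists v => //; exact: endsC.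
have flC : flat (Kset L [set e in eC] S) (pi eC).
  by move=> p q hpq hn; apply: (chain_flat hws heC cC hpq); apply: contra hn; exact: KC.
have eqdif col p q f g : dif col p q = false -> side_of p q f -> side_of p q g -> col f = col g.
  by rewrite /dif => h [->|->] [->|->] //; move: h; case: (col _) (col _) => -[].
have [f [p [q [r hpq hs hend]]]] := reach_vertex M subE subS cS hF hz.
(* A face beside a point that is joined to [u] off the cycle has the colour of [u], whereas the
   route keeps the colour of [z]. *)
have nearu g p' : corner g p' -> (forall q', adjp p' q' -> ~~ Kes L eC p' q') ->
    pi eC p' = pi eC (ctr L u) -> pi eC g = pi eC z -> False.
  move=> h1 h2 h3 h4; move: hne; rewrite -h4 (chain_corner hws heC cC h1 h2) h3.
  by rewrite eqxx.
(* Both colours stay constant along the route: that of [eC] by flatness, and that of [es] because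
   its edges outside the cycle are spokes, drawn on the side of [u], which the route never
   enters. *)
have [hf _] : pi es f = pi es z /\ pi eC f = pi eC z.
  elim: r => [//|g h a b _ [IH1 IH2] hab hK sg sh]; split; last first.
    by rewrite -IH2; exact: (eqdif _ _ _ _ _ (flC _ _ hab hK)).
  rewrite -IH1; apply: (eqdif _ a b) => //.
  apply: (chain_flat hws hes ces hab); apply/negP => /KsetP.
  have [ca cb] := side_of_corner hab sg.
  case=> [[e]|[v hv [ha hb]]].
    rewrite inE => he hin; case: (hes' e he) => [heC'|[x xS exu]].
      by case/KsetP: hK; left; exists e; rewrite ?inE.
    have heE := hes _ he.
    have hneC : e \notin eC.
      by apply: contra uS => heC'; apply: (subsetP (eCS _ heC')); rewrite exu set21.
    have ue : u \in e by rewrite exu set21.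
    have /andP[ma mb] := inedge_mem hin.
    (* A grid edge on the spoke has an end off the ball of [x], and from such a point the path leads
       to [u] without meeting the cycle. *)
    have go p' : p' \in pth L e -> ~~ ball_of L x p' -> corner g p' -> False.
      move=> mp hb hc.
      have hb' v : v \in ends eC -> ~~ ball_of L v p'.
        move=> hv; apply/negP => hvb; have := pth_ball M heE mp hvb.
        rewrite exu !inE => /orP[]/eqP e1; last by rewrite -e1 hvb in hb.
        by rewrite -e1 hv in uends.
      apply: (nearu g p' hc) IH2.
        by move=> q' _; exact: (off_pth M heC q' heE hneC mp hb').
      exact: (chain_pth M hws heC cC heE hneC ue uends mp hb').
    have [hxa|hxa] := boolP (ball_of L x a); last exact: go ma hxa ca.
    apply: (go b mb _ cb); apply/negP => hxb.
    exact: (inedge_not_ball M heE hin hxa hxb).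
  have [vu|vu] := eqVneq v u.
    rewrite vu in ha; apply: (nearu g a ca) IH2.
      by move=> q' _; exact: (off_ball M heC q' uends ha).
    exact: (chain_ball M hws heC cC uends ha).
  case/KsetP: hK; right; exists v => //.
  case/endsP: hv => e he hve; case: (hes' e he) => [heC'|[x xS exu]].
    exact: (subsetP (eCS _ heC')).
  by move: hve; rewrite exu !inE (negbTE vu) => /eqP ->.
rewrite -hf; have [cp cq] := side_of_corner hpq hs.
case: hend => [[hp _]|[e he [hce hin]]].
  rewrite -(chain_ball M hws hes ces cends hp).
  by apply: (chain_corner hws hes ces cp) => q' _; exact: (off_ball M hes q' cends hp).
rewrite inE in he; have heE := heC _ he.
have hnes : e \notin es by apply: contra cends => h; apply/endsP; exists e.
have [y [_ [ecy _ _ _]]] := orient M heE hce.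
have /andP[mp mq] := inedge_mem hin.
have go p' : p' \in pth L e -> ~~ ball_of L y p' -> corner f p' -> pi es f = pi es (ctr L c).
  move=> mp' hb hc.
  have hb' v : v \in ends es -> ~~ ball_of L v p'.
    move=> hv; apply/negP => hvb; have := pth_ball M heE mp' hvb.
    rewrite ecy !inE => /orP[]/eqP e1; last by rewrite -e1 hvb in hb.
    by rewrite -e1 hv in cends.
  rewrite -(chain_pth M hws hes ces heE hnes hce cends mp' hb').
  by apply: (chain_corner hws hes ces hc) => q' _; exact: (off_pth M hes q' heE hnes mp' hb').
have [hya|hya] := boolP (ball_of L y p); last exact: go mp hya cp.
apply: (go q mq _ cq); apply/negP => hyq.
exact: (inedge_not_ball M heE hin hya hyq).
Qed.

End K5.

Lemma adj_neq (V : finType) (E : {set {set V}}) x y : simple_graph E -> adj E x y -> x != y.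
Proof.
by move=> hE hxy; apply: contraTneq hxy => ->; apply/negP => /hE; rewrite setUid cards1.
Qed.

(** Let [z] be a face on the side of the cycle away from [u]. Three vertices of the cycle can each
    be reached, from [z] and from [v] alike, without meeting a certain cycle through [u]; so [z] and
    [v] have the same colour for each of these three cycles, hence for their sum, the given cycle.
    But [v] is adjacent to [u] and lies on its side. *)
Lemma no_K5 (V : finType) (E : {set {set V}}) (L : layout V) u v (D : {set V}) (c : seq V) :
  is_model E L -> is_cycle E c -> u \notin c -> (forall x, x \in c -> adj E u x) ->
  adj E u v -> u \notin D -> v \in D -> (forall x, x \in c -> x \notin D) ->
  (forall d, d \in D -> connect [rel x y | [&& adj E x y, x \in D & y \in D]] v d) ->
  (forall x, x \in c -> exists2 d, d \in D & adj E x d) -> False.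
Proof.
move=> M [hsz hu hcyc] uc huc huv uD vD cD hD hcD.
case: c hsz hu hcyc uc huc cD hcD => [|c1 [|c2 [|c3 rest]]] // _ hu hcyc uc huc cD hcD.
have hE := model_simple M.
have /choice[ws hws] : forall e, exists w, e \in E -> edge_chain L e w.
  move=> e; have [he|he] := boolP (e \in E); last by exists [::].
  by have [w hw] := edge_chain_exists M he; exists w.
pose a31 := edges_of c3 (rcons rest c1).
pose eC := [set c1; c2] :: [set c2; c3] :: a31.
have eCE : eC = edges_of c1 (rcons [:: c2, c3 & rest] c1) by [].
have hpath : path (adj E) c1 (rcons [:: c2, c3 & rest] c1) by exact: hcyc.
have [h12 h23 h31] : [/\ adj E c1 c2, adj E c2 c3 & path (adj E) c3 (rcons rest c1)].
  by move: hpath => /= /and3P[].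
have n12 := adj_neq hE h12; have n23 := adj_neq hE h23.
have n13 : c1 != c3.
  by move: hu => /= /andP[]; rewrite !inE !negb_or => /and3P[].
pose S := [set x in [:: c1, c2, c3 & rest]].
have c1S : c1 \in S by rewrite !inE eqxx.
have c2S : c2 \in S by rewrite !inE eqxx orbT.
have c3S : c3 \in S by rewrite !inE eqxx !orbT.
have uS : u \notin S by rewrite inE.
have huS x : x \in S -> [set u; x] \in E by rewrite inE; exact: huc.
have un x : x \in S -> u != x by move=> hx; apply: contraNneq uS => ->.
have heC : {subset eC <= E} by rewrite eCE; exact: edges_of_sub.
have cC : closed_edges eC.
  by move=> h; rewrite eCE (edges_of_sum h hE hpath) last_rcons addbb.
have eCS e : e \in eC -> e \subset S.
  rewrite eCE => he; apply/subsetP => x /(edges_of_mem he).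
  by rewrite -rcons_cons mem_rcons [x \in S]inE in_cons => /orP[/eqP->|//]; rewrite mem_head.
have a31S e : e \in a31 -> e \in eC by move=> he; rewrite !inE he !orbT.
(* The cycle [c] is the sum of three cycles [es1], [es2], [es3] through [u], and [D] is
   joined to [ci] without meeting [esi]. *)
pose es1 := [:: [set c2; c3]; [set u; c2]; [set u; c3]].
pose es2 := [:: [set u; c3], [set u; c1] & a31].
pose es3 := [:: [set c1; c2]; [set u; c1]; [set u; c2]].
have s1 : {subset es1 <= E}.
  by move=> e; rewrite !inE => /or3P[]/eqP ->; rewrite ?huS.
have s2 : {subset es2 <= E}.
  by move=> e; rewrite !in_cons => /or3P[/eqP->|/eqP->|/a31S/heC //]; rewrite huS.
have s3 : {subset es3 <= E}.
  by move=> e; rewrite !inE => /or3P[]/eqP ->; rewrite ?huS.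
have k1 : closed_edges es1.
  move=> h; rewrite !big_cons big_nil !sum_edge ?un //.
  by case: (h u) (h c2) (h c3) => -[] [].
have k2 : closed_edges es2.
  move=> h; rewrite !big_cons (edges_of_sum h hE h31) last_rcons !sum_edge ?un //.
  by case: (h u) (h c1) (h c3) => -[] [].
have k3 : closed_edges es3.
  move=> h; rewrite !big_cons big_nil !sum_edge ?un //.
  by case: (h u) (h c1) (h c2) => -[] [].
have t1 e : e \in es1 -> e \in eC \/ exists2 x, x \in S & e = [set u; x].
  rewrite !inE => /or3P[]/eqP ->; first by left; rewrite eqxx ?orbT.
    by right; exists c2.
  by right; exists c3.
have t2 e : e \in es2 -> e \in eC \/ exists2 x, x \in S & e = [set u; x].
  rewrite !in_cons => /or3P[/eqP->|/eqP->|/a31S]; last by left.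
    by right; exists c3.
  by right; exists c1.
have t3 e : e \in es3 -> e \in eC \/ exists2 x, x \in S & e = [set u; x].
  rewrite !inE => /or3P[]/eqP ->; first by left; rewrite eqxx ?orbT.
    by right; exists c1.
  by right; exists c2.
have n1 : c1 \notin ends es1.
  apply/endsP => -[e]; rewrite !in_cons orbF => /or3P[]/eqP ->; rewrite !inE ?(negbTE n12) ?(negbTE n13) ?orbF //=.
    by rewrite eq_sym (negbTE (un _ c1S)).
  by rewrite eq_sym (negbTE (un _ c1S)).
have n3 : c3 \notin ends es3.
  apply/endsP => -[e]; rewrite !in_cons orbF => /or3P[]/eqP ->;
    rewrite !inE ![c3 == _]eq_sym ?(negbTE n23) ?(negbTE n13) ?orbF //=;
  by rewrite (negbTE (un _ c3S)).
have c2a31 : c2 \notin c3 :: rcons rest c1.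
  move: hu => /= /and3P[_ + _]; rewrite !inE mem_rcons !inE !negb_or => /andP[-> ->].
  by rewrite eq_sym n12.
have n2 : c2 \notin ends es2.
  apply/endsP => -[e]; rewrite !in_cons => /or3P[/eqP->|/eqP->|he].
  - by rewrite !inE [c2 == u]eq_sym (negbTE (un _ c2S)) (negbTE n23).
  - by rewrite !inE [c2 == u]eq_sym (negbTE (un _ c2S)) eq_sym (negbTE n12).
  by move/(edges_of_mem he); rewrite (negbTE c2a31).
have f1 : is_forest [set e in [set e in eC] | c1 \notin e].
  by apply: (cycle_minus_forest hu) => e; rewrite inE eCE.
have f2 : is_forest [set e in [set e in eC] | c2 \notin e].
  apply: (@cycle_minus_forest _ c2 c3 (rcons rest c1)).
    by rewrite -!rcons_cons -rot1_cons rot_uniq.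
  move=> e; rewrite inE => he.
  have -> : edges_of c2 (rcons (c3 :: rcons rest c1) c2) = [set c2; c3] :: rcons a31 [set c1; c2].
    by rewrite /= edges_of_rcons last_rcons.
  by rewrite in_cons mem_rcons in_cons; move: he; rewrite !in_cons => /or3P[] ->; rewrite ?orbT.
have f3 : is_forest [set e in [set e in eC] | c3 \notin e].
  pose s := rcons (rcons rest c1) c2.
  have es : exists y t, s = y :: t.
    by rewrite /s; case: (rest) => [|y t]; [exists c1, [:: c2] | exists y, (rcons (rcons t c1) c2)].
  have [y [t es']] := es.
  apply: (@cycle_minus_forest _ c3 y t).
    rewrite -es' /s -!rcons_cons.
    have -> : rcons (rcons (c3 :: rest) c1) c2 = rot 2 [:: c1, c2, c3 & rest].
      by rewrite /rot /= ?drop0 ?take0 -!cats1 -catA.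
    by rewrite rot_uniq.
  rewrite -es' /s => e; rewrite inE.
  have -> : edges_of c3 (rcons (rcons (rcons rest c1) c2) c3) =
      rcons (rcons a31 [set c1; c2]) [set c2; c3].
    by rewrite edges_of_rcons last_rcons [edges_of _ (rcons _ c2)]edges_of_rcons last_rcons.
  by rewrite mem_rcons in_cons mem_rcons !in_cons => /or3P[] ->; rewrite ?orbT.
have uendC : u \notin ends eC.
  by apply/endsP => -[e he hue]; have := subsetP (eCS _ he) _ hue; rewrite (negbTE uS).
have Dend es : (forall e, e \in es -> e \in eC \/ exists2 x, x \in S & e = [set u; x]) ->
    forall d, d \in D -> d \notin ends es.
  move=> ht d hd; apply/endsP => -[e he hde]; case: (ht e he) => [h|[x hx ex]].
    have := subsetP (eCS _ h) _ hde; rewrite inE => /cD; by rewrite hd.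
  move: hde; rewrite ex !inE => /orP[]/eqP e1; first by rewrite -e1 hd in uD.
  by move: hx; rewrite inE -e1 => /cD; rewrite hd.
have Dpar es ci : {subset es <= E} -> closed_edges es ->
    (forall e, e \in es -> e \in eC \/ exists2 x, x \in S & e = [set u; x]) ->
    ci \in S -> ci \notin ends es -> chain_par ws es (ctr L v) = chain_par ws es (ctr L ci).
  move=> hs hk ht hci hni.
  have [d hd hcd] := hcD ci ltac:(by move: hci; rewrite inE).
  rewrite (chain_edge M hws hs hk hcd hni (Dend es ht d hd)).
  have /connectP[p hp ->] := hD d hd.
  elim: p (v) hp => [|y p IH] x //= /andP[/and3P[hxy hx hy] hp].
  by rewrite -IH // (chain_edge M hws hs hk hxy) ?(Dend es ht).
have vendC : v \notin ends eC by apply: (Dend eC) => // e; left.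
have Cuv := chain_edge M hws heC cC huv uendC vendC.
have [p [q [hp hq hpq hin _]]] := out_edge M h12 (set21 c1 c2).
have h12n : [set c1; c2] \notin [set c2; c3] :: a31.
  rewrite in_cons negb_or; apply/andP; split.
    apply/eqP => e; have : c1 \in [set c2; c3] by rewrite -e set21.
    by rewrite !inE (negbTE n12) (negbTE n13).
  by apply: contra c2a31 => he; apply: (edges_of_mem he); rewrite set22.
have dC := chain_dif M hws heC cC (erefl eC) h12n hin.
have [z sz hz] : exists2 z, side_of p q z & chain_par ws eC z != chain_par ws eC (ctr L u).
  have [e|e] := eqVneq (chain_par ws eC (side1 p q)) (chain_par ws eC (ctr L u)); last first.
    by exists (side1 p q) => //; left.
  exists (side2 p q); first by right.
  by move: dC; rewrite /dif e; case: (chain_par _ _ _) (chain_par _ _ _) => -[].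
have oz : outside L S z.
  move=> x _; have hn : ~~ (ball_of L x p && ball_of L x q).
    by apply/negP => /andP[h1 h2]; exact: (inedge_not_ball M h12 hin h1 h2).
  by have /andP[out1 out2] := out_side hpq hn; case: sz => ->.
have r1 := K5_side M hws heC cC eCS uS huS s1 k1 t1 c1S n1 f1 oz hz.
have r2 := K5_side M hws heC cC eCS uS huS s2 k2 t2 c2S n2 f2 oz hz.
have r3 := K5_side M hws heC cC eCS uS huS s3 k3 t3 c3S n3 f3 oz hz.
(* Each of the three spokes occurs in two of the lists and cancels. *)
have sumE f : chain_par ws eC f = chain_par ws es1 f (+) chain_par ws es2 f (+) chain_par ws es3 f.
  rewrite /chain_par /eC /es1 /es2 /es3 !big_cons !big_nil.
  set A := \big[_/_]_(e <- a31) _.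
  move: (Par (ws [set c1; c2]) f) (Par (ws [set c2; c3]) f) (Par (ws [set u; c1]) f)
        (Par (ws [set u; c2]) f) (Par (ws [set u; c3]) f) A.
  by case=> [] [] [] [] [] [].
move: hz; rewrite Cuv !sumE r1 r2 r3.
by rewrite -!(Dpar es1 c1, Dpar es2 c2, Dpar es3 c3) // eqxx.
Qed.

(** The combinatorial form of edge-maximality, in contrapositive: a separating vertex set contains a
    cycle. For empty [F] it says that the graph is connected. *)
Definition cyclic_separators (V : finType) (E : {set {set V}}) : Prop :=
  forall F : {set V}, induces_forest E F -> forall a b, a \notin F -> b \notin F ->
    connect (adj (induced_edges E (~: F))) a b.

Lemma cyclic_separators_maximal (V : finType) (E : {set {set V}}) u v L :
  simple_graph E -> cyclic_separators E -> u != v -> [set u; v] \notin E ->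
  ~ is_model ([set u; v] |: E) L.
Proof.
move=> hE hsep huv hnE M.
pose N := [set x | adj E u x].
pose D := [set d | connect (adj (induced_edges E (~: N))) v d].
pose S := [set s in N | [exists d in D, adj E s d]].
have vN : v \notin N by rewrite inE.
have uN : u \notin N by rewrite inE; apply/negP => /(adj_neq hE); rewrite eqxx.
have vD : v \in D by rewrite inE connect0.
have adjN x y : adj (induced_edges E (~: N)) x y = [&& adj E x y, x \notin N & y \notin N].
  by rewrite /adj inE subUset !sub1set !in_setC.
have DN d : d \in D -> d \notin N.
  rewrite inE => /connectP[p hp ->]; elim: p (v) vN hp => [|y p IH] x //= hx /andP[hxy hp].
  by apply: IH => //; move: hxy; rewrite adjN => /and3P[].
(* Once its neighbours are removed, [u] is isolated. *)
have uD : u \notin D.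
  apply/negP; rewrite inE => /connectP[p]; case/lastP: p => [|p y].
    by move=> _ e; rewrite e eqxx in huv.
  rewrite rcons_path last_rcons => /andP[_ hy] e; move: hy; rewrite -e adjN => /and3P[h1 h2 _].
  by move: h2; rewrite inE adj_sym h1.
(* Otherwise [S] would not separate [u] from [v]. But a path from [v] that avoids [S] never leaves
   [D]: a step from [D] into [N] lands in [S]. *)
have [c hc] : exists c, is_cycle (induced_edges E S) c.
  apply: contrapT => hno.
  have hF : induces_forest E S by move=> c hc; apply: hno; exists c.
  have uS : u \notin S by rewrite inE (negbTE uN).
  have vS : v \notin S by rewrite inE (negbTE vN).
  have /connectP[p hp e] := hsep S hF v u vS uS.
  suff : u \in D by rewrite (negbTE uD).
  rewrite e; elim: p (v) vD hp {e} => [|y p IH] x //= hx /andP[hxy hp].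
  apply: IH => //; move: hxy; rewrite /adj inE subUset !sub1set !in_setC => /and3P[hxy _ yS].
  have yN : y \notin N.
    apply: contra yS => yN; rewrite inE yN; apply/existsP; exists x; rewrite hx /=.
    by rewrite adj_sym.
  move: (hx); rewrite !inE => h; apply: connect_trans h (connect1 _).
  by rewrite adjN DN // yN /adj hxy.
have hadj x y : adj E x y -> adj ([set u; v] |: E) x y by rewrite /adj !inE => ->; rewrite orbT.
have cS x : x \in c -> x \in S.
  case: hc => _ _; move=> hcyc hx.
  have := next_cycle hcyc hx; rewrite /adj inE subUset sub1set => /andP[_ /andP[]//].
have hc' : is_cycle ([set u; v] |: E) c.
  case: hc => h1 h2 h3; split=> //; case: c h3 {h1 h2 cS} => // x s.
  by apply: sub_path => a b; rewrite {1}/adj inE => /andP[/hadj].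
apply: (@no_K5 _ _ _ u v D c M hc') => //.
- by apply/negP => /cS; rewrite inE (negbTE uN).
- by move=> x /cS; rewrite inE => /andP[]; rewrite inE => /hadj.
- by rewrite /adj !inE eqxx.
- by move=> x /cS; rewrite inE => /andP[h _]; apply/negP => /DN; rewrite h.
- move=> d; rewrite inE => /connectP[p hp ->].
  have : all (mem D) (v :: p).
    rewrite /= vD /=; elim: p (v) vD hp => [|y p IH] x //= hx /andP[hxy hp].
    have hy : y \in D by move: (hx); rewrite !inE => h; exact: connect_trans h (connect1 hxy).
    by rewrite hy /= (IH y).
  move=> hall; apply/connectP; exists p => //.
  have gen x : path (adj (induced_edges E (~: N))) x p -> all (mem D) (x :: p) ->
      path [rel x y | [&& adj ([set u; v] |: E) x y, x \in D & y \in D]] x p; last exact: gen.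
  elim: p x {hp hall} => [|y p IH] x //= /andP[hxy hp] /and3P[hx hy hall].
  rewrite hx hy /= andbT; move: hxy; rewrite adjN => /and3P[/hadj -> _ _] /=.
  by apply: IH => //=; rewrite hy.
move=> x /cS; rewrite inE => /andP[_ /existsP[d /andP[hd hxd]]].
by exists d => //; exact: hadj.
Qed.

(** * From layouts to drawings *)

Lemma continuous_pair (R : realType) (f g : R -> R) :
  continuous f -> continuous g -> continuous (fun t => (f t, g t)).
Proof.
move=> cf cg t.
by apply: (@cvg_pair _ _ _ (nbhs t) (nbhs (f t)) (nbhs (g t))); [exact: cf | exact: cg].
Qed.

Lemma continuous_affine (R : realType) (a b : R) : continuous (fun t : R => a + t * b).
Proof.
move=> t; apply: cvgD; first exact: cvg_cst.
by apply: cvgM; [exact: cvg_id | exact: cvg_cst].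
Qed.

Section Polyline.
Variable R : realType.
Implicit Types (p q z : R * R).

Definition seg p q z : Prop :=
  exists t, [/\ 0 <= t, t <= 1 & z = (p.1 + t * (q.1 - p.1), p.2 + t * (q.2 - p.2))].

Lemma seg_sym p q z : seg p q z -> seg q p z.
Proof.
case=> t [h0 h1 ->]; exists (1 - t); split; [lra | lra |].
by congr (_, _); ring.
Qed.

Lemma arc_segment p q : p <> q -> exists g : R -> R * R,
  [/\ continuous g, is_arc g p q & forall z, arc_trace g z -> seg p q z].
Proof.
move=> hpq; pose g (t : R) := (p.1 + t * (q.1 - p.1), p.2 + t * (q.2 - p.2)).
have cg : continuous g.
  by apply: continuous_pair; exact: continuous_affine.
exists g; split=> //.
  split; first exact: continuous_subspaceT.
  - move=> s t _ _ [e1 e2]; apply: contrapT => hst; apply: hpq.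
    have hd : s - t != 0 by rewrite subr_eq0; apply/eqP.
    have h1 : (s - t) * (q.1 - p.1) = 0 by lra.
    have h2 : (s - t) * (q.2 - p.2) = 0 by lra.
    move/eqP: h1; move/eqP: h2; rewrite !mulf_eq0 (negbTE hd) /= !subr_eq0 => /eqP h2 /eqP h1.
    by rewrite [p]surjective_pairing [q]surjective_pairing h1 h2.
  - by rewrite /g !mul0r !addr0 -surjective_pairing.
  by rewrite /g !mul1r !subrKC -surjective_pairing.
move=> z [t]; rewrite /= in_itv /= => /andP[h0 h1] <-; by exists t.
Qed.

Lemma arc_concat (g1 g2 : R -> R * R) p q s : continuous g1 -> continuous g2 ->
  is_arc g1 p q -> is_arc g2 q s -> (forall z, arc_trace g1 z -> arc_trace g2 z -> z = q) ->
  exists g, [/\ continuous g, is_arc g p s &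
    forall z, arc_trace g z -> arc_trace g1 z \/ arc_trace g2 z].
Proof.
move=> c1 c2 [_ i1 g10 g11] [_ i2 g20 g21] hcap.
(* With these clamped parameters one of the two curves rests at [q] on each half of the interval, so
   their sum minus [q] is the concatenation and its continuity needs no gluing. *)
pose m (t : R) : R := Num.min (2 * t) 1; pose M (t : R) : R := Num.max (2 * t - 1) 0.
pose g (t : R) := g1 (m t) + (g2 (M t) - q).
have cm : continuous m.
  apply: min_fun_continuous => [t|]; last exact: cst_continuous.
  by apply: cvgM; [exact: cvg_cst | exact: cvg_id].
have cM : continuous M.
  apply: max_fun_continuous => [t|]; last exact: cst_continuous.
  apply: cvgB; last exact: cvg_cst.
  by apply: cvgM; [exact: cvg_cst | exact: cvg_id].
have gl t : t <= 2^-1 -> g t = g1 (2 * t).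
  move=> ht; rewrite /g /m /M; have -> : Num.max (2 * t - 1) 0 = 0.
    by apply/max_idPr; lra.
  by have -> : Num.min (2 * t) 1 = 2 * t; [apply/min_idPl; lra | rewrite g20 subrr addr0].
have gr t : 2^-1 <= t -> g t = g2 (2 * t - 1).
  move=> ht; rewrite /g /m /M; have -> : Num.max (2 * t - 1) 0 = 2 * t - 1.
    by apply/max_idPl; lra.
  have -> : Num.min (2 * t) 1 = 1 by apply/min_idPr; lra.
  by rewrite g11 addrC subrK.
have cg : continuous g.
  move=> t; apply: cvgD; first exact: (continuous_comp (cm t) (c1 _)).
  apply: cvgB; last exact: cvg_cst.
  exact: (continuous_comp (cM t) (c2 _)).
have T1 t : 0 <= t -> t <= 1 -> arc_trace g1 (g1 t).
  by move=> h0 h1; exists t => //; rewrite /= in_itv /= h0.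
have T2 t : 0 <= t -> t <= 1 -> arc_trace g2 (g2 t).
  by move=> h0 h1; exists t => //; rewrite /= in_itv /= h0.
have I t : 0 <= t -> t <= 1 -> t \in `[0, 1]%R by move=> h0 h1; rewrite in_itv /= h0.
have mixed a b : 0 <= a -> a <= 2^-1 -> 2^-1 <= b -> b <= 1 -> g a = g b -> a = b.
  move=> a0 a1 b0 b1; rewrite gl // gr // => e.
  have t1 : arc_trace g1 (g1 (2 * a)) by apply: T1; lra.
  have t2 : arc_trace g2 (g2 (2 * b - 1)) by apply: T2; lra.
  have h1 : g1 (2 * a) = q by apply: hcap => //; rewrite e.
  have h2 : g2 (2 * b - 1) = q by rewrite -e.
  have e1 : 2 * a = 1 by apply: i1; rewrite ?h1 ?g11 //; apply: I; lra.
  have e2 : 2 * b - 1 = 0 by apply: i2; rewrite ?h2 ?g20 //; apply: I; lra.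
  lra.
exists g; split=> //.
  split; first exact: continuous_subspaceT.
  - move=> a b; rewrite !in_itv /= => /andP[a0 a1] /andP[b0 b1].
    case: (lerP a 2^-1) => ha; case: (lerP b 2^-1) => hb.
    + by rewrite !gl // => e; have : 2 * a = 2 * b; [apply: i1 e; apply: I; lra | lra].
    + by apply: mixed => //; exact: ltW.
    + by move=> e; symmetry; apply: mixed; rewrite ?e //; exact: ltW.
    rewrite !gr ?ltW // => e.
    by have : 2 * a - 1 = 2 * b - 1; [apply: i2 e; apply: I; lra | lra].
  - by rewrite gl ?mulr0 //; lra.
  by rewrite gr; [rewrite (_ : 2 * 1 - 1 = 1) //; lra | lra].
move=> z [t]; rewrite /= in_itv /= => /andP[h0 h1] <-; case: (lerP t 2^-1) => ht.
  by left; rewrite gl //; apply: T1; lra.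
by right; rewrite gr ?ltW //; apply: T2; lra.
Qed.

Fixpoint poly_trace q (s : seq (R * R)) z : Prop :=
  if s is q' :: s' then seg q q' z \/ poly_trace q' s' z else False.

Fixpoint simple_poly q (s : seq (R * R)) : Prop :=
  if s is q' :: s' then [/\ q <> q', forall z, seg q q' z -> poly_trace q' s' z -> z = q' &
    simple_poly q' s'] else True.

Lemma poly_arc q s : s <> [::] -> simple_poly q s -> exists g,
  [/\ continuous g, is_arc g q (last q s) & forall z, arc_trace g z -> poly_trace q s z].
Proof.
elim: s q => // q' s IH q _ [hne hcap hs].
have [g1 [c1 a1 t1]] := arc_segment hne.
case: s IH hcap hs => [|q2 s] IH hcap hs.
  by exists g1; split=> // z /t1; left.
have [g2 [c2 a2 t2]] := IH q' ltac:(by []) hs.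
have hc z : arc_trace g1 z -> arc_trace g2 z -> z = q'.
  by move=> /t1 h1 /t2 h2; exact: hcap.
have [g [c a t]] := arc_concat c1 c2 a1 a2 hc; exists g; split=> // z /t[/t1|/t2]; first by left.
by right.
Qed.

Definition rp (p : pt) : R * R := (p.1%:~R, p.2%:~R).

Lemma rp_inj : injective rp.
Proof. by move=> [a b] [c d] [/intr_inj -> /intr_inj ->]. Qed.

Lemma unit_seg a b z : adjp a b -> seg (rp a) (rp b) z ->
  (exists m : int, [/\ a.1 = b.1, (a.2 = m /\ b.2 = m + 1) \/ (a.2 = m + 1 /\ b.2 = m),
     z.1 = a.1%:~R, m%:~R <= z.2 & z.2 <= (m + 1)%:~R]) \/
  (exists m : int, [/\ a.2 = b.2, (a.1 = m /\ b.1 = m + 1) \/ (a.1 = m + 1 /\ b.1 = m),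
     z.2 = a.2%:~R, m%:~R <= z.1 & z.1 <= (m + 1)%:~R]).
Proof.
move=> hab [t [h0 h1 ->]]; case: a b hab => [a1 a2] [b1 b2] /adjpP /=.
case=> -[-> ->].
- left; exists a2; split=> //=; [by left | ring | rewrite intrD; lra | rewrite intrD; lra].
- right; exists a1; split=> //=; [by left | ring | rewrite intrD; lra | rewrite intrD; lra].
- left; exists b2; split=> //=; [by right | ring | rewrite intrD; lra | rewrite intrD; lra].
right; exists b1; split=> //=; [by right | ring | rewrite intrD; lra | rewrite intrD; lra].
Qed.

(** On a unit edge one coordinate is a fixed integer and the other runs between consecutive
    integers, so distinct edges meet only in a lattice point that is an end of both. *)
Lemma unit_cross a b c d z : adjp a b -> adjp c d -> seg (rp a) (rp b) z -> seg (rp c) (rp d) z ->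
  ((c = a /\ d = b) \/ (c = b /\ d = a)) \/
  exists w : pt, [/\ w = a \/ w = b, w = c \/ w = d & z = rp w].
Proof.
move=> hab hcd /(unit_seg hab) h1 /(unit_seg hcd) h2.
case: a b c d z {hab hcd} h1 h2 => [a1 a2] [b1 b2] [c1 c2] [d1 d2] [z1 z2] /=.
case=> -[m [e1 e2 e3 l1 l2]] [] [n [f1 f2 f3 k1 k2]].
- move: f3; rewrite e3 => /intr_inj f3.
  have : m%:~R <= (n + 1)%:~R :> R by lra.
  have : n%:~R <= (m + 1)%:~R :> R by lra.
  rewrite !ler_int => g1 g2.
  have [emn|[emn|emn]] : m = n \/ (m = n + 1 \/ n = m + 1) by lia.
  + left; case: e2 => -[-> ->]; case: f2 => -[-> ->]; rewrite -e1 -f1 -f3 emn; auto.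
  + right; exists (a1, m); split.
    * by case: e2 => -[-> ->]; [left | right; rewrite e1].
    * by rewrite emn f3; case: f2 => -[-> ->]; [right; rewrite f1 | left].
    congr (_, _); rewrite ?e3 //=; rewrite -emn in k2; lra.
  right; exists (a1, n); split.
  + by rewrite emn; case: e2 => -[-> ->]; [right; rewrite e1 | left].
  + by rewrite f3; case: f2 => -[-> ->]; [left | right; rewrite f1].
  congr (_, _); rewrite ?e3 //=; rewrite -emn in l2; lra.
- right; exists (a1, c2).
  move: l1 l2 k1 k2; rewrite e3 f3 !ler_int => l1 l2 k1 k2; split=> //.
    have [->|->] : c2 = a2 \/ c2 = b2 by lia.
      by left.
    by right; rewrite e1.
  have [->|->] : a1 = c1 \/ a1 = d1 by lia.
    by left.
  by right; rewrite f1.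
- right; exists (c1, a2).
  move: l1 l2 k1 k2; rewrite e3 f3 !ler_int => l1 l2 k1 k2; split=> //.
    have [->|->] : c1 = a1 \/ c1 = b1 by lia.
      by left.
    by right; rewrite e1.
  have [->|->] : a2 = c2 \/ a2 = d2 by lia.
    by left.
  by right; rewrite f1.
move: f3; rewrite e3 => /intr_inj f3.
have : m%:~R <= (n + 1)%:~R :> R by lra.
have : n%:~R <= (m + 1)%:~R :> R by lra.
rewrite !ler_int => g1 g2.
have [emn|[emn|emn]] : m = n \/ (m = n + 1 \/ n = m + 1) by lia.
- left; case: e2 => -[-> ->]; case: f2 => -[-> ->]; rewrite -e1 -f1 -f3 emn; auto.
- right; exists (m, a2); split.
  + by case: e2 => -[-> ->]; [left | right; rewrite e1].
  + by rewrite emn f3; case: f2 => -[-> ->]; [right; rewrite f1 | left].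
  congr (_, _); rewrite ?e3 //=; rewrite -emn in k2; lra.
right; exists (n, a2); split.
- by rewrite emn; case: e2 => -[-> ->]; [right; rewrite e1 | left].
- by rewrite f3; case: f2 => -[-> ->]; [left | right; rewrite f1].
congr (_, _); rewrite ?e3 //=; rewrite -emn in l2; lra.
Qed.

Definition rball (o : pt) (r : int) z : Prop :=
  [/\ (o.1 - r)%:~R <= z.1, z.1 <= (o.1 + r)%:~R, (o.2 - r)%:~R <= z.2 & z.2 <= (o.2 + r)%:~R].

Lemma rball_rp o r (p : pt) : inb o r p <-> rball o r (rp p).
Proof. by rewrite /inb /rball /rp /= !ler_int; split=> [h|[h1 h2 h3 h4]]; [split|]; lia. Qed.

Lemma unit_ball a b o r z : adjp a b -> ~~ (inb o r a && inb o r b) -> seg (rp a) (rp b) z ->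
  rball o r z -> exists w : pt, [/\ w = a \/ w = b, inb o r w & z = rp w].
Proof.
move=> hab hn /(unit_seg hab) h1 [b1 b2 b3 b4].
case: a b o z {hab} hn h1 b1 b2 b3 b4 => [a1 a2] [c1 c2] [ox oy] [z1 z2] /= hn.
case=> -[m [e1 e2 e3 l1 l2]] b1 b2 b3 b4.
  move: b1 b2; rewrite e3 !ler_int => b1 b2.
  have g1 : m%:~R <= (oy + r)%:~R :> R by lra.
  have g2 : (oy - r)%:~R <= (m + 1)%:~R :> R by lra.
  rewrite !ler_int in g1 g2.
  have [em|em] : m = oy + r \/ m + 1 = oy - r by move: hn; rewrite /inb /=; lia.
    exists (a1, m); split; first by case: e2 => -[-> ->]; [left | right; rewrite e1].
      by rewrite /inb /=; lia.
    by congr (_, _); rewrite ?e3 //=; rewrite -em in b4; lra.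
  exists (a1, m + 1); split; first by case: e2 => -[-> ->]; [right; rewrite e1 | left].
    by rewrite /inb /=; lia.
  by congr (_, _); rewrite ?e3 //=; rewrite -em in b3; lra.
move: b3 b4; rewrite e3 !ler_int => b3 b4.
have g1 : m%:~R <= (ox + r)%:~R :> R by lra.
have g2 : (ox - r)%:~R <= (m + 1)%:~R :> R by lra.
rewrite !ler_int in g1 g2.
have [em|em] : m = ox + r \/ m + 1 = ox - r by move: hn; rewrite /inb /=; lia.
  exists (m, a2); split; first by case: e2 => -[-> ->]; [left | right; rewrite e1].
    by rewrite /inb /=; lia.
  by congr (_, _); rewrite ?e3 //=; rewrite -em in b2; lra.
exists (m + 1, a2); split; first by case: e2 => -[-> ->]; [right; rewrite e1 | left].
  by rewrite /inb /=; lia.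
by congr (_, _); rewrite ?e3 //=; rewrite -em in b1; lra.
Qed.

Lemma seg_rball o r (p : pt) z : inb o r p -> seg (rp o) (rp p) z -> rball o r z.
Proof.
move=> hp [t [h0 h1 ->]].
have [k1 k2 k3 k4] := (rball_rp o r p).1 hp.
rewrite /rp /= in k1 k2 k3 k4; rewrite /rball /=; rewrite !intrD !intrN in k1 k2 k3 k4 *.
have r0 : 0 <= r%:~R :> R by rewrite ler0z; move: hp; rewrite /inb; lia.
split; nra.
Qed.

(** The squares have integer corners; the witness is the lower left corner of their intersection. *)
Lemma rball_meet o r o' r' z : rball o r z -> rball o' r' z ->
  exists p : pt, inb o r p /\ inb o' r' p.
Proof.
move=> [a1 a2 a3 a4] [b1 b2 b3 b4].
have g1 : (o.1 - r)%:~R <= (o'.1 + r')%:~R :> R by lra.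
have g2 : (o'.1 - r')%:~R <= (o.1 + r)%:~R :> R by lra.
have g3 : (o.2 - r)%:~R <= (o'.2 + r')%:~R :> R by lra.
have g4 : (o'.2 - r')%:~R <= (o.2 + r)%:~R :> R by lra.
have g5 : (o.1 - r)%:~R <= (o.1 + r)%:~R :> R by lra.
have g6 : (o'.1 - r')%:~R <= (o'.1 + r')%:~R :> R by lra.
rewrite !ler_int in g1 g2 g3 g4 g5 g6.
exists (Order.max (o.1 - r) (o'.1 - r'), Order.max (o.2 - r) (o'.2 - r')).
by rewrite /inb /=; lia.
Qed.

Definition onb (o : pt) (r : int) (p : pt) : bool :=
  Order.max `|p.1 - o.1| `|p.2 - o.2| == r.

Lemma onb_out o r (p q : pt) : inb o r p -> ~~ inb o r q -> adjp p q -> onb o r p.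
Proof. by rewrite /inb /onb /adjp; lia. Qed.

Lemma onb_real o r (p : pt) : onb o r p ->
  Num.max `|(p.1 - o.1)%:~R| `|(p.2 - o.2)%:~R| = r%:~R :> R.
Proof.
rewrite /onb => /eqP <-; rewrite -!intr_norm.
by case: (lerP `|p.1 - o.1| `|p.2 - o.2|) => h;
  [apply/max_idPr | apply/max_idPl]; rewrite ler_int // ltW.
Qed.

(** The sup distance from [o] to a point of such a segment is its parameter times [r]. So the
    parameters agree at a common point and, away from the centre, so do the ends. *)
Lemma radial_cross o r (p p' : pt) z : 1 <= r -> onb o r p -> onb o r p' ->
  seg (rp o) (rp p) z -> seg (rp o) (rp p') z -> z = rp o \/ p = p'.
Proof.
move=> hr hp hp' [t [t0 t1 ->]] [s [s0 s1 [e1 e2]]].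
have r0 : 0 < r%:~R :> R by rewrite ltr0z; lia.
have n1 := onb_real hp; have n2 := onb_real hp'.
rewrite /rp /= in e1 e2.
have {}e1 : t * (p.1 - o.1)%:~R = s * (p'.1 - o.1)%:~R :> R by rewrite !intrB; lra.
have {}e2 : t * (p.2 - o.2)%:~R = s * (p'.2 - o.2)%:~R :> R by rewrite !intrB; lra.
have ets : t = s.
  have : t * r%:~R = s * r%:~R.
    have sc (u a b : R) : 0 <= u -> u * Num.max `|a| `|b| = Num.max `|u * a| `|u * b|.
      by move=> hu; rewrite maxr_pMr // !normrM (ger0_norm hu).
    by rewrite -{1}n1 -n2 !sc // e1 e2.
  by move/mulIf; apply; rewrite gt_eqF.
have [t00|tn0] := eqVneq t 0; first by left; rewrite t00 /rp /= !mul0r !addr0.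
right; rewrite -ets in e1 e2.
move/(mulfI tn0)/intr_inj: e1 => e1; move/(mulfI tn0)/intr_inj: e2 => e2.
by case: p p' e1 e2 {hp hp' n1 n2} => [a b] [c d] /= /addIr -> /addIr ->.
Qed.

Lemma seg_end (o p : pt) : seg (rp o) (rp p) (rp p).
Proof. by exists 1; split; rewrite ?ler01 // !mul1r !subrKC -surjective_pairing. Qed.

End Polyline.

Section Drawing.
Variables (R : realType) (V : finType) (E : {set {set V}}) (L : layout V).
Hypothesis M : is_model E L.
Local Notation rp := (@rp R).

Lemma poly_trace_steps p t (O z : R * R) : poly_trace (rp p) (rcons (map rp t) O) z ->
  (exists a b, (a, b) \in steps (p :: t) /\ seg (rp a) (rp b) z) \/ seg (rp (last p t)) O z.
Proof.
elim: t p => [|q t IH] p /=; first by case=> // h; right.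
case=> [h|/IH[[a [b [hab h]]]|h]]; last by right.
  by left; exists p, q; rewrite steps_cons mem_head.
by left; exists a, b; rewrite steps_cons inE hab orbT.
Qed.

Lemma unit_seg_rp a b w : adjp a b -> seg (rp a) (rp b) (rp w) -> w = a \/ w = b.
Proof.
move=> hab; have hw : adjp w (w.1, w.2 + 1) by rewrite /adjp /=; lia.
have hs : seg (rp w) (rp (w.1, w.2 + 1)) (rp w) by apply: seg_sym; exact: seg_end.
move=> h; case: (unit_cross hab hw h hs) => [[[-> _]|[-> _]]|[w' [h1 _ /rp_inj ->]]]; auto.
Qed.

Lemma lattice_poly p t (O : R * R) : path adjp p t -> uniq (p :: t) -> rp (last p t) <> O ->
  (forall a b z, (a, b) \in steps (p :: t) -> seg (rp a) (rp b) z -> seg (rp (last p t)) O z ->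
    z = rp (last p t)) ->
  simple_poly (rp p) (rcons (map rp t) O).
Proof.
elim: t p => [|q t IH] p; first by move=> _ _ h _ /=; split.
move=> /= /andP[hpq hp] /andP[hpn hu] hO hz; split.
- by move/rp_inj => e; rewrite e mem_head in hpn.
- move=> z hs /poly_trace_steps[[a [b [hab hs']]]|hs'].
    have hab' := steps_adjp (s := q :: t) hp hab.
    have /andP[ha hb] := mem_steps hab.
    case: (unit_cross hpq hab' hs hs') => [[[e _]|[_ e]]|[w [[->|->] hw ->]]] //.
    + by rewrite e in ha; rewrite ha in hpn.
    + by rewrite e in hb; rewrite hb in hpn.
    by case: hw => e; rewrite e ?ha ?hb in hpn.
  have e := hz p q z ltac:(by rewrite mem_head) hs hs'; rewrite e in hs *.
  case: (unit_seg_rp hpq hs) => e'; last by rewrite e'.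
  by rewrite -e' mem_last in hpn.
apply: IH => // a b z hab; apply: hz.
by rewrite in_cons; apply/orP; right.
Qed.

(** All that is remembered of an arc: it stays on radial segments to border points of the path and
    on grid edges of the path. *)
Definition edge_trace (e : {set V}) (z : R * R) : Prop :=
  (exists v p, [/\ v \in e, p \in pth L e, onb (ctr L v) (rad L v) p, ball_of L v p &
     seg (rp (ctr L v)) (rp p) z]) \/
  (exists a b, inedge (pth L e) a b /\ seg (rp a) (rp b) z).

Lemma opath_onb x y s : x != y -> opath L x y s -> exists p t, s = p :: t /\ onb (ctr L x) (rad L x) p.
Proof.
move=> hxy ho; have [p [q [t [-> hp hq hpq]]]] := opath_cons M hxy ho.
by exists p, (q :: t); split=> //; exact: onb_out hp hq hpq.
Qed.

Lemma onb_center v p : onb (ctr L v) (rad L v) p -> rp (ctr L v) <> rp p.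
Proof.
move=> h /rp_inj e; move: h; rewrite /onb -e; have := rad_ge1 M v; lia.
Qed.

Lemma edge_arc e : e \in E -> exists g : R -> R * R,
  (exists x y, e = [set x; y] /\ is_arc g (rp (ctr L x)) (rp (ctr L y))) /\
  forall z, arc_trace g z -> edge_trace e z.
Proof.
move=> he; have [x [y [exy hxy ho]]] := pth_ok M he.
have [p' [t' [e1 bx]]] := opath_onb hxy ho.
have hyx : y != x by rewrite eq_sym.
have [l' [t'' [e2 by_]]] := opath_onb hyx (opath_rev ho).
have [p [t [es hp hu [hx hy] hz]]] := ho.
have ep : p' = p by move: e1; rewrite es => -[].
have el : l' = last p t.
  by move: e2; rewrite es lastI rev_rcons => -[].
rewrite {}ep in bx; rewrite {}el in by_ => {e1 e2 p' t' l' t''}.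
have ux a b z : (a, b) \in steps (p :: t) -> seg (rp a) (rp b) z -> rball (ctr L x) (rad L x) z ->
    z = rp p.
  move=> hab hs hb; have hin : inedge (pth L e) a b.
    by rewrite es; apply/hasP; exists (a, b) => //; rewrite /same_edge eqxx.
  have hn : ~~ (ball_of L x a && ball_of L x b).
    by apply/negP => /andP[h1 h2]; exact: (inedge_not_ball M he hin h1 h2).
  have /andP[ma mb] := mem_steps hab.
  have [w [hw hbw ->]] := unit_ball (inedge_adjp (pth_sorted M he) hin) hn hs hb.
  have mw : w \in p :: t by case: hw => ->.
  by case: (hz w x mw hbw) => [[_ ->]|[e1 _]] //; rewrite e1 eqxx in hxy.
have uy a b z : (a, b) \in steps (p :: t) -> seg (rp a) (rp b) z -> rball (ctr L y) (rad L y) z ->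
    z = rp (last p t).
  move=> hab hs hb; have hin : inedge (pth L e) a b.
    by rewrite es; apply/hasP; exists (a, b) => //; rewrite /same_edge eqxx.
  have hn : ~~ (ball_of L y a && ball_of L y b).
    by apply/negP => /andP[h1 h2]; exact: (inedge_not_ball M he hin h1 h2).
  have /andP[ma mb] := mem_steps hab.
  have [w [hw hbw ->]] := unit_ball (inedge_adjp (pth_sorted M he) hin) hn hs hb.
  have mw : w \in p :: t by case: hw => ->.
  by case: (hz w y mw hbw) => [[e1 _]|[_ ->]] //; rewrite e1 eqxx in hxy.
pose s := rp p :: rcons (map rp t) (rp (ctr L y)).
have hs : simple_poly (rp (ctr L x)) s.
  split; first exact: onb_center.
    move=> z h1 /poly_trace_steps[[a [b [hab h2]]]|h2].
      exact: ux hab h2 (seg_rball hx h1).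
    have [w [w1 w2]] := rball_meet (seg_rball hx h1) (seg_rball hy (seg_sym h2)).
    by rewrite (ball_disj M w1 w2) eqxx in hxy.
  apply: lattice_poly => //.
    by move/esym; exact: onb_center.
  by move=> a b z hab h1 h2; apply: uy hab h1 _; exact: (seg_rball hy (seg_sym h2)).
have sn : s <> [::] by [].
have [g [_ ha ht]] := poly_arc sn hs; exists g; split.
  by exists x, y; split=> //; move: ha; rewrite /s /= last_rcons.
have xe : x \in e by rewrite exy set21.
have ye : y \in e by rewrite exy set22.
move=> z /ht; case=> [h|/poly_trace_steps[[a [b [hab h2]]]|h2]].
- by left; exists x, p; rewrite es mem_head; split.
- right; exists a, b; split=> //.
  by rewrite es; apply/hasP; exists (a, b) => //; rewrite /same_edge eqxx.
left; exists y, (last p t); rewrite es mem_last; split=> //.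
exact: seg_sym.
Qed.

Lemma model_planar : planar R E.
Proof.
have /choice[arc harc] : forall e, exists g : R -> R * R, e \in E ->
    (exists x y, e = [set x; y] /\ is_arc g (rp (ctr L x)) (rp (ctr L y))) /\
    forall z, arc_trace g z -> edge_trace e z.
  move=> e; have [he|he] := boolP (e \in E); last by exists (fun=> 0).
  by have [g hg] := edge_arc he; exists g.
have cball v : ball_of L v (ctr L v) by exact: inb_center (rad_ge1 M v).
exists (fun v => rp (ctr L v)), arc; split.
- by move=> u v /rp_inj e; apply: (ball_disj M (cball u)); rewrite e.
- by move=> e he; have [h _] := harc e he.
- move=> e v he /(harc e he).2[[x [p [xe hp _ hb hs]]]|[a [b [hin hs]]]].
    have hv := (rball_rp R _ _ _).1 (cball v).
    have [w [w1 w2]] := rball_meet (seg_rball hb hs) hv.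
    by rewrite -(ball_disj M w1 w2).
  have hn : ~~ (ball_of L v a && ball_of L v b).
    by apply/negP => /andP[h1 h2]; exact: (inedge_not_ball M he hin h1 h2).
  have [w [hw hbw _]] := unit_ball (inedge_adjp (pth_sorted M he) hin) hn hs
    ((rball_rp R _ _ _).1 (cball v)).
  have /andP[ma mb] := inedge_mem hin.
  by apply: (pth_ball M he _ hbw); case: hw => ->.
(* A radial segment can meet a grid edge of [f] only at the point where the path of [f] arrives at
   the ball. That point is on the border, hence is the end [p] of the segment, and disjointness of
   paths gives [e = f]. *)
have RU e f z v p a b : e \in E -> f \in E -> v \in e -> p \in pth L e ->
    onb (ctr L v) (rad L v) p -> ball_of L v p -> seg (rp (ctr L v)) (rp p) z ->
    inedge (pth L f) a b -> seg (rp a) (rp b) z -> e = f.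
  move=> he hf ve hp hon hb hs hin hs'.
  have hn : ~~ (ball_of L v a && ball_of L v b).
    by apply/negP => /andP[h1 h2]; exact: (inedge_not_ball M hf hin h1 h2).
  have /andP[ma mb] := inedge_mem hin.
  have [w [hw hbw ez]] := unit_ball (inedge_adjp (pth_sorted M hf) hin) hn hs' (seg_rball hb hs).
  have mw : w \in pth L f by case: hw => ->.
  have vf := pth_ball M hf mw hbw.
  have [y [s [_ hxy ho hs0]]] := orient M hf vf.
  have [p1 [t1 [es _ _ _ hz]]] := ho.
  have ew : w = p1.
    have : w \in p1 :: t1 by rewrite -es; case: hs0 => ->; rewrite ?mem_rev.
    by move/hz => /(_ v hbw)[[_ ->]|[e1 _]] //; rewrite e1 eqxx in hxy.
  have [p2 [t2 [e2 hon2]]] := opath_onb hxy ho.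
  have e12 : p2 = p1 by move: e2; rewrite es => -[].
  rewrite e12 -ew in hon2; rewrite ez in hs.
  case: (radial_cross (rad_ge1 M v) hon hon2 hs (seg_end _ _ _)) => [e3|e3].
    by case: (onb_center hon2); rewrite e3.
  by rewrite e3 in hp; exact: (pth_disj M he hf hp mw).
move=> e f z he hf hne /(harc e he).2 h1 /(harc f hf).2 h2.
case: h1 => [[x [p [xe hp hon hb hs]]]|[a [b [hin hs]]]];
case: h2 => [[x' [p' [xe' hp' hon' hb' hs']]]|[a' [b' [hin' hs']]]].
- have [w [w1 w2]] := rball_meet (seg_rball hb hs) (seg_rball hb' hs').
  have exx := ball_disj M w1 w2; rewrite -exx in xe' hon' hs'.
  case: (radial_cross (rad_ge1 M x) hon hon' hs hs') => [->|epp].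
    by exists x => //; rewrite inE xe xe'.
  by rewrite -epp in hp'; case: hne; exact: (pth_disj M he hf hp hp').
- by case: hne; exact: (RU e f z x p a' b').
- by case: hne; symmetry; exact: (RU f e z x' p' a b).
have hab := inedge_adjp (pth_sorted M he) hin.
have hab' := inedge_adjp (pth_sorted M hf) hin'.
have /andP[ma mb] := inedge_mem hin; have /andP[ma' mb'] := inedge_mem hin'.
case: hne; case: (unit_cross hab hab' hs hs') => [[[e1 _]|[e1 _]]|[w [w1 w2 _]]].
- by rewrite e1 in ma'; exact: (pth_disj M he hf ma ma').
- by rewrite e1 in ma'; exact: (pth_disj M he hf mb ma').
have mw : w \in pth L e by case: w1 => ->.
have mw' : w \in pth L f by case: w2 => ->.
exact: (pth_disj M he hf mw mw').
Qed.

End Drawing.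

(** * From drawings to layouts *)

Section Distance.
Variable R : realType.
Implicit Types (z w c : R * R).

Definition dst z w : R := Num.max `|z.1 - w.1| `|z.2 - w.2|.

Lemma dst_le z w e : (dst z w <= e) = (`|z.1 - w.1| <= e) && (`|z.2 - w.2| <= e).
Proof. by rewrite /dst ge_max. Qed.

Lemma dst_ge0 z w : 0 <= dst z w.
Proof. by rewrite /dst le_max normr_ge0. Qed.

Lemma dstC z w : dst z w = dst w z.
Proof. by rewrite /dst distrC [`|z.2 - _|]distrC. Qed.

Lemma dst_eq0 z w : dst z w <= 0 -> z = w.
Proof.
rewrite dst_le !normr_le0 !subr_eq0 => /andP[/eqP h1 /eqP h2].
by rewrite [z]surjective_pairing [w]surjective_pairing h1 h2.
Qed.

Lemma dstxx z : dst z z = 0.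
Proof. by rewrite /dst !subrr normr0 maxxx. Qed.

Lemma dst_triangle w z c : dst z c <= dst z w + dst w c.
Proof.
rewrite dst_le; apply/andP; split.
  apply: le_trans (ler_distD w.1 _ _) _.
  by apply: lerD; rewrite /dst le_max lexx.
apply: le_trans (ler_distD w.2 _ _) _.
by apply: lerD; rewrite /dst le_max lexx orbT.
Qed.

Definition emb (h : R) (p : pt) : R * R := (h * p.1%:~R, h * p.2%:~R).
Definition di (p q : pt) : int := Order.max `|p.1 - q.1| `|p.2 - q.2|.
Definition fl (h : R) z : pt := (Num.floor (z.1 / h), Num.floor (z.2 / h)).

Lemma dst_emb h p q : 0 < h -> dst (emb h p) (emb h q) = h * (di p q)%:~R.
Proof.
move=> h0; have e (a b : int) : `|h * a%:~R - h * b%:~R| = h * (`|a - b|)%:~R.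
  by rewrite -mulrBr normrM gtr0_norm // -intrB intr_norm.
rewrite /dst /emb /= !e -maxr_pMr ?ltW //; congr (_ * _); rewrite /di.
by case: (lerP `|p.1 - q.1| `|p.2 - q.2|) => hle;
  [apply/max_idPr | apply/max_idPl]; rewrite ler_int // ltW.
Qed.

Lemma dst_fl h z : 0 < h -> dst (emb h (fl h z)) z <= h.
Proof.
move=> h0; have e (x : R) : `|h * (Num.floor (x / h))%:~R - x| <= h.
  have /andP[l1 l2] := floor_itv (x / h).
  have ex : x = h * (x / h) by rewrite mulrC mulfVK ?gt_eqF.
  rewrite {2}ex -mulrBr normrM gtr0_norm //; rewrite -[leRHS]mulr1 ler_pM2l //.
  rewrite intrD in l2; rewrite ler_norml; apply/andP; split; lra.
by rewrite dst_le /emb /fl /= !e.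
Qed.

Lemma dst_box h p q x c e : 0 < h -> dst (emb h p) c <= e -> dst (emb h q) c <= e ->
  in_box p q x -> dst (emb h x) c <= e.
Proof.
move=> h0; rewrite !dst_le /emb /= => /andP[a1 a2] /andP[b1 b2] /andP[/andP[c1 c2] /andP[d1 d2]].
have one (a b m : int) (y : R) : `|h * a%:~R - y| <= e -> `|h * b%:~R - y| <= e ->
    Order.min a b <= m -> m <= Order.max a b -> `|h * m%:~R - y| <= e.
  rewrite !ler_norml => /andP[g1 g2] /andP[g3 g4] m1 m2.
  have [[k1 k2]|[k1 k2]] : (a <= m /\ m <= b) \/ (b <= m /\ m <= a).
    by move: m1 m2; clear; lia.
    have r1 : h * a%:~R <= h * m%:~R by rewrite ler_pM2l // ler_int.
    have r2 : h * m%:~R <= h * b%:~R by rewrite ler_pM2l // ler_int.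
    by apply/andP; split; lra.
  have r1 : h * b%:~R <= h * m%:~R by rewrite ler_pM2l // ler_int.
  have r2 : h * m%:~R <= h * a%:~R by rewrite ler_pM2l // ler_int.
  by apply/andP; split; lra.
by apply/andP; split; [apply: (one p.1 q.1) | apply: (one p.2 q.2)].
Qed.

Lemma inb_di o r p : inb o r p = (di p o <= r).
Proof. by rewrite /inb /di; apply/idP/idP; lia. Qed.

Lemma pos_uniform (I : finType) (P : I -> R -> Prop) :
  (forall i, exists2 d, 0 < d & P i d) ->
  (forall i d d', d' <= d -> P i d -> P i d') ->
  exists2 d, 0 < d & forall i, P i d.
Proof.
move=> hex hmon; have /choice[f hf] : forall i, exists d, 0 < d /\ P i d.
  by move=> i; have [d h1 h2] := hex i; exists d.
(* The initial value 1 keeps the bound positive for an empty family and otherwise can only shrink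
   it. *)
exists (\big[Order.min/1]_i f i).
  by apply/bigmin_gtP; split=> // i _; have [] := hf i.
move=> i; apply: hmon (hf i).2; exact: bigmin_le_cond.
Qed.

(* Freezing a curve outside the unit interval makes it continuous on the whole line. *)
Definition clamp (t : R) : R := Num.max 0 (Num.min 1 t).

Lemma clamp_itv t : clamp t \in `[0, 1]%R.
Proof. by rewrite in_itv /= /clamp le_max lexx ge_max ler01 ge_min lexx. Qed.

Lemma clamp_id t : 0 <= t -> t <= 1 -> clamp t = t.
Proof. by move=> h0 h1; rewrite /clamp (min_idPr h1) (max_idPr h0). Qed.

Lemma clamp_continuous : continuous clamp.
Proof.
apply: max_fun_continuous; first exact: cst_continuous.
apply: min_fun_continuous; first exact: cst_continuous.
by move=> x; exact: cvg_id.
Qed.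

Lemma continuous_clamp (g : R -> R * R) :
  {within `[0, 1], continuous g}%classic -> continuous (g \o clamp).
Proof.
move=> /subspace_continuousP hg t.
have hc : `[0, 1]%classic (clamp t) := clamp_itv t.
apply: cvg_comp (hg _ hc).
move=> A /= hA; suff : nbhs t (clamp @^-1` A)%classic by [].
apply: (@filterS _ (nbhs t) _ (clamp @^-1` (fun y => `[0, 1]%classic y -> A y))%classic).
  by move=> x hx; apply: hx; exact: (clamp_itv x).
exact: (clamp_continuous hA).
Qed.

Lemma continuous_coords (T : topologicalType) (g : T -> R * R) : continuous g ->
  continuous (fun t => (g t).1) /\ continuous (fun t => (g t).2).
Proof.
move=> cg; split=> t; apply: cvg_comp (cg t) _; [exact: cvg_fst | exact: cvg_snd].
Qed.

Lemma continuous_dst (T : topologicalType) (g h : T -> R * R) :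
  continuous g -> continuous h -> continuous (fun t => dst (g t) (h t)).
Proof.
move=> /continuous_coords[g1 g2] /continuous_coords[h1 h2].
apply: max_fun_continuous => t.
  by apply: cvg_norm; apply: cvgB; [exact: g1 | exact: h1].
by apply: cvg_norm; apply: cvgB; [exact: g2 | exact: h2].
Qed.

Lemma continuous_bigmax (T : topologicalType) (I : Type) (s : seq I) (F : I -> T -> R) :
  (forall i, continuous (F i)) -> continuous (fun t => \big[Num.max/0]_(i <- s) F i t).
Proof.
move=> cF; elim: s => [|i s IH].
  have -> : (fun t => \big[Num.max/0]_(i <- [::]) F i t) = (fun=> 0).
    by apply/funext => t; rewrite big_nil.
  exact: cst_continuous.
have -> : (fun t => \big[Num.max/0]_(j <- i :: s) F j t) =
    (F i) \max (fun t => \big[Num.max/0]_(j <- s) F j t).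
  by apply/funext => t; rewrite big_cons.
exact: max_fun_continuous.
Qed.

Lemma dist_point (G : R -> R * R) q : continuous G ->
  (forall t, 0 <= t -> t <= 1 -> G t <> q) ->
  exists2 d, 0 < d & forall t, 0 <= t -> t <= 1 -> d < dst (G t) q.
Proof.
move=> cG hne.
have cf : {within `[0, 1], continuous (fun t => dst (G t) q)}%classic.
  by apply: continuous_subspaceT; apply: continuous_dst => //; exact: cst_continuous.
have [c hc hmin] := EVT_min ler01 cf.
move: hc; rewrite in_itv /= => /andP[c0 c1].
have m0 : 0 < dst (G c) q.
  by rewrite lt_neqAle dst_ge0 andbT eq_sym; apply/eqP => h; apply: (hne c) => //; apply: dst_eq0; rewrite h.
exists (dst (G c) q / 2); first by rewrite divr_gt0.
move=> t t0 t1; apply: lt_le_trans (hmin t _); first by rewrite ltr_pdivrMr //; lra.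
by rewrite in_itv /= t0.
Qed.

Lemma dist_curves (I : finType) (pos : I -> R * R) (G H : R -> R * R) r : 0 < r ->
  continuous G -> continuous H ->
  (forall s t, 0 <= s -> s <= 1 -> 0 <= t -> t <= 1 -> G s = H t -> exists i, G s = pos i) ->
  exists2 d, 0 < d & forall s t, 0 <= s -> s <= 1 -> 0 <= t -> t <= 1 ->
    (forall i, r <= dst (G s) (pos i)) -> d < dst (G s) (H t).
Proof.
move=> r0 cG cH hcap.
have [p1 p2] : continuous (fun x : R * R => x.1) /\ continuous (fun x : R * R => x.2).
  by apply: (@continuous_coords (R * R)%type id) => x; exact: cvg_id.
have c1 : continuous (fun x : R * R => G x.1).
  by move=> x; exact: (continuous_comp (p1 x) (cG _)).
have c2 : continuous (fun x : R * R => H x.2).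
  by move=> x; exact: (continuous_comp (p2 x) (cH _)).
(* [far] is positive exactly where [G] comes within [r] of some [pos i]. So [psi] is positive on the
   whole compact square, common points included, and equals the distance where the bound is
   claimed. *)
pose far (x : R * R) := \big[Num.max/0]_(i : I) (r - dst (G x.1) (pos i)).
pose psi (x : R * R) := Num.max (dst (G x.1) (H x.2)) (far x).
have cpsi : continuous psi.
  apply: max_fun_continuous; first exact: continuous_dst.
  apply: continuous_bigmax => i x; apply: cvgB; first exact: cvg_cst.
  by apply: continuous_dst => //; exact: cst_continuous.
pose K := (`[0, 1]%classic `*` `[0, 1]%classic)%classic : set (R * R).
have cK : compact K by apply: compact_setX; exact: segment_compact.
have K0 : (K !=set0)%classic by exists (0, 0); split; rewrite /= in_itv /= lexx ler01.
have [c hc hmin] := compact_EVT_min K0 cK (continuous_subspaceT cpsi).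
move: hc => /set_mem[] /=; rewrite !in_itv /= => /andP[a0 a1] /andP[b0 b1].
have m0 : 0 < psi c.
  rewrite /psi lt_max; have [h|h] := ltrP 0 (dst (G c.1) (H c.2)) => //=.
  have [i hi] := hcap _ _ a0 a1 b0 b1 (dst_eq0 h).
  rewrite /far; apply: (lt_le_trans r0).
  apply: (le_trans (y := r - dst (G c.1) (pos i))); first by rewrite hi dstxx subr0.
  exact: (le_bigmax_cond 0 (fun i => r - dst (G c.1) (pos i))).
exists (psi c / 2); first by rewrite divr_gt0.
move=> s t s0 s1 t0 t1 hfar; have hK : (s, t) \in K.
  by apply/mem_set; split; rewrite /= in_itv /= ?s0 ?t0.
have := hmin _ hK; rewrite {2}/psi /=.
have far0 : far (s, t) <= 0.
  rewrite /far; elim/big_ind: _ => // [x y hx hy|i _]; first by rewrite ge_max hx hy.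
  by rewrite subr_le0.
rewrite (max_idPl (le_trans far0 (dst_ge0 _ _))) => h.
by apply: lt_le_trans h; rewrite ltr_pdivrMr //; lra.
Qed.

Lemma continuous_dstP (G : R -> R * R) t e : continuous G -> 0 < e ->
  exists2 d, 0 < d & forall t', `|t - t'| < d -> dst (G t) (G t') < e.
Proof.
move=> cG e0; have cd : continuous (fun t' => dst (G t) (G t')).
  by apply: continuous_dst => //; exact: cst_continuous.
have /cvgrPdist_lt /(_ e e0) := cd t.
rewrite dstxx => /nbhs_ballP[d /= d0 hd]; exists d => // t' ht.
by have := hd t' ht; rewrite /= sub0r normrN ger0_norm ?dst_ge0.
Qed.

(** Continuous induction: at the supremum of the parameters up to which the curve can be followed,
    continuity allows one more box walk, past the supremum unless it is 1. *)
Lemma curve_walk (G : R -> R * R) h : continuous G -> 0 < h ->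
  exists s, [/\ path adjp (fl h (G 0)) s, last (fl h (G 0)) s = fl h (G 1) &
    forall z : pt, z \in fl h (G 0) :: s -> exists t, [/\ 0 <= t, t <= 1 & dst (emb h z) (G t) <= 2 * h]].
Proof.
move=> cG h0.
pose near (z : pt) := exists t, [/\ 0 <= t, t <= 1 & dst (emb h z) (G t) <= 2 * h].
pose P t := exists s, [/\ path adjp (fl h (G 0)) s, last (fl h (G 0)) s = fl h (G t) &
    forall z : pt, z \in fl h (G 0) :: s -> near z].
pose S := [set t | [/\ 0 <= t, t <= 1 & P t]]%classic.
have S0 : S 0.
  split; rewrite ?lexx ?ler01 //; exists [::]; split=> // z; rewrite inE => /eqP ->.
  by exists 0; split; rewrite ?ler01 //; apply: le_trans (dst_fl _ h0) _; lra.
have hs : has_sup S by split; [exists 0 | exists 1 => t []].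
have s0 : 0 <= sup S by apply: (ub_le_sup hs.2).
have s1 : sup S <= 1 by apply: ge_sup; [exists 0 | move=> t []].
have [d d0 hd] := continuous_dstP (sup S) cG h0.
have [t [t0 t1 [s [p1 p2 p3]]] ht] := sup_adherent d0 hs.
have tS : t <= sup S by apply: (ub_le_sup hs.2); split=> //; exists s.
have dt : dst (G (sup S)) (G t) < h by apply: hd; rewrite ger0_norm; lra.
have ext t' : `|sup S - t'| < d -> 0 <= t' -> t' <= 1 -> P t'.
  move=> /hd dt' t0' t1'.
  have [s' [q1 q2 q3]] := box_walk (fl h (G t)) (fl h (G t')).
  exists (s ++ s'); split.
  - by rewrite cat_path p1 p2.
  - by rewrite last_cat p2.
  move=> z; rewrite -cat_cons mem_cat => /orP[/p3 //|hz].
  (* The bound [2 * h] is one [h] for rounding to the grid and one for the variation of [G] near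
     [sup S]; it passes to the box because sup-distance balls are boxes themselves. *)
  exists (sup S); split=> //.
  have hz' : in_box (fl h (G t)) (fl h (G t')) z by apply: q3; rewrite inE hz orbT.
  apply: dst_box hz' => //.
    apply: le_trans (dst_triangle (G t) _ _) _; have := dst_fl (G t) h0.
    by move: dt; rewrite dstC; lra.
  apply: le_trans (dst_triangle (G t') _ _) _; have := dst_fl (G t') h0.
  by move: dt'; rewrite dstC; lra.
suff e : sup S = 1.
  have k : `|sup S - 1| < d by rewrite e subrr normr0.
  exact: (ext 1 k ler01 (lexx 1)).
apply/eqP; rewrite eq_le s1 /=; rewrite leNgt; apply/negP => hlt.
pose t' := Num.min 1 (sup S + d / 2).
have [e1 e2 e3] : [/\ sup S < t', t' <= 1 & t' < sup S + d].
  by rewrite /t' lt_min ge_min gt_min lexx hlt /=; split=> //; [lra | apply/orP; right; lra].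
have : t' <= sup S.
  apply: (ub_le_sup hs.2); split=> //; [lra | apply: ext => //; [|lra]].
  by rewrite ltr0_norm; lra.
by rewrite leNgt e1.
Qed.

End Distance.

(** The grid has mesh [h] and the balls have [N] meshes as radius, that is [rho]. Each arc is
    followed by a lattice walk, trimmed to the part between the two balls of its ends. *)
Lemma planar_model (R : realType) (V : finType) (E : {set {set V}}) :
  planar R E -> simple_graph E -> exists L, is_model E L.
Proof.
move=> [pos [arc hd]] hE.
pose G e := arc e \o @clamp R.
have Garc e t : 0 <= t -> t <= 1 -> G e t = arc e t by move=> h0 h1; rewrite /G /= clamp_id.
have tr e t : 0 <= t -> t <= 1 -> arc_trace (arc e) (G e t).
  by move=> h0 h1; rewrite Garc //; exists t => //=; rewrite in_itv /= h0.
have cG e : e \in E -> continuous (G e).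
  by move=> /(drawing_ends hd)[x [y [_ [h _ _ _]]]]; exact: continuous_clamp.
have [d1 d10 hd1] : exists2 d : R, 0 < d &
    forall uv : V * V, uv.1 != uv.2 -> d < dst (pos uv.1) (pos uv.2).
  apply: pos_uniform => [[u v] /=|[u v] d d' hd' h hne]; last exact: le_lt_trans hd' (h hne).
  have [->|huv] := eqVneq u v; first by exists 1.
  have h0 : 0 < dst (pos u) (pos v).
    rewrite lt_neqAle dst_ge0 andbT eq_sym; apply/eqP => h.
    by case/eqP: huv; apply: (drawing_inj hd); apply: dst_eq0; rewrite h.
  by exists (dst (pos u) (pos v) / 2); [rewrite divr_gt0 | move=> _; rewrite ltr_pdivrMr //; lra].
have [d2 d20 hd2] : exists2 d : R, 0 < d & forall ev : {set V} * V, ev.1 \in E -> ev.2 \notin ev.1 ->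
    forall t, 0 <= t -> t <= 1 -> d < dst (G ev.1 t) (pos ev.2).
  apply: pos_uniform => [[e v] /=|[e v] d d' hd' h h1 h2 t t0 t1]; last first.
    exact: le_lt_trans hd' (h h1 h2 t t0 t1).
  have [he|he] := boolP (e \in E); last by exists 1.
  have [hv|hv] := boolP (v \in e); first by exists 1.
  have [t t0 t1|d d0 h] := dist_point (cG e he) (q := pos v).
    move=> ht; move/negP: hv; apply; apply: (drawing_vertex hd he).
    by rewrite -ht; exact: tr.
  by exists d.
(* Up to rounding, disjoint balls need vertex distances above [2 * rho], and avoiding a foreign ball
   needs a distance above [rho]; a sixth leaves ample room for errors of a few [h]. *)
pose rho := Num.min d1 d2 / 6.
have rho0 : 0 < rho by rewrite divr_gt0 // lt_min d10 d20.
have rd1 : 6 * rho <= d1 by rewrite /rho mulrC divfK // ge_min lexx.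
have rd2 : 6 * rho <= d2 by rewrite /rho mulrC divfK // ge_min lexx orbT.
(* Arcs with a common end come arbitrarily close to each other, so a uniform distance exists only
   away from the vertices; the trimmed paths stay there. *)
have [d3 d30 hd3] : exists2 d : R, 0 < d & forall ef : {set V} * {set V}, ef.1 \in E -> ef.2 \in E ->
    ef.1 != ef.2 -> forall s t, 0 <= s -> s <= 1 -> 0 <= t -> t <= 1 ->
    (forall i, rho / 2 <= dst (G ef.1 s) (pos i)) -> d < dst (G ef.1 s) (G ef.2 t).
  apply: pos_uniform => [[e f] /=|[e f] d d' hd' h h1 h2 h3 s t a0 a1 b0 b1 hf]; last first.
    exact: le_lt_trans hd' (h h1 h2 h3 s t a0 a1 b0 b1 hf).
  have [he|he] := boolP (e \in E); last by exists 1.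
  have [hf|hf] := boolP (f \in E); last by exists 1.
  have [|hne] := eqVneq e f; first by exists 1.
  have r2 : 0 < rho / 2 by rewrite divr_gt0.
  have [s t a0 a1 b0 b1 est|d d0 h] := dist_curves (pos := pos) r2 (cG e he) (cG f hf).
    have tf := tr f t b0 b1; rewrite -est in tf.
    have [v _ ev] := drawing_cross hd he hf (elimN eqP hne) (tr e s a0 a1) tf.
    by exists v.
  by exists d.
(* This yields [16 * h < rho], which absorbs the rounding errors near the balls, and [4 * h < d3]:
   two arcs whose paths share a lattice point are each within [2 * h] of it. *)
pose N := (Num.bound (16 + 4 * rho / d3)).+1.
have q0 : 0 <= 4 * rho / d3 by apply: divr_ge0; [lra | exact: ltW].
have q1 : 0 <= 16 + 4 * rho / d3 by lra.
have hN : 16 + 4 * rho / d3 < N%:R.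
  by apply: (lt_trans (archi_boundP q1)); rewrite ltr_nat.
have N16 : 16 < N%:R :> R by lra.
have N0 : 0 < N%:R :> R by lra.
pose h := rho / N%:R.
have h0 : 0 < h by rewrite divr_gt0.
have hNr : h * N%:R = rho by rewrite /h divfK // gt_eqF.
have h16 : 16 * h < rho by rewrite -hNr mulrC ltr_pM2l.
have h4 : 4 * h < d3.
  have k : 4 * rho / d3 < N%:R by lra.
  by rewrite ltr_pdivrMr // in k; rewrite /h mulrA ltr_pdivrMr // [ltRHS]mulrC.
have NE : (N%:Z)%:~R = N%:R :> R by rewrite -pmulrn.
pose ctr0 v := fl h (pos v).
have far v p : ~~ inb (ctr0 v) N%:Z p -> rho <= dst (emb h p) (pos v).
  rewrite inb_di -ltNge => hp.
  have := dst_triangle (pos v) (emb h p) (emb h (ctr0 v)); rewrite dst_emb //.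
  have := dst_fl (pos v) h0; rewrite dstC -/(ctr0 v) => k1 k2.
  have k3 : h * (N%:Z + 1)%:~R <= h * (di p (ctr0 v))%:~R by rewrite ler_pM2l // ler_int lezD1.
  by move: k3; rewrite intrD NE mulrDr hNr mulr1 => k3; lra.
have faron v p : onb (ctr0 v) N%:Z p -> rho - h <= dst (emb h p) (pos v).
  rewrite /onb -/(di _ _) => /eqP hp.
  have := dst_triangle (pos v) (emb h p) (emb h (ctr0 v)); rewrite dst_emb // hp NE hNr.
  by have := dst_fl (pos v) h0; rewrite dstC -/(ctr0 v) => k1 k2; lra.
have nearb v p : inb (ctr0 v) N%:Z p -> dst (emb h p) (pos v) <= rho + h.
  rewrite inb_di => hp.
  have := dst_triangle (emb h (ctr0 v)) (emb h p) (pos v); rewrite dst_emb //.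
  have := dst_fl (pos v) h0; rewrite -/(ctr0 v) => k1 k2.
  have k3 : h * (di p (ctr0 v))%:~R <= h * (N%:Z)%:~R by rewrite ler_pM2l // ler_int.
  by move: k3; rewrite NE hNr => k3; lra.
have bdisj u v p : inb (ctr0 u) N%:Z p -> inb (ctr0 v) N%:Z p -> u = v.
  move=> /nearb k1 /nearb k2; apply/eqP; apply: contraT => huv.
  have := hd1 (u, v) huv; have := dst_triangle (emb h p) (pos u) (pos v) => /=.
  by move: k1; rewrite dstC; lra.
(* [opath] looks only at the balls, so a layout with dummy paths can be used while the real paths
   are being chosen. *)
have hex e : exists s, e \in E -> exists x y, [/\ e = [set x; y], x != y,
    opath (Layout ctr0 (fun=> N%:Z) (fun=> [::])) x y s &
    forall z, z \in s -> exists t, [/\ 0 <= t, t <= 1 & dst (emb h z) (G e t) <= 2 * h]].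
  have [he|he] := boolP (e \in E); last by exists [::].
  have [x [y [exy [_ _ g0 g1]]]] := drawing_ends hd he.
  have hxy : x != y by apply/negP => /eqP e1; have := hE _ he; rewrite exy e1 setUid cards1.
  have [s [p1 p2 p3]] := curve_walk (cG e he) h0.
  have e0 : fl h (G e 0) = ctr0 x by rewrite Garc ?lexx ?ler01 // g0.
  have e1 : fl h (G e 1) = ctr0 y by rewrite Garc ?lexx ?ler01 // g1.
  rewrite e0 e1 in p1 p2 p3.
  have N1 : 1 <= N%:Z by rewrite lez_nat.
  have cA : inb (ctr0 x) N%:Z (ctr0 x) by exact: inb_center.
  have cB : inb (ctr0 y) N%:Z (last (ctr0 x) s) by rewrite p2; exact: inb_center.
  have [p' [s' [k1 k2 k3 [k4 k5] k6]]] := path_extract p1 cA cB.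
  exists (p' :: s') => _; exists x, y; split=> //; last by move=> z /k3 /p3.
  exists p', s'; split=> // z v hz hv; rewrite /ball_of /= in hv.
  have [vx|vx] := eqVneq v x; first by left; split=> //; apply: (k6 z hz).1; rewrite -vx.
  have [vy|vy] := eqVneq v y; first by right; split=> //; apply: (k6 z hz).2; rewrite -vy.
  exfalso; have [t [t0 t1 ht]] := p3 z (k3 z hz).
  have ve : v \notin e by rewrite exy !inE (negbTE vx) (negbTE vy).
  have := hd2 (e, v) he ve t t0 t1 => /=; have := nearb _ _ hv.
  by have := dst_triangle (emb h z) (G e t) (pos v); move: ht; rewrite dstC; lra.
have /choice[P hP] := hex.
pose L := Layout ctr0 (fun=> N%:Z) P.
(* A path meets a ball only on its border, [N] meshes from the rounded centre; the rounding of the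
   centre costs one [h]. *)
have farP e z v : e \in E -> z \in P e -> rho - h <= dst (emb h z) (pos v).
  move=> he hz; have [x [y [exy hxy ho hn]]] := hP e he.
  have [hb|hb] := boolP (inb (ctr0 v) N%:Z z); last by have := far _ _ hb; lra.
  apply: faron; have [p [t [es hp hu [hx hy] hzz]]] := ho.
  have ends : forall x' y' s, x' != y' -> opath L x' y' s -> forall p t, s = p :: t ->
      onb (ctr0 x') N%:Z p.
    move=> x' y' s hxy' [p' [t' [-> hp' hu' [hx' hy'] hz']]] p1 t1 [<- _].
    case: t' hp' hu' hy' hz' => [|q' t'] hp' hu' hy' hz'.
      by case/eqP: hxy'; exact: bdisj hx' hy'.
    have hpq : adjp p' q' by case/andP: hp'.
    apply: onb_out hx' _ hpq; apply/negP => hq.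
    have hin : q' \in [:: p', q' & t'] by rewrite !inE eqxx orbT.
    case: (hz' q' x' hin hq) => [[_ e1]|[e1 _]].
      by move: hu'; rewrite e1 /= mem_head.
    by rewrite e1 eqxx in hxy'.
  have hz' : z \in p :: t by rewrite -es.
  have ho' : opath L x y (P e) by exact: ho.
  case: (hzz z v hz' hb) => -[-> ->]; first exact: (ends x y (P e) hxy ho' p t es).
  apply: (ends y x (rev (P e)) _ (opath_rev ho') (last p t) (behead (rev (P e)))).
    by rewrite eq_sym.
  by rewrite es lastI rev_rcons.
exists L; split.
- by move=> v; rewrite lez_nat.
- exact: bdisj.
- by move=> e he; have [x [y [h1 h2 h3 _]]] := hP e he; exists x, y.
move=> e f z he hf ze zf; apply/eqP; apply: contraT => hne.
have [_ [_ [_ _ _ ne]]] := hP e he; have [_ [_ [_ _ _ nf]]] := hP f hf.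
have [t [t0 t1 ht]] := ne z ze; have [s [s0 s1 hs]] := nf z zf.
have hfar i : rho / 2 <= dst (G e t) (pos i).
  have := farP e z i he ze; have := dst_triangle (G e t) (emb h z) (pos i).
  by lra.
have := hd3 (e, f) he hf hne t s t0 t1 s0 s1 hfar => /=.
by have := dst_triangle (emb h z) (G e t) (G f s); move: ht; rewrite dstC; lra.
Qed.

(** * Triangulations and spanning trees *)

(** The second alternative is excluded in two ways: by the maximality of a triangulation, and by
    choosing a laid out graph with the most edges. *)
Lemma cyclic_separators_or_extend (V : finType) (E : {set {set V}}) L : is_model E L ->
  cyclic_separators E \/ exists a b s, [/\ a != b, [set a; b] \notin E &
    is_model ([set a; b] |: E) (refined L [set a; b] s)].
Proof.
move=> M; apply: contrapT => /not_orP[+ hno]; apply=> F hF a b ha hb; apply: contrapT => hn.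
apply: hno; pose A := [set x | connect (adj (induced_edges E (~: F))) a x].
have adjF x y : adj (induced_edges E (~: F)) x y = [&& adj E x y, x \notin F & y \notin F].
  by rewrite /adj inE subUset !sub1set !in_setC.
have AF x : x \in A -> x \notin F.
  rewrite inE => /connectP[p hp ->]; elim: p (a) ha hp => [|y p IH] x' //= hx /andP[hxy hp].
  by apply: IH => //; move: hxy; rewrite adjF => /and3P[].
have hAB x y : x \in A -> y \notin A -> y \notin F -> [set x; y] \notin E.
  move=> hx hy hyF; apply: contra hy => hxy; move: (hx); rewrite !inE => h.
  by apply: connect_trans h (connect1 _); rewrite adjF AF // hyF /adj hxy.
have dAF : [disjoint A & F].
  by rewrite disjoint_subset; apply/subsetP => x /AF.
have aA : a \in A by rewrite inE connect0.
have bA : b \notin A by rewrite inE; apply/negP.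
have [a' [b' [s [ha' hb' hbF' M']]]] := extend_model M hF aA bA ha hb hAB dAF.
exists a', b', s; split=> //; last exact: hAB.
by apply: contraNneq hb' => <-.
Qed.

Lemma triangulation_cyclic_separators (R : realType) (V : finType) (E : {set {set V}}) :
  planar_triangulation R E -> cyclic_separators E.
Proof.
case=> hE hpl hmax; have [L M] := planar_model hpl hE.
case: (cyclic_separators_or_extend M) => // -[a [b [s [hab he M']]]].
case: (hmax [set a; b]) => //; first by rewrite cards2 hab.
exact: model_planar M'.
Qed.

Lemma path_edges_of (V : finType) (E : {set {set V}}) x s :
  {subset edges_of x s <= E} -> path (adj E) x s.
Proof.
elim: s x => [|y s IH] x //= h; apply/andP; split; first by apply: h; rewrite mem_head.
by apply: IH => e he; apply: h; rewrite inE he orbT.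
Qed.

(** A connected edge set of least size has no cycle, because the rest of a cycle replaces any of its
    edges. *)
Lemma connected_tree (V : finType) (E : {set {set V}}) : connected_graph E ->
  exists2 T : {set {set V}}, T \subset E & is_tree T.
Proof.
move=> hE.
pose P (T : {set {set V}}) := (T \subset E) && `[< connected_graph T >].
have PE : P E by rewrite /P subxx; apply/asboolP.
case: (arg_minnP (fun T : {set {set V}} => #|T|) PE) => T /andP[sub /asboolP hT] hmin.
exists T => //; split=> // c [hsz hu hc].
case: c hsz hu hc => [|x [|y [|z s]]] // _ hu hc.
pose e := [set x; y]; have heT : e \in T by move: hc => /= /andP[].
suff : P (T :\ e) by move/hmin; rewrite leqNgt (cardsD1 e T) heT add1n ltnS leqnn.
rewrite /P (subset_trans (subsetDl _ _) sub); apply/asboolP => a b.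
have hyx : connect (adj (T :\ e)) y x.
  apply/connectP; exists (rcons (z :: s) x); last by rewrite last_rcons.
  apply: path_edges_of => f hf; rewrite !inE.
  have -> /= : f \in T.
    by move: hc => /= /andP[_ hc]; apply: (edges_of_sub _ hf).
  rewrite andbT; apply/eqP => fe; rewrite fe in hf.
  move: hu => /= /and4P[+ + _ _]; rewrite !inE !negb_or => /and3P[xy xz xs] /andP[yz ys].
  move: hf; rewrite rcons_cons /= in_cons => /orP[/eqP ee|he].
    have : x \in [set y; z] by rewrite -ee set21.
    by rewrite !inE (negbTE xy) (negbTE xz).
  have := edges_of_mem he (set22 x y).
  by rewrite inE mem_rcons inE (negbTE yz) (negbTE ys) [y == x]eq_sym (negbTE xy).
have hsym : connect_sym (adj (T :\ e)).
  by apply: sym_connect_sym => u v; rewrite adj_sym.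
have step u v : adj T u v -> connect (adj (T :\ e)) u v.
  move=> huv; have [euv|neuv] := eqVneq [set u; v] e; last first.
    by apply: connect1; rewrite /adj !inE neuv.
  have [uv|uv] := eqVneq u v; first by rewrite uv connect0.
  have hu' : u \in [set x; y] by rewrite -[[set x; y]]/e -euv set21.
  have hv' : v \in [set x; y] by rewrite -[[set x; y]]/e -euv set22.
  move: hu' hv'; rewrite !inE => /orP[]/eqP eu /orP[]/eqP ev; rewrite eu ev ?connect0 //.
  by rewrite hsym.
have /connectP[p hp ->] := hT a b.
elim: p a hp => [|y' p IH] a' /=; first by rewrite connect0.
by case/andP => /step h /IH; exact: connect_trans.
Qed.

Lemma leaf_of (V : finType) (T : {set {set V}}) v e0 : (1 < #|V|)%N -> connected_graph T ->
  (forall e, e \in T -> v \in e -> e = e0) -> v \in leaves T.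
Proof.
move=> hV hT he0.
have [w hw] : exists w : V, w != v.
  apply: contrapT => hno; move: hV; rewrite ltnNge => /negP; apply.
  rewrite -(card1 v); apply: subset_leq_card; apply/subsetP => w _; rewrite !inE.
  by apply: contraT => h; case: hno; exists w.
have /connectP[p hp e] := hT v w.
case: p hp e => [|y p] /=; first by move=> _ e; rewrite e eqxx in hw.
case/andP => hvy _ _; rewrite inE; apply/eqP.
have e1 := he0 _ hvy (set21 v y).
rewrite (_ : [set e in T | v \in e] = [set e0]) ?cards1 //.
apply/setP => e; rewrite !inE; apply/andP/eqP => [[h1 h2]|->]; first exact: he0.
by rewrite -e1 set21.
Qed.

(** Each vertex of [F] is hung by a single edge on the connected graph G - F; any spanning tree of
    the result keeps all these edges. *)
Lemma spanning_tree_leaves (V : finType) (E : {set {set V}}) (F : {set V}) :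
  (1 < #|V|)%N -> simple_graph E -> cyclic_separators E -> induces_forest E F ->
  exists2 T, T \in spanning_trees E & F \subset leaves T.
Proof.
move=> hV hE hsep hF.
have conn0 : connected_graph E.
  move=> a b; have h0 : induces_forest E finset.set0.
    move=> c [h1 _ h3]; case: c h1 h3 => [|x [|y c]] //= _ /andP[].
    by rewrite /adj inE subUset !sub1set !in_set0 /= andbF.
  have := hsep _ h0 a b; rewrite !inE => /(_ isT isT).
  have -> // : induced_edges E (~: finset.set0) = E.
  by apply/setP => e; rewrite inE setC0 subsetT andbT.
(* If the whole graph is a forest, any two vertices are adjacent, since deleting all others must
   leave them connected. A third vertex would give a triangle, so there is only the edge
   [[set: V]]. *)
have [FT|FT] := eqVneq F [set: V].
  have [T sub hT] := connected_tree conn0.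
  exists T; first by rewrite inE sub; apply/asboolP.
  apply/subsetP => v _; apply: (@leaf_of _ _ v [set: V]) => //; first by case: hT.
  move=> e he hv; apply/setP => w; rewrite inE.
  have [x [y [exy hxy]]] := simple_edgeP hE (subsetP sub _ he).
  apply: contraT => hw.
  have allE a b : a != b -> adj E a b.
    move=> hab; have hF' : induces_forest E (~: [set a; b]).
      apply: forest_sub hF; apply/subsetP => f; rewrite !inE FT => /andP[-> _].
      exact: subsetT.
    have := hsep _ hF' a b; rewrite !inE !eqxx orbT => /(_ isT isT) /connectP[p].
    elim: p a hab {hF'} => [|c p IH] a' hab /=; first by move=> _ e1; rewrite e1 eqxx in hab.
    case/andP; rewrite {1}/adj inE subUset !sub1set setCK => /and3P[hac _].
    rewrite !inE => /orP[]/eqP ec; last by rewrite -ec.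
    by have := adj_neq hE hac; rewrite ec eqxx.
  exfalso; have [nwx nwy] : w != x /\ w != y by move: hw; rewrite exy !inE negb_or => /andP.
  apply: (hF [:: x; y; w]); split=> //.
    by rewrite /= !inE negb_or hxy [x == w]eq_sym [y == w]eq_sym nwx nwy.
  have ind : induced_edges E F = E by apply/setP => f; rewrite inE FT subsetT andbT.
  by rewrite /= ind !allE // eq_sym.
have [b0 hb0] : exists b0, b0 \notin F.
  apply: contrapT => hno; case/eqP: FT; apply/setP => x; rewrite inE.
  by apply: contraT => hx; case: hno; exists x.
have adjF G x y : adj (induced_edges E (~: G)) x y = [&& adj E x y, x \notin G & y \notin G].
  by rewrite /adj inE subUset !sub1set !in_setC.
(* The set [F :\ f] induces a forest as well, so [f] is joined to [b0] off it, and the first step of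
   such a path leaves [F]. *)
have nbr f : f \in F -> exists n, n \notin F /\ adj E f n.
  move=> hf; have hF' : induces_forest E (F :\ f).
    apply: forest_sub hF; apply/subsetP => e; rewrite !inE => /andP[-> h].
    exact: subset_trans h (subsetDl _ _).
  have := hsep _ hF' f b0; rewrite !inE eqxx (negbTE hb0) andbF => /(_ isT isT).
  case/connectP => -[|y p] /=; first by move=> _ e; rewrite e hf in hb0.
  case/andP; rewrite adjF !inE !negb_and !negbK => /and3P[hfy _ /orP[/eqP e|hy]] _ _.
    by have := adj_neq hE hfy; rewrite e eqxx.
  by exists y.
have /choice[n hn] : forall f, exists m, f \in F -> m \notin F /\ adj E f m.
  move=> f; have [hf|hf] := boolP (f \in F); last by exists f.
  by have [m hm] := nbr f hf; exists m.
pose E2 := induced_edges E (~: F) :|: [set [set f; n f] | f in F].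
have sub2 : E2 \subset E.
  apply/subsetP => e; rewrite inE => /orP[|/imsetP[f hf ->]]; first by rewrite inE => /andP[].
  by have [_ h] := hn f hf.
have hsym : connect_sym (adj E2) by apply: sym_connect_sym => u v; rewrite adj_sym.
have toout x : exists2 y, y \notin F & connect (adj E2) x y.
  have [hx|hx] := boolP (x \in F); last by exists x; rewrite ?connect0.
  exists (n x); first by have [] := hn x hx.
  apply: connect1; rewrite /adj inE; apply/orP; right; apply/imsetP; by exists x.
have conn2 : connected_graph E2.
  move=> a b; have [a' ha' h1] := toout a; have [b' hb' h2] := toout b.
  apply: connect_trans h1 _; rewrite hsym; apply: connect_trans h2 _; rewrite hsym.
  apply: connect_sub (hsep _ hF _ _ ha' hb') => u v huv.
  by apply: connect1; rewrite /adj inE; apply/orP; left.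
have [T sub hT] := connected_tree conn2.
exists T; first by rewrite inE (subset_trans sub sub2); apply/asboolP.
apply/subsetP => f hf; apply: (@leaf_of _ _ f [set f; n f]) => //; first by case: hT.
move=> e /(subsetP sub); rewrite inE => /orP[|/imsetP[g hg ->]].
  by rewrite inE => /andP[_ /subsetP h] /h; rewrite inE hf.
rewrite !inE => /orP[]/eqP efg; first by rewrite efg.
by have [h _] := hn g hg; rewrite -efg hf in h.
Qed.

(** * From induced forests to robust connectivity *)

Lemma forest_to_robust (R : realType) :
  (forall (V : finType) (E : {set {set V}}), simple_graph E -> planar R E ->
      exists F : {set V}, induces_forest E F /\ (#|V|%:R / 2%:R <= #|F|%:R :> rat)) ->
  forall (V : finType) (E : {set {set V}}), (1 < #|V|)%N -> planar_triangulation R E ->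
      (2%:R^-1 <= robust_connectivity E :> rat).
Proof.
move=> hA V E hV hT; have hsep := triangulation_cyclic_separators hT.
have [hE [pos [arc hd]] _] := hT.
rewrite /robust_connectivity; elim/big_ind: _ => [|x y hx hy|X hX].
- by rewrite invf_le1.
- by rewrite le_min hx hy.
(* The induced subgraph on [X] gets a vertex type of its own, so that the bound of (A) is half of
   [#|X|]; its drawing is the restriction of the given one. *)
pose V' : finType := {x : V | x \in X}.
pose E' := [set e : {set V'} | (val @: e) \in E].
have vinj : injective (val : V' -> V) by exact: val_inj.
have iinj := imset_inj vinj.
have hE' : simple_graph E' by move=> e; rewrite inE => /hE; rewrite card_imset.
have hp' : planar R E'.
  exists (fun x : V' => pos (val x)), (fun e : {set V'} => arc (val @: e)); split.
  - exact: inj_comp (drawing_inj hd) vinj.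
  - move=> e; rewrite inE => he; have [x [y [exy ha]]] := drawing_ends hd he.
    have hx : x \in [set val z | z in e] by rewrite exy set21.
    have hy : y \in [set val z | z in e] by rewrite exy set22.
    have [x' _ ex] := imsetP hx; have [y' _ ey] := imsetP hy.
    exists x', y'; rewrite -ex -ey; split=> //.
    by apply: iinj; rewrite exy imsetU !imset_set1 ex ey.
  - move=> e v; rewrite inE => he h; have := drawing_vertex hd he h.
    by rewrite mem_imset.
  move=> e f p; rewrite !inE => he hf hne h1 h2.
  have hne' : [set val z | z in e] <> [set val z | z in f] by move/iinj.
  have [v hv ->] := drawing_cross hd he hf hne' h1 h2.
  move: hv; rewrite inE => /andP[/imsetP[v' hv' ev] hvf]; exists v'; last by rewrite ev.
  by rewrite inE hv' /=; move: hvf; rewrite ev mem_imset.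
have [F' [hF' hc]] := hA V' E' hE' hp'.
pose F := [set val x | x in F'].
have FX : F \subset X by apply/subsetP => x /imsetP[x' _ ->]; exact: valP.
have hF : induces_forest E F.
  move=> c [h1 h2 h3].
  have cF x : x \in c -> x \in F.
    by move=> hx; have := next_cycle h3 hx; rewrite /adj inE subUset sub1set => /andP[_ /andP[]].
  have [c' ec] : exists c' : seq V', c = map val c'.
    elim: c cF {h1 h2 h3} => [|x c IH] cF; first by exists [::].
    have [c' ->] := IH (fun z hz => cF z (mem_behead (s := x :: c) hz)).
    by have /imsetP[x' _ ->] := cF x (mem_head _ _); exists (x' :: c').
  rewrite {}ec in h1 h2 h3 cF; apply: (hF' c'); split.
  - by rewrite size_map in h1.
  - by rewrite map_inj_uniq in h2.
  move: h3; rewrite cycle_map; case: (c') => // x s; apply: sub_path => a b.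
  rewrite /adj /= !inE imsetU !imset_set1 !subUset !sub1set => /and3P[-> h4 h5] /=.
  by move: h4 h5; rewrite !mem_imset // => -> ->.
have [T hT' /subsetP hl] := spanning_tree_leaves hV hE hsep hF.
have cX : (0 < #|X|)%N by rewrite card_gt0.
have bound : 2%:R^-1 <= #|X :&: leaves T|%:R / #|X|%:R :> rat.
  rewrite ler_pdivlMr ?ltr0n // mulrC; apply: (le_trans (y := #|F|%:R)).
    rewrite card_imset //; move: hc; have -> // : #|V'| = #|X|.
    by rewrite card_sig; apply: eq_card => x; rewrite inE.
  rewrite ler_nat; apply: subset_leq_card; apply/subsetP => x hx.
  by rewrite inE (subsetP FX) // hl.
apply: le_trans bound _.
exact: (le_bigmax_cond _ (fun T => #|X :&: leaves T|%:R / #|X|%:R)).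
Qed.

(** * Separated layouts *)

Definition half (f : pt) : pt := ((f.1 %/ 2)%Z, (f.2 %/ 2)%Z).

(** Every old face splits into four of the same colour, so a change occurs only across half of an
    old edge of [Kset], which is covered by the doubled path or ball. *)
Lemma flat_refined (V : finType) (L : layout V) (EC : {set {set V}})
    (S : {set V}) e0 s0 col : e0 \notin EC -> flat (Kset L EC S) col ->
  flat (Kset (refined L e0 s0) EC S) (col \o half).
Proof.
move=> he0 hfl.
have hne e : e \in EC -> (e == e0) = false.
  by move=> he; apply/negbTE; apply: contra he0 => /eqP <-.
have Kdbl p q : adjp p q -> Kset L EC S p q -> Kset (refined L e0 s0) EC S (dp p) (mid p q).
  move=> hpq /KsetP[[e he hin]|[v hv [hp hq]]]; apply/KsetP.
    by left; exists e => //=; rewrite hne //; exact: inedge_dbl.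
  right; exists v => //; rewrite /ball_of /= dbl_inb dbl_inb_mid //.
  by rewrite [inb _ _ p]hp [inb _ _ q]hq.
have Ksym (L' : layout V) p q : Kset L' EC S p q = Kset L' EC S q p.
  apply/KsetP/KsetP => -[[e he hin]|[v hv [hp hq]]].
  - by left; exists e; rewrite // inedge_sym.
  - by right; exists v.
  - by left; exists e; rewrite // inedge_sym.
  by right; exists v.
apply: edge_ind => [p q hpq h|x y|x y].
- by rewrite Ksym -dif_sym.
- rewrite dif_vert /= /half /=.
  (* Either the edge runs inside an old face, or [x] is even and the edge is half of an old one; the
     parity of [y] tells which half. *)
  have [ho|he] : ((x - 1) %/ 2)%Z = (x %/ 2)%Z \/ (x = 2 * (x %/ 2)%Z /\ ((x - 1) %/ 2)%Z = (x %/ 2)%Z - 1) by lia.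
    by rewrite ho addbb.
  case: he => hx ->; set X := (x %/ 2)%Z in hx *; set Y := (y %/ 2)%Z; rewrite -dif_vert => hn.
  apply: hfl; first exact: adjp_vert.
  apply: contra hn => hK; have hXY := adjp_vert X Y.
  have [hy|hy] : y = 2 * Y \/ y = 2 * Y + 1 by rewrite /Y; lia.
    have := Kdbl _ _ hXY hK; rewrite /dp /mid /=.
    have -> : (2 * X, 2 * Y) = (x, y) by rewrite -hx -hy.
    by have -> : (X + X, Y + (Y + 1)) = (x, y + 1) by congr (_, _); lia.
  rewrite Ksym in hK; rewrite adjp_sym in hXY.
  have := Kdbl _ _ hXY hK; rewrite Ksym /dp /mid /=.
  have -> : (2 * X, 2 * (Y + 1)) = (x, y + 1) by congr (_, _); lia.
  by have -> : (X + X, Y + 1 + Y) = (x, y) by congr (_, _); lia.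
rewrite dif_hor /= /half /=.
have [ho|he] : ((y - 1) %/ 2)%Z = (y %/ 2)%Z \/ (y = 2 * (y %/ 2)%Z /\ ((y - 1) %/ 2)%Z = (y %/ 2)%Z - 1) by lia.
  by rewrite ho addbb.
case: he => hy ->; set Y := (y %/ 2)%Z in hy *; set X := (x %/ 2)%Z; rewrite -dif_hor => hn.
apply: hfl; first exact: adjp_hor.
apply: contra hn => hK; have hXY := adjp_hor X Y.
have [hx|hx] : x = 2 * X \/ x = 2 * X + 1 by rewrite /X; lia.
  have := Kdbl _ _ hXY hK; rewrite /dp /mid /=.
  have -> : (2 * X, 2 * Y) = (x, y) by rewrite -hx -hy.
  by have -> : (X + (X + 1), Y + Y) = (x + 1, y) by congr (_, _); lia.
rewrite Ksym in hK; rewrite adjp_sym in hXY.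
have := Kdbl _ _ hXY hK; rewrite Ksym /dp /mid /=.
have -> : (2 * (X + 1), 2 * Y) = (x + 1, y) by congr (_, _); lia.
by have -> : (X + 1 + X, Y + Y) = (x, y) by congr (_, _); lia.
Qed.

(** The argument of [chain_edge] for an arbitrary colouring: in a refined layout the separating
    colour is no longer given as the parity of a chain. *)
Lemma flat_edge (V : finType) (E : {set {set V}}) (L : layout V) (EC : {set {set V}})
    (S : {set V}) col x y : is_model E L -> EC \subset E -> (forall e, e \in EC -> e \subset S) ->
  flat (Kset L EC S) col -> [set x; y] \in E -> x \notin S -> y \notin S ->
  col (ctr L x) = col (ctr L y).
Proof.
move=> M /subsetP sub hS hfl he hx hy.
have offb z p q : z \notin S -> ball_of L z p -> ~~ Kset L EC S p q.
  move=> hz hp; apply/negP => /KsetP[[e' he' /inedge_mem /andP[hm _]]|[v hv [hvp _]]].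
    by move: hz; rewrite (subsetP (hS _ he')) // (pth_ball M (sub _ he') hm hp).
  by rewrite -(ball_disj M hvp hp) hv in hz.
have cx z : ball_of L z (ctr L z) by exact: inb_center (rad_ge1 M z).
have ball z p : z \notin S -> ball_of L z p -> col (ctr L z) = col p.
  move=> hz hp; have [s [h1 h2 h3]] := ball_walk (cx z) hp.
  by rewrite -h2; apply: (flat_walk hfl h1) => a b ha _; exact: offb hz (h3 _ ha).
have offp p q : p \in pth L [set x; y] -> ~~ Kset L EC S p q.
  move=> hp; apply/negP => /KsetP[[e' he' /inedge_mem /andP[hm _]]|[v hv [hvp _]]].
    have e1 := pth_disj M (sub _ he') he hm hp.
    by move: hx; rewrite (subsetP (hS _ he')) // e1 set21.
  have := pth_ball M he hp hvp; rewrite !inE => /orP[]/eqP e1.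
    by rewrite -e1 hv in hx.
  by rewrite -e1 hv in hy.
have [px [qx [hpx _ _ /inedge_mem /andP[mx _] _]]] := out_edge M he (set21 x y).
have [py [qy [hpy _ _ /inedge_mem /andP[my _] _]]] := out_edge M he (set22 x y).
rewrite (ball x px) // (ball y py) //.
have [_ [_ [_ _ [p [t [es hp _ _ _]]]]]] := pth_ok M he.
have all_eq z : z \in pth L [set x; y] -> col z = col p.
  move=> hz; have hz' : z \in p :: t by rewrite -es.
  case/splitPl: hz' hp es => t1 t2 <-; rewrite cat_path => /andP[h1 _] es.
  by symmetry; apply: (flat_walk hfl h1) => a b ha _; apply: offp; rewrite es -cat_cons mem_cat ha.
by rewrite !all_eq.
Qed.

Lemma steps_dbl_inv s a b : (a, b) \in steps (dbl s) -> exists p q : pt, (p, q) \in steps s /\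
  ((a = dp p /\ b = mid p q) \/ (a = mid p q /\ b = dp q)).
Proof.
case: s => // p t; elim: t p => [|q t IH] p //.
have -> : dbl (p :: q :: t) = dp p :: mid p q :: dbl (q :: t) by [].
have [t' e] := dbl_cons q t.
rewrite steps_cons e steps_cons -e !in_cons => /or3P[/eqP[-> ->]|/eqP[-> ->]|/IH].
- by exists p, q; rewrite steps_cons mem_head; split=> //; left.
- by exists p, q; rewrite steps_cons mem_head; split=> //; right.
by case=> p' [q' [h1 h2]]; exists p', q'; rewrite steps_cons inE h1 orbT.
Qed.

(** The reason for doubling twice: a ball of radius 1 around the centre [(4 * f.1 + 2, 4 * f.2 + 2)]
    of a face contains no point with a coordinate divisible by 4, hence meets no path. *)
Lemma dbl2_on_line s z : sorted adjp s -> z \in dbl (dbl s) ->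
  exists k, z.1 = 4 * k \/ z.2 = 4 * k.
Proof.
move=> hs /mem_dbl[[p /mem_dbl[[q _ ->]|[a [b [hab ->]]]] ->]|[a [b [/steps_dbl_inv[p [q [hpq h]]] ->]]]].
- by exists q.1; left; rewrite /dp /=; lia.
- have := steps_adjp hs hab; rewrite /adjp => h.
  have [e|e] : a.1 = b.1 \/ a.2 = b.2 by move: h; lia.
    by exists a.1; left; rewrite /dp /mid /=; lia.
  by exists a.2; right; rewrite /dp /mid /=; lia.
have := steps_adjp hs hpq; rewrite /adjp => hadj.
have [e|e] : p.1 = q.1 \/ p.2 = q.2 by move: hadj; clear; lia.
  by exists p.1; left; case: h => -[-> ->]; rewrite /dp /mid /=; move: e; clear; lia.
by exists p.2; right; case: h => -[-> ->]; rewrite /dp /mid /=; move: e; clear; lia.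
Qed.

Lemma half_half (f : pt) : half (half (4 * f.1 + 2, 4 * f.2 + 2)) = f.
Proof. by case: f => a b; rewrite /half /=; congr (_, _); lia. Qed.

Section Gadget.
Variables (V : finType) (E : {set {set V}}) (L : layout V).
Hypothesis M : is_model E L.

(* The faces on both sides of the drawn edges; each of them receives a new vertex. *)
Definition side_faces : seq pt :=
  flatten [seq flatten [seq [:: side1 st.1 st.2; side2 st.1 st.2] | st <- steps (pth L e)]
          | e <- enum E].

Lemma side_facesP e p q f : e \in E -> inedge (pth L e) p q -> side_of p q f -> f \in side_faces.
Proof.
move=> he hin hf; have hpq := inedge_adjp (pth_sorted M he) hin.
case/hasP: hin => -[a b] hab /orP h.
have {}hf : side_of a b f.
  case: h => /eqP[-> ->] //; exact: side_of_sym hpq hf.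
apply/flattenP; exists (flatten [seq [:: side1 st.1 st.2; side2 st.1 st.2] | st <- steps (pth L e)]).
  by apply/mapP; exists e; rewrite ?mem_enum.
apply/flattenP; exists [:: side1 a b; side2 a b]; first by apply/mapP; exists (a, b).
by rewrite !inE; case: hf => ->; rewrite eqxx ?orbT.
Qed.

Lemma side_faces_outside f v : f \in side_faces -> ~~ fball L v f.
Proof.
case/flattenP => s /mapP[e]; rewrite mem_enum => he -> /flattenP[t /mapP[[a b] hab ->] hf].
have adj_ab := steps_adjp (pth_sorted M he) hab.
have hin : inedge (pth L e) a b by apply/hasP; exists (a, b) => //; rewrite /same_edge eqxx.
have hn : ~~ (ball_of L v a && ball_of L v b).
  by apply/negP => /andP[h1 h2]; exact: (inedge_not_ball M he hin h1 h2).
by have /andP[h1 h2] := out_side adj_ab hn; move: hf; rewrite !inE => /orP[]/eqP ->.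
Qed.

Definition gadget_vertex : finType := seq_sub side_faces.
Local Notation VW := (V + gadget_vertex)%type.

Definition up_edge (e : {set V}) : {set VW} := [set inl x | x in e].
Definition up_edges : {set {set VW}} := [set up_edge e | e in E].

Lemma inl_injective : injective (@inl V gadget_vertex).
Proof. by move=> x y []. Qed.

Definition dbl2 : layout V := refined (refined L finset.set0 [::]) finset.set0 [::].

(** Each new vertex sits in the middle of its face, without edges so far. *)
Definition gadget_layout : layout VW :=
  Layout (fun x => match x with inl v => ctr dbl2 v
                   | inr w => (4 * (val w).1 + 2, 4 * (val w).2 + 2) end)
         (fun x => match x with inl v => rad dbl2 v | inr _ => 1 end)
         (fun e => pth dbl2 [set x | inl x \in e]).

Lemma up_edgeK e : [set x | inl x \in up_edge e] = e.
Proof. by apply/setP => x; rewrite inE mem_imset //; exact: inl_injective. Qed.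

Lemma set0_notin : finset.set0 \notin E.
Proof. by apply/negP => /(model_simple M); rewrite cards0. Qed.

Lemma dbl2_model : is_model E dbl2.
Proof. exact: (refined_model (refined_model M _ set0_notin) _ set0_notin). Qed.

Lemma dbl2_pth e : e \in E -> pth dbl2 e = dbl (dbl (pth L e)).
Proof.
move=> he; rewrite /dbl2 /refined /=; have -> // : (e == finset.set0) = false.
by apply/negbTE; apply: contraTneq he => ->; exact: set0_notin.
Qed.

Lemma gadget_model : is_model up_edges gadget_layout.
Proof.
have M2 := dbl2_model.
have far (w : gadget_vertex) v p : ball_of gadget_layout (inr w) p ->
    ball_of gadget_layout (inl v) p -> False.
  have := side_faces_outside v (valP w).
  rewrite /fball /inface /ball_of /inb /gadget_layout /dbl2 /refined /dp /=.
  by move: (ctr L v) (rad L v) (ssval w) => [c d] r [a b] /=; clear; lia.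
split.
- by case=> [v|w] //=; exact: (rad_ge1 M2).
- case=> [u|w] [v|w'] p.
  + by move=> hu hv; congr inl; exact: (ball_disj M2 hu hv).
  + by move=> h1 h2; case: (far _ _ _ h2 h1).
  + by move=> h1 h2; case: (far _ _ _ h1 h2).
  move=> h1 h2; congr inr; apply: val_inj; move: h1 h2.
  rewrite /ball_of /inb /gadget_layout /=.
  move: (ssval w) (ssval w') => [a b] [c d] /= h1 h2.
  by congr (_, _); move: h1 h2; lia.
- move=> e' /imsetP[e he ->]; have [x [y [exy hxy ho]]] := pth_ok M2 he.
  exists (inl x), (inl y); split.
  + by rewrite exy /up_edge imsetU !imset_set1.
  + by apply: contra hxy => /eqP[->].
  have -> : pth gadget_layout (up_edge e) = pth dbl2 e by rewrite /= up_edgeK.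
  have [p [t [es h1 h2 h3 hz]]] := ho; exists p, t; split=> // z [v|w] hzin hb.
    by case: (hz z v hzin hb) => -[-> ->]; [left|right].
  exfalso; rewrite -es (dbl2_pth he) in hzin.
  have [k] := dbl2_on_line (pth_sorted M he) hzin.
  by move: hb; rewrite /ball_of /inb /gadget_layout /=; lia.
move=> e' f' z /imsetP[e he ->] /imsetP[f hf ->]; rewrite /= !up_edgeK => h1 h2.
by congr up_edge; exact: (pth_disj M2 he hf h1 h2).
Qed.

(** Chords of the cycle are included, so the set depends only on the vertices of the cycle; a tree
    path that avoids these vertices cannot use any of these edges. *)
Definition cyc_edges (c : seq V) : {set {set VW}} :=
  [set up_edge e | e in E & e \subset [set x in c]].
Definition cyc_verts (c : seq V) : {set VW} := [set inl x | x in [set x in c]].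

Lemma cyc_edges_sub c : cyc_edges c \subset up_edges.
Proof.
by apply/subsetP => e /imsetP[f]; rewrite inE => /andP[hf _] ->; apply/imsetP; exists f.
Qed.

Lemma cyc_edges_verts c e : e \in cyc_edges c -> e \subset cyc_verts c.
Proof.
case/imsetP => f; rewrite inE => /andP[_ hf] ->; exact: imsetS.
Qed.

(** Asking for some colouring, instead of the parity of the drawn cycle, makes the property pass to
    refined layouts by composition with [half]. *)
Definition separated (L' : layout VW) : Prop := forall c, is_cycle E c ->
  exists (w1 w2 : gadget_vertex) col, flat (Kset L' (cyc_edges c) (cyc_verts c)) col /\
    col (ctr L' (inr w1)) != col (ctr L' (inr w2)).

Lemma separated_refined L' e0 s0 : e0 \notin up_edges -> separated L' ->
  separated (refined L' e0 s0).
Proof.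
move=> he0 hs c hc; have [w1 [w2 [col [hf hne]]]] := hs c hc.
exists w1, w2, (col \o half); split.
  by apply: flat_refined => //; apply: contra he0; apply: (subsetP (cyc_edges_sub c)).
have hd p : half (dp p) = p by case: p => a b; rewrite /half /dp /=; congr (_, _); lia.
by rewrite /= !hd.
Qed.

(** The parity colouring of the cycle differs on the two sides of a grid edge of its first drawn
    edge, and both sides hold a new vertex. *)
Lemma separated_gadget : separated gadget_layout.
Proof.
move=> c [hsz hu hcyc].
case: c hsz hu hcyc => [|c1 [|c2 [|c3 rest]]] // _ hu hcyc.
set c := [:: c1, c2, c3 & rest].
have hE := model_simple M.
have /choice[ws hws] : forall e, exists w, e \in E -> edge_chain L e w.
  move=> e; have [he|he] := boolP (e \in E); last by exists [::].
  by have [w hw] := edge_chain_exists M he; exists w.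
pose es := [set c2; c3] :: edges_of c3 (rcons rest c1).
pose eC := [set c1; c2] :: es.
have eCE : eC = edges_of c1 (rcons [:: c2, c3 & rest] c1) by [].
have hpath : path (adj E) c1 (rcons [:: c2, c3 & rest] c1) by exact: hcyc.
have heC : {subset eC <= E} by rewrite eCE; exact: edges_of_sub.
have cC : closed_edges eC.
  by move=> h; rewrite eCE (edges_of_sum h hE hpath) last_rcons addbb.
have h12 : [set c1; c2] \in E by apply: heC; rewrite mem_head.
have eCS e : e \in eC -> e \subset [set x in c].
  rewrite eCE => he; apply/subsetP => x /(edges_of_mem he).
  by rewrite -rcons_cons mem_rcons [X in _ -> is_true X]inE in_cons => /orP[/eqP->|//]; rewrite mem_head.
have h12n : [set c1; c2] \notin es.
  have /and3P[+ + _] : [&& c1 \notin [:: c2, c3 & rest], c2 \notin c3 :: rest & true].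
    by move: hu => /= /and3P[-> -> _].
  rewrite !inE !negb_or => /and3P[n12 n13 _] /andP[n23 n2].
  apply/andP; split.
    apply/eqP => e; have : c1 \in [set c2; c3] by rewrite -e set21.
    by rewrite !inE (negbTE n12) (negbTE n13).
  apply/negP => he; have := edges_of_mem he (set22 c1 c2).
  by rewrite inE mem_rcons inE (negbTE n23) (negbTE n2) eq_sym (negbTE n12).
have [p [q [_ _ hpq hin _]]] := out_edge M h12 (set21 c1 c2).
have dC := chain_dif M hws heC cC (erefl eC) h12n hin.
have m1 : side1 p q \in side_faces by apply: (side_facesP h12 hin); left.
have m2 : side2 p q \in side_faces by apply: (side_facesP h12 hin); right.
exists (SeqSub m1), (SeqSub m2), ((chain_par ws eC \o half) \o half).
pose EF := [set e in E | e \subset [set x in c]].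
have n0 : finset.set0 \notin EF by rewrite inE (negbTE set0_notin).
have fl0 : flat (Kset L EF [set x in c]) (chain_par ws eC).
  move=> a b hab hn; apply: (chain_flat hws heC cC hab); apply: contra hn.
  case/KsetP => [[e he h]|[v /endsP[e he hv] h]]; apply/KsetP.
    by left; exists e => //; rewrite inE in he; rewrite inE heC ?eCS.
  by right; exists v => //; exact: (subsetP (eCS _ he)).
have fl2 := flat_refined (s0 := [::]) n0 (flat_refined (s0 := [::]) n0 fl0).
split.
  move=> a b hab hn; apply: fl2 => //; apply: contra hn => /KsetP[[e he h]|[v hv h]]; apply/KsetP.
    left; exists (up_edge e); first by apply/imsetP; exists e.
    by rewrite /= up_edgeK.
  by right; exists (inl v) => //; apply/imsetP; exists v.
have -> : ((chain_par ws eC \o half) \o half) (ctr gadget_layout (inr (SeqSub m1))) =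
    chain_par ws eC (side1 p q) by exact: (congr1 (chain_par ws eC) (half_half _)).
have -> : ((chain_par ws eC \o half) \o half) (ctr gadget_layout (inr (SeqSub m2))) =
    chain_par ws eC (side2 p q) by exact: (congr1 (chain_par ws eC) (half_half _)).
move: dC; rewrite /dif.
by case: (chain_par _ _ (side1 p q)); case: (chain_par _ _ (side2 p q)).
Qed.

End Gadget.

(** * From robust connectivity to induced forests *)

Lemma inner_not_leaf (V : finType) (T : {set {set V}}) x p z :
  path (adj T) x p -> uniq (x :: p) -> z \in p -> z != last x p -> z \notin leaves T.
Proof.
move=> hp hu hz; case/splitPr: hz hp hu => p1 [|b p2]; first by rewrite last_cat /= eqxx.
rewrite cat_path /= => /and4P[_ haz hzb _] hu _.
rewrite inE; apply/eqP => h1.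
have /eqP/cards1P[e he] := h1.
have e1 : [set last x p1; z] \in [set e in T | z \in e] by rewrite inE set22 andbT.
have e2 : [set z; b] \in [set e in T | z \in e] by rewrite inE set21 andbT.
move: e1 e2; rewrite he !inE => /eqP e1 /eqP e2.
have : b \in [set last x p1; z] by rewrite e1 -e2 set22.
have : uniq ((x :: p1) ++ [:: z, b & p2]) by [].
rewrite !inE cat_uniq => /and3P[_ /hasPn h3 /= /andP[h4 _]].
case/orP => /eqP eb.
  have /h3/negP : b \in [:: z, b & p2] by rewrite !inE eqxx orbT.
  by apply; rewrite eb; exact: mem_last.
by move: h4; rewrite -eb mem_head.
Qed.

Lemma robust_to_forest (R : realType) :
  (forall (V : finType) (E : {set {set V}}), (1 < #|V|)%N -> planar_triangulation R E ->
      (2%:R^-1 <= robust_connectivity E :> rat)) ->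
  forall (V : finType) (E : {set {set V}}), simple_graph E -> planar R E ->
      exists F : {set V}, induces_forest E F /\ (#|V|%:R / 2%:R <= #|F|%:R :> rat).
Proof.
move=> hB V E hE hpl.
(* With at most one vertex the whole graph serves; otherwise the graph to which (B) is applied has
   more than one vertex, as (B) requires. *)
have [hV|hV] := leqP #|V| 1.
  exists [set: V]; split; last first.
    by rewrite cardsT ler_pdivrMr // ler_peMr ?ler0n.
  move=> c [h1 h2 _]; have := max_card (mem c); move/card_uniqP: h2 => -> h3.
  by have := leq_trans h1 (leq_trans h3 hV).
have [L M] := planar_model hpl hE.
pose VW : finType := (V + gadget_vertex E L)%type.
pose P (E' : {set {set VW}}) := (up_edges E L \subset E') &&
  `[< exists2 L', is_model E' L' & @separated V E L L' >].
have P0 : P (up_edges E L).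
  rewrite /P subxx; apply/asboolP; exists (gadget_layout E L); first exact: gadget_model.
  exact: separated_gadget.
case: (arg_maxnP (fun E' : {set {set VW}} => #|E'|) P0) => E' /andP[sub /asboolP[L' M' sep]] hmax.
(* An edge that could be drawn in [L'] would keep the layout separated, by [separated_refined],
   against the choice of [E'] with the most edges. *)
have hsep : cyclic_separators E'.
  case: (cyclic_separators_or_extend M') => // -[a [b [s [hab he M'']]]].
  have /hmax : P ([set a; b] |: E').
    rewrite /P (subset_trans sub (subsetUr _ _)); apply/asboolP.
    exists (refined L' [set a; b] s) => //; apply: separated_refined => //.
    by apply: contra he; exact: (subsetP sub).
  by rewrite cardsU1 he /= => h; exfalso; move: h; rewrite /geq /=; lia.
have hE' := model_simple M'.
(* Maximality has to hold for every drawing of the extended graph, not only for those extending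
   [L']; hence the detour through [cyclic_separators]. *)
have tri : planar_triangulation R E'.
  split=> //; first exact: model_planar M'.
  move=> e he hne hp.
  have /eqP/cards2P[u [v [huv euv]]] := he; rewrite euv in hne hp.
  have hs : simple_graph ([set u; v] |: E').
    by move=> f; rewrite in_setU1 => /orP[/eqP->|/hE' //]; rewrite cards2 huv.
  have [L'' M''] := planar_model hp hs.
  exact: (cyclic_separators_maximal hE' hsep huv hne M'').
have hcard : (1 < #|VW|)%N by rewrite card_sum (leq_trans hV) // leq_addr.
have := hB VW E' hcard tri.
pose X : {set VW} := [set inl x | x in [set: V]].
have cX : #|X| = #|V| by rewrite card_imset ?cardsT //; exact: inl_injective.
have X0 : X != finset.set0 by rewrite -card_gt0 cX ltnW.
rewrite /robust_connectivity => hr.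
have {}hr := le_trans hr (bigmin_le_cond 1 (fun X : {set VW} =>
  \big[Order.max/0]_(T in spanning_trees E') (#|X :&: leaves T|%:R / #|X|%:R)) X0).
(* If all ratios were below 1/2, so would be their maximum, its initial value 0 included. *)
have [T hT hl] : exists2 T, T \in spanning_trees E' & 2%:R^-1 <= #|X :&: leaves T|%:R / #|X|%:R :> rat.
  apply: contrapT => hno; move: hr; rewrite leNgt => /negP; apply.
  elim/big_ind: _ => // [x y hx hy|T hT]; first by rewrite gt_max hx hy.
  by rewrite ltNge; apply/negP => h; apply: hno; exists T.
pose F := [set v | inl v \in leaves T] : {set V}.
have cF : #|X :&: leaves T| = #|F|.
  rewrite -(card_imset _ (@inl_injective V E L)); apply: eq_card => x.
  rewrite inE; apply/andP/imsetP => [[/imsetP[v _ ->] h]|[v hv ->]].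
    by exists v => //; rewrite inE.
  by split; [apply/imsetP; exists v | move: hv; rewrite inE].
exists F; split; last first.
  move: hl; rewrite cF cX ler_pdivlMr; first by rewrite mulrC.
  by rewrite ltr0n ltnW.
move=> c [h1 h2 h3].
have hc : is_cycle E c.
  split=> //; case: c h3 {h1 h2} => // x s.
  by apply: sub_path => a b; rewrite {1}/adj inE => /andP[].
have cFs x : x \in c -> x \in F.
  by move=> hx; have := next_cycle h3 hx; rewrite /adj inE subUset sub1set => /andP[_ /andP[]].
have [w1 [w2 [col [hfl hne]]]] := sep c hc.
have [_ /asboolP[hconn _]] : T \subset E' /\ `[< is_tree T >] by move: hT; rewrite inE => /andP.
have subT : T \subset E' by move: hT; rewrite inE => /andP[].
have /connectP[p0 hp0 ep0] := hconn (inr w1) (inr w2).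
case/shortenP: hp0 ep0 => p hp hu _ ep.
have sub1 := subset_trans (cyc_edges_sub E L c) sub.
have inS (z : VW) : z \in cyc_verts E L c -> z \in leaves T /\ exists x, z = inl x.
  case/imsetP => x; rewrite inE => /cFs hx ->; split; last by exists x.
  by move: hx; rewrite inE.
(* The ends of the tree path are new vertices, so a vertex of the cycle on it would be an inner one
   and no leaf. *)
have off z : z \in inr w1 :: p -> z \notin cyc_verts E L c.
  rewrite in_cons => hz; apply/negP => /inS[hzl [x ex]].
  case/orP: hz => [/eqP e|hz]; first by rewrite ex in e.
  suff : z \notin leaves T by rewrite hzl.
  apply: inner_not_leaf hp hu hz _; rewrite -ep ex.
  by apply/eqP.
have walk q (z : VW) : path (adj T) z q -> (forall y, y \in z :: q -> y \notin cyc_verts E L c) ->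
    col (ctr L' z) = col (ctr L' (last z q)).
  elim: q z => [|y q IH] z //= /andP[hzy hq] hoff.
  rewrite -IH //; last by move=> x hx; apply: hoff; rewrite inE hx orbT.
  apply: (flat_edge M' sub1 (@cyc_edges_verts _ _ _ c) hfl).
  - exact: (subsetP subT).
  - by apply: hoff; rewrite mem_head.
  by apply: hoff; rewrite !inE eqxx orbT.
by move: hne; rewrite (walk p (inr w1) hp off) -ep eqxx.
Qed.

(** The condition [1 < #|V|] excludes the one-vertex triangulation: its only spanning tree has no
    edge and hence no vertex of degree one, which makes the robust connectivity 0. *)
Theorem theorem4 (R : realType) :
  (forall (V : finType) (E : {set {set V}}),
      simple_graph E -> planar R E ->
      exists F : {set V},
        induces_forest E F /\ (#|V|%:R / 2%:R <= #|F|%:R :> rat))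
  <->
  (forall (V : finType) (E : {set {set V}}),
      (1 < #|V|)%N -> planar_triangulation R E ->
      (2%:R^-1 <= robust_connectivity E :> rat)).
Proof. split; [exact: forest_to_robust | exact: robust_to_forest]. Qed.
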